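(* Let $\Omega\subset\mathbb{C}$ be a nonempty bounded open set. There exist functions $f_1,f_2,f_3\in\mathcal{C}^\infty(\overline\Omega)$ and a compact set $K\subset\Omega$ such that, with $f=(f_1,f_2,f_3)$, the following hold: (1) $\mathcal{G}_f(\overline\Omega)$ is polynomially convex; (2) the Shilov boundary of $[z,f]_{\overline\Omega}$ is $\overline\Omega$, so in particular there is no disk in $\Omega$ on which all the $f_j$ are holomorphic; (3) $\{g\in\mathcal{C}(\overline\Omega): g|_K\in\mathcal{R}(K)\}\subset[z,f]_{\overline\Omega}$; and (4) $[z,f]_{\overline\Omega}\neq\mathcal{C}(\overline\Omega)$.
   Context: $\mathcal{C}(X)$ is the algebra of continuous complex-valued functions on a compact space $X$. $\mathcal{C}^\infty(\overline\Omega)$ denotes complex-valued functions on $\overline\Omega$ that are $\mathcal{C}^\infty$-smooth up to the boundary (restrictions to $\overline\Omega$ of $\mathcal{C}^\infty$ functions on a neighborhood of $\overline\Omega$). $[z,f]_{\overline\Omega}$ is the uniform algebra on $\overline\Omega$ generated by the coordinate function $z$ and $f_1,f_2,f_3$, i.e. the uniform closure of the polynomials in $z,f_1,f_2,f_3$. $\mathcal{G}_f(\overline\Omega)=\{(z,f(z)): z\in\overline\Omega\}\subset\mathbb{C}^4$. $\mathcal{R}(K)$ is the uniform closure on $K$ of the rational functions holomorphic on a neighborhood of $K$. *)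

(* Defs.v *)
From mathcomp Require Import all_boot all_order all_algebra.
From mathcomp Require Import all_classical all_reals all_analysis.
From mathcomp Require Import complex.
(* The notations of mpoly clash with those of MathComp-Analysis. *)
From mathcomp Require mpoly.
Import -(notations) mpoly.

Set Implicit Arguments.
Unset Strict Implicit.
Unset Printing Implicit Defensive.

Import Order.TTheory GRing.Theory Num.Theory.
Import numFieldNormedType.Exports.

Local Open Scope classical_set_scope.
Local Open Scope ring_scope.
Local Open Scope complex_scope.

(* Typing R[i] as a numClosedFieldType lets it inherit the topology and the
   normed space structure over itself that every numFieldType carries. *)
Definition Cplx (R : realType) : numClosedFieldType := R[i].

(* The modulus as an element of R; the generic norm takes its values in C. *)
Definition cabs (R : realType) (z : Cplx R) : R := complex.Re `|z|.

(* Functions on a subset X of C are represented by total functions C -> C whose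
   values outside X are irrelevant: each of the sets of functions "on X" below
   contains, along with g, every function that agrees with g on X. *)

Definition cont_fun (R : realType) (X : set (Cplx R)) :
    set (Cplx R -> Cplx R) :=
  [set g | {within X, continuous g}].

Definition unif_closure (R : realType) (X : set (Cplx R))
    (F : set (Cplx R -> Cplx R)) : set (Cplx R -> Cplx R) :=
  [set g | forall e : R, 0 < e ->
     exists2 h, F h & forall z, X z -> cabs (g z - h z) < e].

(* l is the derivative at z of F along v, in the real sense:
   the increment h is real. *)
Definition is_real_derive (R : realType) (v : Cplx R)
    (F : Cplx R -> Cplx R) (z l : Cplx R) : Prop :=
  (fun h : R => (F (z + h%:C * v) - F z) / (h%:C : Cplx R)) @ (0 : R)^' --> l.

(* F is of class C^k, in the real sense, on the open set U: all its iterated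
   partial derivatives d/dx, d/dy of order at most k exist and are continuous. *)
Fixpoint Ck_on (R : realType) (k : nat) (U : set (Cplx R))
    (F : Cplx R -> Cplx R) : Prop :=
  (forall z, U z -> {for z, continuous F}) /\
  if k is k'.+1 then
    exists Fx Fy : Cplx R -> Cplx R,
      [/\ forall z, U z -> is_real_derive 1 F z (Fx z),
          forall z, U z -> is_real_derive (0 +i* 1) F z (Fy z),
          Ck_on k' U Fx & Ck_on k' U Fy]
  else True.

Definition smooth_on (R : realType) (U : set (Cplx R))
    (F : Cplx R -> Cplx R) : Prop :=
  forall k, Ck_on k U F.

Definition smooth_up_to_boundary (R : realType) (Omega : set (Cplx R))
    (f : Cplx R -> Cplx R) : Prop :=
  exists (U : set (Cplx R)) (F : Cplx R -> Cplx R),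
    [/\ open U, closure Omega `<=` U, smooth_on U F &
        forall z, closure Omega z -> f z = F z].

Definition holomorphic_on (R : realType) (U : set (Cplx R))
    (f : Cplx R -> Cplx R) : Prop :=
  forall z, U z -> derivable f z 1.

Definition polyval (R : realType) (n : nat) (p : mpoly n (Cplx R))
    (v : 'rV[Cplx R]_n) : Cplx R :=
  meval (fun i => v ord0 i) p.

(* The point (z, f_1(z), ..., f_m(z)) of C^(m+1). *)
Definition graph_point (R : realType) (m : nat)
    (f : 'I_m -> Cplx R -> Cplx R) (z : Cplx R) : 'rV[Cplx R]_m.+1 :=
  \row_i (if unlift ord0 i is Some j then f j z else z).

Definition graph (R : realType) (m : nat) (f : 'I_m -> Cplx R -> Cplx R)
    (X : set (Cplx R)) : set 'rV[Cplx R]_m.+1 :=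
  graph_point f @` X.

Definition poly_hull (R : realType) (n : nat) (X : set 'rV[Cplx R]_n) :
    set 'rV[Cplx R]_n :=
  [set v | forall p : mpoly n (Cplx R),
     cabs (polyval p v) <= sup [set cabs (polyval p w) | w in X]].

Definition polynomially_convex (R : realType) (n : nat)
    (X : set 'rV[Cplx R]_n) : Prop :=
  compact X /\ poly_hull X = X.

(* The uniform algebra [z, f_1, ..., f_m]_X. *)
Definition generated_algebra (R : realType) (m : nat)
    (f : 'I_m -> Cplx R -> Cplx R) (X : set (Cplx R)) :
    set (Cplx R -> Cplx R) :=
  unif_closure X
    [set h | exists p : mpoly m.+1 (Cplx R),
       h = fun z => polyval p (graph_point f z)].

(* The uniform algebra R(K). *)
Definition rational_algebra (R : realType) (K : set (Cplx R)) :
    set (Cplx R -> Cplx R) :=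
  unif_closure K
    [set h | exists (p q : {poly Cplx R}) (U : set (Cplx R)),
       [/\ open U, K `<=` U, forall z, U z -> q.[z] != 0 &
           h = fun z => p.[z] / q.[z]]].

(* E is a closed subset of X on which every member of A attains its maximum
   modulus over X. *)
Definition closed_boundary (R : realType) (X : set (Cplx R))
    (A : set (Cplx R -> Cplx R)) (E : set (Cplx R)) : Prop :=
  [/\ closed E, E `<=` X &
      forall g, A g -> exists2 x, E x & forall y, X y -> cabs (g y) <= cabs (g x)].

Definition is_shilov_boundary (R : realType) (X : set (Cplx R))
    (A : set (Cplx R -> Cplx R)) (E : set (Cplx R)) : Prop :=
  closed_boundary X A E /\
  forall E', closed_boundary X A E' -> E `<=` E'.

(* Main.v *)
(* K is a Swiss cheese: a closed disc in Omega with a dense sequence of disjoint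
   open discs D(a n, r n) removed, the radii being so small that R(K) <> C(K).
   Three generators suffice besides z.  F1 is a smooth extension of
   sum_n c n / (z - a n), with c n decreasing so fast that multiplying by Lagrange
   factors recovers every 1/(z - a n) on K, hence all of R(K).  The other two are
   rho and rho * conj z, where rho >= 0 is smooth and vanishes exactly on K: by
   Stone-Weierstrass they generate, together with z, all continuous functions
   vanishing on K.  So the algebra is { g : g|K in R(K) }.

   Polynomial convexity: at a hull point off the graph every function vanishing
   on K is sent to 0, so the point lies over K, where division by z - z0 inside
   R(K) forces it onto the graph.  Shilov boundary: bump functions peak off K and
   1/(z - w), with w a hole close to x, almost peaks at x in K.  Properness: a
   measure on the boundary circles of the cheese annihilates R(K) but not conj z;
   integrals over circles are replaced by averages over 2^m-th roots. *)

Require Import Defs.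
From mathcomp Require Import all_boot all_order all_algebra.
From mathcomp Require Import all_classical all_reals all_analysis.
From mathcomp Require Import complex.
From mathcomp Require Import ring lra zify.
From mathcomp Require mpoly.
Import -(notations) mpoly.
Set Implicit Arguments.
Unset Strict Implicit.
Unset Printing Implicit Defensive.
Import Order.TTheory GRing.Theory Num.Theory.
Import numFieldNormedType.Exports.
Local Open Scope classical_set_scope.
Local Open Scope ring_scope.
Local Open Scope complex_scope.

(** * The complex plane as a normed space *)

(** Circle integrals are sampled at 2^m-th roots because halving turns [w / (w - b)] into the same
    expression for the squares: the mean of a simple pole has a closed form, which converges to a
    winding number. Only simple poles are computed this way, so properness also requires that every
    element of the algebra on K be a uniform limit of sums of simple poles with poles off K. The
    radii start at [R0 / 8] so that the holes together are too small to cancel the mean of conj over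
    the outer circle. Smoothness is witnessed by one class of functions per disc that is closed
    under both partial derivatives. All generators are series over these classes with a common
    coefficient sequence, which may be shrunk for two purposes at once: convergence of all
    derivatives, and recovery of single poles by interpolation. The passage from K to the closure of
    Omega rests on one remark: a continuous function of modulus at most eta on K is within eta of a
    continuous function that vanishes on K. *)

Section Modulus.
Variable R : realType.
Implicit Types z w : Cplx R.

Lemma normE z : `|z| = (cabs z)%:C.
Proof. by rewrite /cabs normc_def. Qed.

Lemma cabsE z : cabs z = Num.sqrt (complex.Re z ^+ 2 + complex.Im z ^+ 2).
Proof. by rewrite /cabs normc_def. Qed.

Lemma cabs_ge0 z : 0 <= cabs z.
Proof. by rewrite cabsE sqrtr_ge0. Qed.

Lemma sqr_cabs z : cabs z ^+ 2 = complex.Re z ^+ 2 + complex.Im z ^+ 2.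
Proof. by rewrite cabsE sqr_sqrtr // addr_ge0 ?sqr_ge0. Qed.

Lemma cabsM z w : cabs (z * w) = cabs z * cabs w.
Proof. by apply: complexI; rewrite rmorphM /= -!normE normrM. Qed.

Lemma cabsN z : cabs (- z) = cabs z.
Proof. by rewrite /cabs normrN. Qed.

Lemma cabsV z : cabs z^-1 = (cabs z)^-1.
Proof. by apply: complexI; rewrite fmorphV /= -!normE normfV. Qed.

Lemma cabsX z n : cabs (z ^+ n) = cabs z ^+ n.
Proof. by apply: complexI; rewrite rmorphXn /= -!normE normrX. Qed.

Lemma cabs_eq0 z : (cabs z == 0) = (z == 0).
Proof. by rewrite -[z == 0]normr_eq0 (normE z) -(inj_eq (@complexI R)). Qed.

Lemma cabs0 : cabs (0 : Cplx R) = 0.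
Proof. by apply/eqP; rewrite cabs_eq0. Qed.

Lemma cabs1 : cabs (1 : Cplx R) = 1.
Proof. by rewrite /cabs normr1. Qed.

Lemma cabs_gt0 z : (0 < cabs z) = (z != 0).
Proof. by rewrite lt_def cabs_ge0 andbT cabs_eq0. Qed.

Lemma cabs_dist z w : cabs (z - w) = cabs (w - z).
Proof. by rewrite -opprB cabsN. Qed.

Lemma ler_cabsD z w : cabs (z + w) <= cabs z + cabs w.
Proof. by rewrite -lecR rmorphD /= -!normE ler_normD. Qed.

Lemma ler_cabsB z w : cabs (z - w) <= cabs z + cabs w.
Proof. by rewrite -(cabsN w) ler_cabsD. Qed.

Lemma ler_cabs_dist z w t : cabs (z - t) <= cabs (z - w) + cabs (w - t).
Proof. by rewrite -(subrKA w) ler_cabsD. Qed.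

Lemma lerB_cabs z w : cabs z - cabs w <= cabs (z - w).
Proof. by rewrite lerBlDr -{1}(subrK w z) ler_cabsD. Qed.

Lemma cabs_real (x : R) : cabs (x%:C : Cplx R) = `|x|.
Proof. by rewrite cabsE /= expr0n addr0 sqrtr_sqr. Qed.

Lemma cabs_conj z : cabs (conjc z : Cplx R) = cabs z.
Proof. by rewrite /cabs normcJ. Qed.

Lemma ler_Re_cabs z : `|complex.Re z| <= cabs z.
Proof.
by rewrite -(ler_pXn2r (n:=2)) ?nnegrE ?cabs_ge0 // sqr_cabs real_normK ?num_real// lerDl sqr_ge0.
Qed.

Lemma ler_Im_cabs z : `|complex.Im z| <= cabs z.
Proof.
by rewrite -(ler_pXn2r (n:=2)) ?nnegrE ?cabs_ge0 // sqr_cabs real_normK ?num_real// lerDr sqr_ge0.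
Qed.

Lemma ler_cabs_ReIm z : cabs z <= `|complex.Re z| + `|complex.Im z|.
Proof.
rewrite -(ler_pXn2r (n:=2)) ?nnegrE ?cabs_ge0 ?addr_ge0// sqr_cabs sqrrD !real_normK ?num_real//.
by rewrite lerD2r lerDl mulrn_wge0// mulr_ge0.
Qed.

Lemma ler_cabs_sum (I : Type) (s : seq I) (P : pred I) (F : I -> Cplx R) :
  cabs (\sum_(i <- s | P i) F i) <= \sum_(i <- s | P i) cabs (F i).
Proof.
elim/big_rec2: _ => [|i y x _ h]; first by rewrite cabs0.
by rewrite (le_trans (ler_cabsD _ _))// lerD2l.
Qed.

Lemma mul_conjc_cabs z : z * (conjc z : Cplx R) = (cabs z ^+ 2)%:C.
Proof. by rewrite sqr_cabs; case: z => x y /=; apply/eqP; rewrite eq_complex /=; apply/andP; split; apply/eqP; ring. Qed.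

Lemma nbhs_cplxP z (A : set (Cplx R)) :
  nbhs z A <-> exists2 d : R, 0 < d & forall w, cabs (w - z) < d -> A w.
Proof.
split.
  move=> /nbhs_ballP[e /= e0 h]; exists (complex.Re e).
    by move: e0; rewrite ltcE => /andP[].
  move=> w wz; apply: h; rewrite -ball_normE /ball_ /=.
  have -> : e = (complex.Re e)%:C.
    by move: e0; rewrite ltcE => /andP[/= /eqP + _]; case: (e) => a b /= ->.
  by rewrite normE ltcR cabs_dist.
move=> [d d0 h]; apply/nbhs_ballP; exists (d%:C) => /=; first by rewrite ltcR.
move=> w; rewrite -ball_normE /ball_ /= normE ltcR cabs_dist; exact: h.
Qed.

Lemma ball_cplxE z (d : R) w : ball z (d%:C : Cplx R) w <-> cabs (w - z) < d.
Proof. by rewrite -ball_normE /ball_ /= normE ltcR cabs_dist. Qed.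

Lemma cvg_cplxP (T : Type) (F : set_system T) (FF : Filter F)
    (g : T -> Cplx R) l :
  (g @ F --> l) <-> (forall e : R, 0 < e -> \forall t \near F, cabs (g t - l) < e).
Proof.
split.
  move=> h e e0; have : nbhs l [set w | cabs (w - l) < e].
    by apply/nbhs_cplxP; exists e.
  by move=> /h.
by move=> h A /nbhs_cplxP[d d0 hd]; apply: filterS (h d d0) => t; exact: hd.
Qed.

Lemma continuous_cplxP (g : Cplx R -> Cplx R) z :
  {for z, continuous g} <-> (forall e : R, 0 < e -> exists2 d : R, 0 < d &
    forall w, cabs (w - z) < d -> cabs (g w - g z) < e).
Proof.
rewrite /continuous_at; split.
  by move=> /cvg_cplxP h e /h /nbhs_cplxP.
by move=> h; apply/cvg_cplxP; [exact: nbhs_filter|move=> e /h /nbhs_cplxP].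
Qed.

Lemma open_cplxP (A : set (Cplx R)) :
  open A <-> forall z, A z -> exists2 d : R, 0 < d & forall w, cabs (w - z) < d -> A w.
Proof.
rewrite openE; split.
  by move=> h z /h /nbhs_cplxP.
by move=> h z /h /nbhs_cplxP.
Qed.

Lemma open_cdisc (a : Cplx R) (r : R) : open [set z | cabs (z - a) < r].
Proof.
apply/open_cplxP => z /= zr; exists (r - cabs (z - a)); first by rewrite subr_gt0.
by move=> w; rewrite ltrBrDr; apply: le_lt_trans; rewrite ler_cabs_dist.
Qed.

Lemma closed_cdisc (a : Cplx R) (r : R) : closed [set z | cabs (z - a) <= r].
Proof.
rewrite -openC; apply/open_cplxP => z /= /negP; rewrite -ltNge => zr.
exists (cabs (z - a) - r); first by rewrite subr_gt0.
move=> w wz; apply/negP; rewrite -ltNge.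
have := ler_cabs_dist z w a; rewrite (cabs_dist z w); lra.
Qed.

Lemma closure_cplxP (A : set (Cplx R)) z :
  closure A z <-> forall d : R, 0 < d -> exists2 w, A w & cabs (w - z) < d.
Proof.
split.
  move=> h d d0; have /h[w [Aw wz]] : nbhs z [set w | cabs (w - z) < d].
    by apply/nbhs_cplxP; exists d.
  by exists w.
by move=> h B /nbhs_cplxP[d /h[w Aw wz] hB]; exists w; split => //; apply: hB.
Qed.

Lemma bounded_cplxP (A : set (Cplx R)) :
  bounded_set A -> exists2 M : R, 0 < M & forall z, A z -> cabs z <= M.
Proof.
move=> [M [Mr h]].
exists (Num.max 1 (complex.Re M + 1)); first by rewrite lt_max ltr01.
move=> z Az; have := h ((Num.max 1 (complex.Re M + 1))%:C); rewrite /= -/(Cplx R).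
move: Mr => /complex_realP[k Mk]; rewrite {}Mk ltcR /= lt_max ltrDl ltr01 orbT.
by move=> /(_ isT z Az); rewrite normE lecR.
Qed.

End Modulus.

(** * Compactness as an induction principle, and Heine-Borel in the plane *)

Section Compactness.

(** If [P A] failed, the sets whose complement in [A] satisfies [P] would form a proper filter
    containing [A], and the local hypothesis rules out a cluster point in [A]. This stands in for
    finite subcovers: a property is proved near each point and glued along unions. *)
Lemma compact_ind (T : topologicalType) (A : set T) (P : set T -> Prop) :
  P set0 -> (forall S S', S `<=` S' -> P S' -> P S) ->
  (forall S S', P S -> P S' -> P (S `|` S')) ->
  (forall x, A x -> exists2 U, nbhs x U & P (U `&` A)) ->
  compact A -> P A.
Proof.
move=> P0 PS PU loc cA; apply: contrapT => nPA.
pose F : set_system T := [set S | P (A `\` S)].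
have FF : ProperFilter F.
  apply: Build_ProperFilter_ex.
    move=> S FS; apply: contrapT => nS; apply: nPA.
    by apply: PS FS => x Ax; split => // Sx; apply: nS; exists x.
  split.
  - by apply: PS P0 => x [_]; apply.
  - move=> S S' h h'; apply: PS (PU _ _ h h') => x [Ax] /not_andP[]; by [left|right].
  - by move=> S S' h; apply: PS => x [Ax nS']; split=> // /h.
have FA : F A by apply: PS P0 => x [].
have [x [Ax clx]] := cA F FF FA.
have [U Ux PU'] := loc x Ax.
have FU : F (~` U) by apply: PS PU' => y [Ay /contrapT].
by have [y [nU yU]] := clx _ _ FU Ux.
Qed.

Variable R : realType.

Lemma continuous_Complex : continuous (fun p : R * R => (p.1 +i* p.2 : Cplx R)).
Proof.
move=> [x y] /=; apply/cvg_cplxP => e e0.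
have e20 : 0 < e / 2 by rewrite divr_gt0.
near=> p.
have h1 : `|x - p.1| < e / 2.
  by near: p; exact: (iffLR (cvgrPdist_lt _ _) (@cvg_fst R R (nbhs x) (nbhs y) _)).
have h2 : `|y - p.2| < e / 2.
  by near: p; exact: (iffLR (cvgrPdist_lt _ _) (@cvg_snd R R (nbhs x) (nbhs y) _)).
rewrite (le_lt_trans (ler_cabs_ReIm _))//= (distrC p.1) (distrC p.2).
by rewrite [e]splitr ltrD.
Unshelve. all: by end_near.
Qed.

Lemma compact_cplx (A : set (Cplx R)) (M : R) :
  closed A -> (forall z, A z -> cabs z <= M) -> compact A.
Proof.
move=> cA bA.
have cI : compact `[(- M), M]%classic by exact: segment_compact.
have cS := compact_setX cI cI.
apply: (subclosed_compact cA (continuous_compact (f:=fun p : R * R => (p.1 +i* p.2 : Cplx R)) _ cS)).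
  exact/continuous_subspaceT/continuous_Complex.
move=> z Az; exists (complex.Re z, complex.Im z); last by case: z Az.
split; rewrite /= in_itv /= -ler_norml.
  exact: le_trans (ler_Re_cabs z) (bA _ Az).
exact: le_trans (ler_Im_cabs z) (bA _ Az).
Qed.

End Compactness.

(** * The Stone-Weierstrass theorem *)

Section StoneWeierstrass.
Variables (R : realType) (T : topologicalType).

Definition continuous_on (X : set T) (g : T -> R) :=
  forall x, X x -> forall e : R, 0 < e ->
    \forall y \near x, X y -> `|g y - g x| < e.

Lemma continuous_on_bounded (X : set T) (g : T -> R) :
  compact X -> continuous_on X g ->
  exists2 M : R, 0 < M & forall x, X x -> `|g x| <= M.
Proof.
move=> cX cg.
pose P S := exists2 M : R, 0 < M & forall x, S x -> X x -> `|g x| <= M.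
suff [M M0 h] : P X.
  by exists M => // x Xx; exact: h.
apply: (compact_ind (A := X) (P := P)) => //.
- by exists 1.
- by move=> S S' SS' [M M0 h]; exists M => // x /SS'; exact: h.
- move=> S S' [M M0 h] [M' M0' h']; exists (Num.max M M'); first by rewrite lt_max M0.
  move=> x [Sx|Sx] Xx; rewrite le_max; first by rewrite h.
  by rewrite (h' x) // orbT.
- move=> x Xx; exists [set y | X y -> `|g y - g x| < 1]; first exact: cg.
  exists (`|g x| + 1) => [|y [h Xy] _]; first by rewrite ltr_wpDl.
  by rewrite -lerBlDl (le_trans (lerB_dist _ _))// ltW// h.
Qed.

(** The classical iteration increasing to the square root of [s] on [0, 1]. Each stage is a
    polynomial in [s], so at [s = g ^+ 2] it stays in any algebra containing [g] and approximates
    the absolute value of [g]. *)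
Fixpoint abs_approx (n : nat) (s : R) : R :=
  if n is n'.+1 then
    abs_approx n' s + (s - abs_approx n' s ^+ 2) / 2
  else 0.

(** One step multiplies the error by [1 - (t + q) / 2], at most [1 - t / 2], and [(1 - t / 2) * (2 +
    (n + 1) * t) <= 2 + n * t]. The third bound makes the error at most [2 / n], uniformly in
    [t]. *)
Lemma abs_approx_bounds n (t : R) : 0 <= t <= 1 ->
  [/\ 0 <= abs_approx n (t ^+ 2), abs_approx n (t ^+ 2) <= t
    & (t - abs_approx n (t ^+ 2)) * (2 + n%:R * t) <= 2 * t].
Proof.
move=> /andP[t0 t1]; elim: n => [|n [h1 h2 h3]] /=.
  by split => //; lra.
set q := abs_approx n (t ^+ 2) in h1 h2 h3 *.
have n0 : 0 <= n%:R :> R by [].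
have nE : n.+1%:R = n%:R + 1 :> R by rewrite natr1.
rewrite nE; move: (n%:R) n0 h3 => m m0 h3; split.
- nra.
- nra.
have E : t - (q + (t ^+ 2 - q ^+ 2) / 2) = (t - q) * (1 - (t + q) / 2) by field.
rewrite E.
apply: le_trans h3; rewrite -mulrA ler_wpM2l ?subr_ge0//.
have u0 : 0 <= m * t by apply: mulr_ge0.
have u1 : 0 <= m * t * t by apply: mulr_ge0.
have u2 : 0 <= m * t * q by apply: mulr_ge0.
have u3 : 0 <= t * q by apply: mulr_ge0.
have -> : (1 - (t + q) / 2) * (2 + (m + 1) * t) =
  2 + m * t - q - (m * t * t + t * t + m * t * q + t * q) / 2 by field.
have : 0 <= t * t by apply: mulr_ge0.
lra.
Qed.

Variables (X : set T) (A : set (T -> R)).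
Hypothesis cX : compact X.
Hypothesis A_cst : forall c, A (fun=> c).
Hypothesis A_add : forall g h, A g -> A h -> A (fun x => g x + h x).
Hypothesis A_mul : forall g h, A g -> A h -> A (fun x => g x * h x).
Hypothesis A_closed : forall h, (forall e : R, 0 < e ->
  exists2 g, A g & forall x, X x -> `|h x - g x| < e) -> A h.
Hypothesis A_cont : forall g, A g -> continuous_on X g.

Let A_ext g h : A g -> (forall x, X x -> h x = g x) -> A h.
Proof.
move=> Ag gh; apply: A_closed => e e0; exists g => // x Xx.
by rewrite gh// subrr normr0.
Qed.

Let A_abs1 g : A g -> (forall x, X x -> `|g x| <= 1) -> A (fun x => `|g x|).
Proof.
move=> Ag g1; apply: A_closed => e e0.
have Aapp n : A (fun x => abs_approx n (g x ^+ 2)).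
  elim: n => [|n IH] /=; first exact: A_cst.
  apply: A_add => //; apply: (A_mul (h := fun=> 2^-1)) => //.
  apply: A_add; first by under eq_fun do rewrite expr2; exact: A_mul.
  have -> : (fun x => - abs_approx n (g x ^+ 2) ^+ 2) =
    (fun x => (-1) * (abs_approx n (g x ^+ 2) * abs_approx n (g x ^+ 2))).
    by apply/funext => x; rewrite mulN1r expr2.
  by apply: (A_mul (g := fun=> -1)) => //; exact: A_mul.
pose n := (Num.truncn (2 / e)).+1.
exists (fun x => abs_approx n (g x ^+ 2)) => // x Xx.
have t01 : 0 <= `|g x| <= 1 by rewrite normr_ge0 g1.
have [] := @abs_approx_bounds n _ t01.
rewrite real_normK ?num_real//; move=> h1 h2 h3.
rewrite ger0_norm ?subr_ge0//.
have nE : 2 / e < n%:R by rewrite /n truncnS_gt.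
have [t0|t0] := eqVneq `|g x| 0.
  by move: h2; rewrite t0 => h2; lra.
have tp : 0 < `|g x| by rewrite lt_def t0 normr_ge0.
set u := `|g x| - _ in h3 *.
have u0 : 0 <= u by rewrite subr_ge0.
have h4 : u * n%:R <= 2.
  rewrite -(ler_pM2r tp); apply: le_trans h3.
  by rewrite -mulrA ler_wpM2l// lerDr.
have h5 : 2 < n%:R * e by rewrite -ltr_pdivrMr.
have n0 : 0 < n%:R :> R by [].
rewrite -(ltr_pM2r n0) (le_lt_trans h4)// mulrC //.
Qed.

Let A_abs g : A g -> A (fun x => `|g x|).
Proof.
move=> Ag; have [M M0 gM] := continuous_on_bounded cX (A_cont Ag).
have MV : `|M^-1| = M^-1 by rewrite ger0_norm// invr_ge0 ltW.
apply: (@A_ext (fun x => M * `|M^-1 * g x|)).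
  apply: (A_mul (g := fun=> M)) => //; apply: (A_abs1 (g := fun x => M^-1 * g x)).
    exact: (A_mul (g := fun=> M^-1)).
  move=> x Xx; rewrite normrM MV.
  by rewrite ler_pdivrMl// mulr1 gM.
move=> x Xx; rewrite normrM MV.
by rewrite mulrA mulfV ?mul1r// gt_eqF.
Qed.

Let A_opp g : A g -> A (fun x => - g x).
Proof.
move=> Ag; apply: (@A_ext (fun x => (-1) * g x)); first exact: (A_mul (g := fun=> -1)).
by move=> x _; rewrite mulN1r.
Qed.

Let A_max g h : A g -> A h -> A (fun x => Num.max (g x) (h x)).
Proof.
move=> Ag Ah; apply: (@A_ext (fun x => (g x + h x + `|g x - h x|) * 2^-1)).
  apply: (A_mul (h := fun=> 2^-1)) => //; apply: A_add; first exact: A_add.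
  by apply: (A_abs (g := fun x => g x - h x)); apply: A_add => //; exact: A_opp.
by move=> x _; rewrite maxr_absE.
Qed.

Let A_min g h : A g -> A h -> A (fun x => Num.min (g x) (h x)).
Proof.
move=> Ag Ah; apply: (@A_ext (fun x => (g x + h x - `|g x - h x|) * 2^-1)).
  apply: (A_mul (h := fun=> 2^-1)) => //; apply: A_add; first exact: A_add.
  apply: (@A_opp (fun x => `|g x - h x|)).
  by apply: (A_abs (g := fun x => g x - h x)); apply: A_add => //; exact: A_opp.
by move=> x _; rewrite minr_absE.
Qed.

(** Maxima glued over the second point give an element above [h - e] that is exact at [x]; minima
    glued over [x] then bound it from above. The hypothesis asks for two-point interpolation of this
    [h] only, not for separation of points, because it is applied to functions that cannot tell the
    points of K apart. *)
Lemma stone_weierstrass (h : T -> R) : continuous_on X h ->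
  (forall x y, X x -> X y -> exists2 g, A g & g x = h x /\ g y = h y) -> A h.
Proof.
move=> ch hA.
have lower x (e : R) : X x -> 0 < e ->
    exists2 g, A g & g x = h x /\ forall y, X y -> h y - e < g y.
  move=> Xx e0.
  pose P S := exists2 g, A g &
    g x = h x /\ forall y, S y -> X y -> h y - e < g y.
  suff [g Ag [gx gy]] : P X.
    by exists g => //; split=> // y Xy; exact: gy.
  apply: (compact_ind (A := X) (P := P)) => //.
  - by exists (fun=> h x).
  - by move=> S S' SS' [g Ag [gx gy]]; exists g => //; split => // y /SS'; exact: gy.
  - move=> S S' [g Ag [gx gy]] [g' Ag' [gx' gy']].
    exists (fun x => Num.max (g x) (g' x)); first exact: A_max.
    split; first by rewrite gx gx' maxxx.
    by move=> y [Sy|Sy] Xy; rewrite lt_max; [rewrite gy|rewrite (gy' y) ?orbT].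
  - move=> y Xy; have [g Ag [gx gy]] := hA x y Xx Xy.
    have e2 : 0 < e / 2 by rewrite divr_gt0.
    exists [set t | X t -> `|g t - g y| < e / 2 /\ `|h t - h y| < e / 2].
      near=> t => Xt; split; move: Xt; near: t; [exact: A_cont|exact: ch].
    exists g => //; split=> // t [ht Xt] _; have [] := ht Xt.
    by rewrite gy !ltr_norml => /andP[? ?] /andP[? ?]; lra.
apply: A_closed => e e0.
have [M M0 hM] := continuous_on_bounded cX ch.
pose P S := exists2 g, A g & (forall y, X y -> h y - e < g y)
  /\ forall y, S y -> X y -> g y < h y + e.
suff [g Ag [gl gu]] : P X.
  exists g => // x Xx; rewrite ltr_norml.
  by have := gl x Xx; have := gu x Xx Xx; lra.
apply: (compact_ind (A := X) (P := P)) => //.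
- exists (fun=> M) => //; split=> // y /hM; rewrite ler_norml => /andP[_ ?]; lra.
- by move=> S S' SS' [g Ag [gx gy]]; exists g => //; split => // y /SS'; exact: gy.
- move=> S S' [g Ag [gx gy]] [g' Ag' [gx' gy']].
  exists (fun x => Num.min (g x) (g' x)); first exact: A_min.
  split; first by move=> y Xy; rewrite lt_min gx ?gx'.
  by move=> y [Sy|Sy] Xy; rewrite gt_min; [rewrite gy|rewrite (gy' y) ?orbT].
- move=> x Xx; have [g Ag [gx gy]] := lower x e Xx e0.
  have e2 : 0 < e / 2 by rewrite divr_gt0.
  exists [set t | X t -> `|g t - g x| < e / 2 /\ `|h t - h x| < e / 2].
    near=> t => Xt; split; move: Xt; near: t; [exact: A_cont|exact: ch].
  exists g => //; split=> // t [ht Xt] _; have [] := ht Xt.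
  by rewrite gx !ltr_norml => /andP[? ?] /andP[? ?]; lra.
Unshelve. all: by end_near.
Qed.

End StoneWeierstrass.

(** * Continuous functions and generated algebras *)

Section ContinuousFunctions.
Variable R : realType.
Implicit Types (X : set (Cplx R)) (g h : Cplx R -> Cplx R) (u v : Cplx R -> R).

Definition ccont X g := forall z, X z -> forall e : R, 0 < e ->
  exists2 d : R, 0 < d & forall w, X w -> cabs (w - z) < d -> cabs (g w - g z) < e.

Lemma cont_funP X g : cont_fun X g <-> ccont X g.
Proof.
rewrite /cont_fun /=; split.
  move=> h z Xz e e0.
  have /cvg_cplxP /(_ e e0) := iffLR (subspace_continuousP X g) h z Xz.
  by rewrite /within /= => /nbhs_cplxP[d d0 hd]; exists d => // w Xw /hd; exact.
move=> h; apply: (iffRL (subspace_continuousP X g)) => z Xz; apply/cvg_cplxP => e e0.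
have [d d0 hd] := h z Xz e e0.
by rewrite /within /=; apply/nbhs_cplxP; exists d => // w wz Xw; exact: hd.
Qed.

Lemma continuous_onP X u : continuous_on X u <-> {within X, continuous u}.
Proof.
split.
  move=> h; apply: (iffRL (subspace_continuousP _ _)) => z Xz; apply/cvgrPdist_lt => e e0.
  apply: filterS (h z Xz e e0) => w hw Xw; rewrite distrC; exact: hw.
move=> h z Xz e e0.
have /cvgrPdist_lt /(_ e e0) H := iffLR (subspace_continuousP X u) h z Xz.
have {H} : nbhs z [set w | X w -> `|u z - u w| < e] := H.
move=> /nbhs_cplxP[d d0 hd].
by apply/nbhs_cplxP; exists d => // w wz Xw; rewrite distrC; exact: hd.
Qed.

Lemma ccont_sub X Y g : Y `<=` X -> ccont X g -> ccont Y g.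
Proof.
move=> YX h z /YX Xz e /(h z Xz)[d d0 hd].
by exists d => // w /YX; exact: hd.
Qed.

Lemma ccont_cst X c : ccont X (fun=> c).
Proof. by move=> z _ e e0; exists 1 => // w _ _; rewrite subrr cabs0. Qed.

Lemma ccont_id X : ccont X (fun z => z).
Proof. by move=> z _ e e0; exists e. Qed.

Lemma ccontD X g h : ccont X g -> ccont X h -> ccont X (fun z => g z + h z).
Proof.
move=> /cont_funP cg /cont_funP ch; apply/cont_funP => x.
by apply: continuousD; [exact: cg|exact: ch].
Qed.

Lemma ccontN X g : ccont X g -> ccont X (fun z => - g z).
Proof. by move=> /cont_funP cg; apply/cont_funP => x; apply: continuousN; exact: cg. Qed.

Lemma ccontB X g h : ccont X g -> ccont X h -> ccont X (fun z => g z - h z).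
Proof. by move=> cg ch; apply: ccontD => //; exact: ccontN. Qed.

Lemma ccontM X g h : ccont X g -> ccont X h -> ccont X (fun z => g z * h z).
Proof.
move=> /cont_funP cg /cont_funP ch; apply/cont_funP => x.
by apply: continuousM; [exact: cg|exact: ch].
Qed.

Lemma ccont_conj X g : ccont X g -> ccont X (fun z => conjc (g z)).
Proof.
move=> h z Xz e /(h z Xz)[d d0 hd].
by exists d => // w Xw wz; rewrite -rmorphB cabs_conj; exact: hd.
Qed.

Lemma ccont_real X u : {within X, continuous u} ->
  ccont X (fun z => ((u z)%:C : Cplx R)).
Proof.
move=> /continuous_onP h z Xz e e0.
have /nbhs_cplxP[d d0 hd] := h z Xz e e0.
by exists d => // w Xw wz; rewrite -rmorphB cabs_real; exact: hd.
Qed.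

Lemma within_Re X g : ccont X g -> {within X, continuous (fun z => complex.Re (g z))}.
Proof.
move=> h; apply/continuous_onP => z Xz e /(h z Xz)[d d0 hd].
apply/nbhs_cplxP; exists d => // w wz Xw; apply: le_lt_trans (hd w Xw wz).
by rewrite -raddfB ler_Re_cabs.
Qed.

Lemma within_Im X g : ccont X g -> {within X, continuous (fun z => complex.Im (g z))}.
Proof.
move=> h; apply/continuous_onP => z Xz e /(h z Xz)[d d0 hd].
apply/nbhs_cplxP; exists d => // w wz Xw; apply: le_lt_trans (hd w Xw wz).
by rewrite -raddfB ler_Im_cabs.
Qed.

Lemma within_cabs X g : ccont X g -> {within X, continuous (fun z => cabs (g z))}.
Proof.
move=> h; apply/continuous_onP => z Xz e /(h z Xz)[d d0 hd].
apply/nbhs_cplxP; exists d => // w wz Xw; apply: le_lt_trans (hd w Xw wz).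
rewrite ler_norml lerB_cabs andbT lerNl opprB cabs_dist; exact: lerB_cabs.
Qed.

Lemma ccont_bounded X g : compact X -> ccont X g ->
  exists2 M : R, 0 < M & forall z, X z -> cabs (g z) <= M.
Proof.
move=> cX /within_cabs /continuous_onP /(continuous_on_bounded cX)[M M0 h].
by exists M => // z /h; rewrite ger0_norm ?cabs_ge0.
Qed.

Lemma cabs_attains_max X g : compact X -> X !=set0 -> ccont X g ->
  exists2 x, X x & forall y, X y -> cabs (g y) <= cabs (g x).
Proof.
move=> cX X0 /within_cabs cg.
have [c Xc h] := compact_EVT_max X0 cX cg.
by exists c; [exact: set_mem|move=> y Xy; apply: h; rewrite inE].
Qed.

End ContinuousFunctions.

Section GeneratedAlgebra.
Variables (R : realType) (m : nat) (f : 'I_m -> Cplx R -> Cplx R).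
Notation C := (Cplx R).

Lemma graph_point0 z : graph_point f z ord0 ord0 = z.
Proof. by rewrite mxE unlift_none. Qed.

Lemma graph_pointS z j : graph_point f z ord0 (lift ord0 j) = f j z.
Proof. by rewrite mxE liftK. Qed.

(** The monomial expansion is opened only here; afterwards a property of all polynomials in the
    generators follows from stability under sums and products. It serves for continuity and, in the
    proof of properness, for pole multipliers. *)
Lemma polyval_graph_ind (S : set (C -> C)) :
  (forall c, S (fun=> c)) -> S (fun z => z) -> (forall j, S (f j)) ->
  (forall g h, S g -> S h -> S (fun z => g z + h z)) ->
  (forall g h, S g -> S h -> S (fun z => g z * h z)) ->
  forall p, S (fun z => polyval p (graph_point f z)).
Proof.
move=> Sc Sid Sf SD SM p.
have Sx i n : S (fun z => graph_point f z ord0 i ^+ n).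
  elim: n => [|n IH]; first by under eq_fun do rewrite expr0; exact: Sc.
  under eq_fun do rewrite exprS; apply: SM IH.
  case: (unliftP ord0 i) => [j ->|->].
    by under eq_fun do rewrite graph_pointS; exact: Sf.
  by under eq_fun do rewrite graph_point0; exact: Sid.
have SM' := SM; rewrite /polyval; under eq_fun do rewrite mevalE.
elim: (msupp p) => [|a s IH]; first by under eq_fun do rewrite big_nil; exact: Sc.
under eq_fun do rewrite big_cons; apply: (SD) IH; apply: SM; first exact: Sc.
elim: (index_enum _) => [|i r IH]; first by under eq_fun do rewrite big_nil; exact: Sc.
by under eq_fun do rewrite big_cons; exact: SM'.
Qed.

Lemma polyvalD n (p q : mpoly n C) v : polyval (p + q) v = polyval p v + polyval q v.
Proof. exact: mevalD. Qed.

Lemma polyvalB n (p q : mpoly n C) v : polyval (p - q) v = polyval p v - polyval q v.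
Proof. exact: mevalB. Qed.

Lemma polyvalM n (p q : mpoly n C) v : polyval (p * q) v = polyval p v * polyval q v.
Proof. exact: mevalM. Qed.

Lemma polyvalC n (c : C) (v : 'rV[C]_n) : polyval (mpolyC n c) v = c.
Proof. exact: mevalC. Qed.

Lemma polyvalX n (i : 'I_n) (v : 'rV[C]_n) : polyval (mpolyX C (mnm1 i)) v = v ord0 i.
Proof. exact: mevalXU. Qed.

Variable X : set C.
Hypothesis cX : compact X.
Hypothesis cf : forall j, ccont X (f j).
Notation G := (generated_algebra f X).

Lemma cont_polyval_graph p : ccont X (fun z => polyval p (graph_point f z)).
Proof.
apply: (polyval_graph_ind (S := ccont X)) => //.
- exact: ccont_cst.
- exact: ccont_id.
- by move=> g h; exact: ccontD.
- by move=> g h; exact: ccontM.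
Qed.

Lemma gen_polyval p : G (fun z => polyval p (graph_point f z)).
Proof.
move=> e e0; exists (fun z => polyval p (graph_point f z)); first by exists p.
by move=> z _; rewrite subrr cabs0.
Qed.

Lemma genP g : G g <-> forall e : R, 0 < e -> exists p, forall z, X z ->
  cabs (g z - polyval p (graph_point f z)) < e.
Proof.
split=> h e /h; first by move=> [_ [p ->] hp]; exists p.
by move=> [p hp]; exists (fun z => polyval p (graph_point f z)) => //; exists p.
Qed.

Lemma gen_closed g : (forall e : R, 0 < e ->
  exists2 h, G h & forall z, X z -> cabs (g z - h z) < e) -> G g.
Proof.
move=> H; apply/genP => e e0; have e2 : 0 < e / 2 by rewrite divr_gt0.
have [h /genP /(_ _ e2)[p hp] gh] := H _ e2.
exists p => z Xz; apply: le_lt_trans (ler_cabs_dist _ (h z) _) _.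
by rewrite [e]splitr ltrD ?gh ?hp.
Qed.

Lemma gen_ext g h : {in X, g =1 h} -> G g -> G h.
Proof.
move=> gh Gg; apply: gen_closed => e e0; exists g => // z Xz.
by rewrite gh ?inE// subrr cabs0.
Qed.

Lemma gen_cst c : G (fun=> c).
Proof.
apply: (@gen_ext (fun z => polyval (mpolyC _ c) (graph_point f z))); last exact: gen_polyval.
by move=> z _; rewrite polyvalC.
Qed.

Lemma gen_id : G (fun z => z).
Proof.
apply: (@gen_ext (fun z => polyval (mpolyX _ (mnm1 ord0)) (graph_point f z))); last exact: gen_polyval.
by move=> z _; rewrite polyvalX graph_point0.
Qed.

Lemma gen_f j : G (f j).
Proof.
apply: (@gen_ext (fun z => polyval (mpolyX _ (mnm1 (lift ord0 j))) (graph_point f z))); last exact: gen_polyval.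
by move=> z _; rewrite polyvalX graph_pointS.
Qed.

Lemma gen_cont g : G g -> ccont X g.
Proof.
move=> /genP Gg z Xz e e0.
have e3 : 0 < e / 3 by rewrite divr_gt0.
have [p hp] := Gg _ e3.
have [d d0 hd] := cont_polyval_graph p Xz e3.
exists d => // w Xw wz; have h1 := hp _ Xz; have h2 := hp _ Xw; have h3 := hd w Xw wz.
have := ler_cabs_dist (g w) (polyval p (graph_point f w)) (g z).
have := ler_cabs_dist (polyval p (graph_point f w)) (polyval p (graph_point f z)) (g z).
rewrite cabs_dist in h1; move: h1 h2 h3.
move: (cabs _) (cabs _) (cabs _) (cabs _) (cabs _) => *; lra.
Qed.

Lemma genD g h : G g -> G h -> G (fun z => g z + h z).
Proof.
move=> /genP Gg /genP Gh; apply/genP => e e0.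
have e2 : 0 < e / 2 by rewrite divr_gt0.
have [p hp] := Gg _ e2; have [q hq] := Gh _ e2.
exists (p + q) => z Xz; rewrite polyvalD opprD addrACA.
by rewrite (le_lt_trans (ler_cabsD _ _))// [e]splitr ltrD ?hp ?hq.
Qed.

Lemma genM g h : G g -> G h -> G (fun z => g z * h z).
Proof.
move=> Gg Gh; apply/genP => e e0.
have [M M0 gM] := ccont_bounded cX (gen_cont Gg).
have [N N0 hN] := ccont_bounded cX (gen_cont Gh).
have d0 : 0 < Num.min 1 (e / (M + N + 2)).
  by rewrite lt_min ltr01 divr_gt0// addr_gt0// addr_gt0.
set d := Num.min _ _ in d0.
have d1 : d <= 1 by rewrite /d ge_min lexx.
have dMN : d * (M + N + 2) <= e.
  by rewrite -ler_pdivlMr ?addr_gt0// ?addr_gt0// /d ge_min lexx orbT.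
have [p hp] := iffLR (genP _) Gg _ d0; have [q hq] := iffLR (genP _) Gh _ d0.
exists (p * q) => z Xz; rewrite polyvalM.
have := hp z Xz; have := hq z Xz.
move: (polyval p _) (polyval q _) => P Q hQ hP.
have -> : g z * h z - P * Q = g z * (h z - Q) + (g z - P) * (h z - (h z - Q)) by ring.
apply: le_lt_trans (ler_cabsD _ _) _; rewrite !cabsM.
have h1 : cabs (g z) * cabs (h z - Q) <= M * d.
  by rewrite ler_pM ?cabs_ge0 ?gM// ltW.
have h2 : cabs (g z - P) * cabs (h z - (h z - Q)) <= d * (N + 1).
  rewrite ler_pM ?cabs_ge0 ?(ltW hP)//.
  apply: le_trans (ler_cabsB _ _) _; rewrite lerD ?hN//; lra.
nra.
Qed.

Lemma genN g : G g -> G (fun z => - g z).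
Proof.
move=> Gg; apply: (@gen_ext (fun z => (-1) * g z)); last exact: genM (gen_cst _) Gg.
by move=> z _; rewrite mulN1r.
Qed.

Lemma genB g h : G g -> G h -> G (fun z => g z - h z).
Proof. by move=> Gg Gh; apply: genD => //; exact: genN. Qed.

Lemma genX g n : G g -> G (fun z => g z ^+ n).
Proof.
move=> Gg; elim: n => [|n IH]; first by under eq_fun do rewrite expr0; exact: gen_cst.
by under eq_fun do rewrite exprS; exact: genM.
Qed.

Lemma gen_sum (I : Type) (s : seq I) (g : I -> C -> C) :
  (forall i, G (g i)) -> G (fun z => \sum_(i <- s) g i z).
Proof.
move=> h; elim: s => [|i s IH]; first by under eq_fun do rewrite big_nil; exact: gen_cst.
by under eq_fun do rewrite big_cons; exact: genD.
Qed.

Lemma gen_horner g (p : {poly C}) : G g -> G (fun z => p.[g z]).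
Proof.
move=> Gg; under eq_fun do rewrite horner_coef.
by apply: gen_sum => i; apply: genM; [exact: gen_cst|exact: genX].
Qed.

Lemma compact_graph : compact (graph f X).
Proof.
rewrite /graph; apply: continuous_compact => //.
apply: (iffRL (subspace_continuousP _ _)) => z Xz.
apply/cvg_ballP => e e0.
(* The radius of a ball over C is itself a complex number; positivity forces it to be real. *)
have e1 : 0 < complex.Re e by move: e0; rewrite ltcE => /andP[].
have eE : e = (complex.Re e)%:C.
  by move: e0; rewrite ltcE => /andP[/= /eqP + _]; case: (e) => a b /= ->.
have : \forall w \near within X (nbhs z), forall i : 'I_m.+1,
    cabs (graph_point f w ord0 i - graph_point f z ord0 i) < complex.Re e.
  have H (i : 'I_m.+1) : \forall w \near within X (nbhs z),
    cabs (graph_point f w ord0 i - graph_point f z ord0 i) < complex.Re e.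
    have : ccont X (fun w => graph_point f w ord0 i).
      case: (unliftP ord0 i) => [j ->|->].
        by under eq_fun do rewrite graph_pointS; exact: cf.
      by under eq_fun do rewrite graph_point0; exact: ccont_id.
    move=> /(_ z Xz _ e1)[d d0 hd].
    by rewrite /within /=; apply/nbhs_cplxP; exists d => // w wz Xw; exact: hd.
  exact: filter_forall.
apply: filterS => w hw; split => // i j.
by rewrite eE (ord1 i); apply/ball_cplxE.
Qed.

End GeneratedAlgebra.

(** * Smooth functions *)

Section FlatFunction.
Variable R : realType.

(** [beta 0] is the usual flat function. The powers of [t^-1] are included so that the linear span
    of the family is closed under differentiation. *)
Definition beta (k : nat) (t : R) : R :=
  if 0 < t then t^-1 ^+ k * expR (- t^-1) else 0.

Lemma beta_le0 k t : t <= 0 -> beta k t = 0.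
Proof. by rewrite /beta leNgt => /negbTE ->. Qed.

Lemma beta_gt0 k t : 0 < t -> 0 < beta k t.
Proof. by move=> t0; rewrite /beta t0 mulr_gt0 ?expR_gt0 ?exprn_gt0 ?invr_gt0. Qed.

Lemma beta_ge0 k t : 0 <= beta k t.
Proof. by have [/beta_gt0/ltW//|/beta_le0 ->] := ltP 0 t. Qed.

(** The exponential series gives [expR t^-1] at least its term of degree [k.+2]. A quadratic bound
    is what makes the derivative at the origin exist and vanish, for all [k] at once. *)
Lemma beta_le_sqr k t : beta k t <= (k.+2)`!%:R * t ^+ 2.
Proof.
have F0 : 0 < (k.+2)`!%:R :> R by rewrite ltr0n fact_gt0.
have [t0|t0] := ltP 0 t; last by rewrite beta_le0// mulr_ge0 ?sqr_ge0// ltW.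
rewrite /beta t0 expRN ler_pdivrMr ?expR_gt0//.
have x0 : 0 <= t^-1 by rewrite invr_ge0 ltW.
have h := @expR_ge1Dxn R _ k.+1 x0.
have h2 : t^-1 ^+ k.+2 / (k.+2)`!%:R <= expR t^-1 by apply: le_trans h; rewrite lerDr.
rewrite ler_pdivrMr// in h2.
have -> : t^-1 ^+ k = t ^+ 2 * t^-1 ^+ k.+2.
  by rewrite [in RHS]expr2 !exprS; field; rewrite gt_eqF.
have -> : (k.+2)`!%:R * t ^+ 2 * expR t^-1 = t ^+ 2 * (expR t^-1 * (k.+2)`!%:R) by ring.
by rewrite ler_wpM2l ?sqr_ge0.
Qed.

Lemma is_derive1P (phi : R -> R) (t l : R) :
  is_derive t 1 phi l <-> forall e, 0 < e -> exists2 d, 0 < d &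
    forall h, `|h| < d -> `|phi (t + h) - phi t - l * h| <= e * `|h|.
Proof.
have E : (fun h : R => h^-1 *: ((phi \o shift t) (h *: (1 : R)) - phi t)) =
         (fun h : R => h^-1 * (phi (t + h) - phi t)).
  by apply/funext => h; rewrite /= /GRing.scale /= mulr1 (addrC h).
split.
  move=> [dphi <-] e e0; move: dphi; rewrite /derivable /derive E => /cvgrPdist_le.
  move=> /(_ e e0); rewrite near_withinE => /nbhs_ballP[d /= d0 hd].
  exists d => // h hh; have [->|h0] := eqVneq h 0.
    by rewrite addr0 subrr mulr0 subr0 normr0 mulr0.
  have := hd h; rewrite -ball_normE /= sub0r normrN => /(_ hh h0).
  set L := lim _; rewrite distrC => H.
  have -> : phi (t + h) - phi t - L * h = (h^-1 * (phi (t + h) - phi t) - L) * h.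
    by field.
  by rewrite normrM ler_wpM2r.
move=> H; have C : (fun h : R => h^-1 * (phi (t + h) - phi t)) @ (0 : R)^' --> l.
  apply/cvgrPdist_le => e e0; have [d d0 hd] := H e e0.
  rewrite near_withinE; apply/nbhs_ballP; exists d => //= h.
  rewrite -ball_normE /= sub0r normrN => hh h0.
  rewrite distrC -(ler_pM2r (x := `|h|)) ?normr_gt0// -normrM.
  have -> : (h^-1 * (phi (t + h) - phi t) - l) * h = phi (t + h) - phi t - l * h.
    by field.
  exact: hd.
split; first by rewrite /derivable E; apply/cvg_ex; exists l.
by rewrite /derive E; apply: cvg_lim.
Qed.

Lemma is_derive_beta (k : nat) (t : R) :
  is_derive t 1 (beta k) (beta k.+2 t - k%:R * beta k.+1 t).
Proof.
have [t0|t0|->] := ltrgt0P t.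
- have tn : t != 0 by rewrite gt_eqF.
  have DV : is_derive t 1 (fun y : R => y^-1) (- t ^- 2).
    by have := is_deriveV tn (is_derive_id t 1); rewrite /GRing.scale /= mulr1.
  have DX : is_derive t 1 (fun y : R => y^-1 ^+ k) (k%:R * t^-1 ^+ k.-1 * (- t ^- 2)).
    have -> : (fun y : R => y^-1 ^+ k) = (fun y : R => y^-1) ^+ k.
      by apply/funext => y; rewrite exprfctE.
    exact: (@is_deriveX _ _ (fun y : R => y^-1) k t 1 _ DV).
  have DE : is_derive t 1 (fun y : R => expR (- y^-1)) (expR (- t^-1) * (t ^- 2)).
    have DN : is_derive t 1 (fun y : R => - y^-1) (t ^- 2).
      by have := is_deriveN (df := _) DV; rewrite opprK.
    exact: (@is_derive1_comp R expR (fun y : R => - y^-1) t _ _ _ DN).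
  apply: (@near_eq_is_derive _ _ _ (fun y : R => y^-1 ^+ k * expR (- y^-1))).
  + near=> y; rewrite /beta; case: ifPn => //; rewrite -leNgt => y0.
    exfalso; have : 0 < y by near: y; exact: lt_nbhsr.
    by rewrite ltNge y0.
  + apply: (is_derive_eq (is_deriveM DX DE)).
    rewrite /beta t0 /GRing.scale /=.
    case: k {DX} => [|k] /=; first by rewrite !expr0; field.
    by rewrite !exprS; field.
- rewrite !beta_le0 ?(ltW t0)// mulr0 subr0.
  apply: (@near_eq_is_derive _ _ _ (cst (0 : R)) _ _ _ _ _ (is_derive_cst _ _ _)).
  near=> y; rewrite beta_le0//; apply: ltW; near: y; exact: lt_nbhsl.
- rewrite !beta_le0// mulr0 subr0; apply/is_derive1P => e e0.
  have F0 : 0 < (k.+2)`!%:R :> R by rewrite ltr0n fact_gt0.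
  exists (e / (k.+2)`!%:R); first by rewrite divr_gt0.
  move=> h; rewrite ltr_pdivlMr// => hh.
  rewrite add0r (@beta_le0 k 0)// mul0r !subr0 ger0_norm ?beta_ge0//.
  apply: le_trans (beta_le_sqr k h) _.
  rewrite -[h ^+ 2]real_normK ?num_real// expr2 mulrA ler_wpM2r//.
  by rewrite mulrC ltW.
Unshelve. all: by end_near.
Qed.

Lemma continuous_beta k : continuous (beta k).
Proof.
move=> t; apply: differentiable_continuous; apply/derivable1_diffP.
by have [] := is_derive_beta k t.
Qed.

End FlatFunction.

(** * Smoothness through classes closed under partial derivatives *)

Section SmoothFunctions.
Variable R : realType.
Notation C := (Cplx R).
Implicit Types (U : set C) (u w : C -> R) (z v : C).

(** A one-variable derivative along a real line through [z], so that the calculus rules for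
    [is_derive] carry over. *)
Definition dder v u z (l : R) := is_derive (0 : R) 1 (fun h : R => u (z + h%:C * v)) l.

Lemma dderP v u z l : dder v u z l <-> forall e, 0 < e -> exists2 d, 0 < d &
  forall h : R, `|h| < d -> `|u (z + h%:C * v) - u z - l * h| <= e * `|h|.
Proof.
rewrite /dder is_derive1P; split=> H e /H[d d0 hd]; exists d => // h hh.
  by have := hd h hh; rewrite add0r mul0r addr0.
by have := hd h hh; rewrite add0r mul0r addr0.
Qed.

Lemma dder_shift v u z (t : R) l : dder v u (z + t%:C * v) l ->
  is_derive t 1 (fun h : R => u (z + h%:C * v)) l.
Proof.
move=> /dderP H; apply/is_derive1P => e /H[d d0 hd]; exists d => // h hh.
by rewrite rmorphD mulrDl addrA; exact: hd.
Qed.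

Lemma dder_eq v u z l l' : dder v u z l -> l = l' -> dder v u z l'.
Proof. by move=> H <-. Qed.

Definition dir (b : bool) : C := if b then 1 else 0 +i* 1.

(** A coinductive witness of smoothness: membership in such a class yields [Ck_on] for every order
    by one induction, without naming the higher derivatives. *)
Definition der_closed U (P : set (C -> R)) := forall u, P u ->
  (forall z, U z -> {for z, continuous u}) /\
  forall b, exists2 u', P u' & forall z, U z -> dder (dir b) u z (u' z).

Definition rsmooth U u := exists2 P, der_closed U P & P u.

Lemma rsmooth_add U u w : rsmooth U u -> rsmooth U w -> rsmooth U (fun z => u z + w z).
Proof.
move=> [P cP Pu] [Q cQ Qw].
exists [set g | exists u w, [/\ P u, Q w & g = fun z => u z + w z]]; last by exists u, w.
move=> _ {u w Pu Qw}[u [w [/cP[cu du] /cQ[cw dw] ->]]]; split.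
  by move=> z Uz; apply: continuousD; [exact: cu|exact: cw].
move=> b; have [u' Pu' hu] := du b; have [w' Qw' hw] := dw b.
exists (fun z => u' z + w' z); first by exists u', w'.
by move=> z Uz; exact: is_deriveD (hu z Uz) (hw z Uz).
Qed.

Lemma dder_real_derive v u w z l l' : dder v u z l -> dder v w z l' ->
  is_real_derive v (fun z => (u z +i* w z : C)) z (l +i* l').
Proof.
move=> /dderP hu /dderP hw; apply/cvg_cplxP => e e0.
have e2 : 0 < e / 3 by rewrite divr_gt0.
have [d d0 hd] := hu _ e2; have [d' d0' hd'] := hw _ e2.
rewrite near_withinE; apply/nbhs_ballP; exists (Num.min d d'); first by rewrite /= lt_min d0.
move=> h; rewrite -ball_normE /= sub0r normrN lt_min => /andP[h1 h2] h0.
have hp : 0 < `|h| by rewrite normr_gt0.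
have hc : (h%:C : C) != 0 by rewrite -cabs_gt0 cabs_real.
rewrite -(ltr_pM2r hp) -(cabs_real h) -cabsM.
set A := u _ +i* w _; set B := u z +i* w z.
have -> : ((A - B : C) / h%:C - (l +i* l')) * h%:C = (A - B) - (l +i* l') * h%:C.
  by rewrite mulrBl divfK.
apply: le_lt_trans (ler_cabs_ReIm _) _; rewrite /A /B /=.
have := hd h h1; have := hd' h h2; rewrite cabs_real !mulr0 subr0.
have : 0 < e / 3 * `|h| by rewrite mulr_gt0.
have -> : e * `|h| = 3 * (e / 3 * `|h|) by field.
by rewrite add0r; move: (`|u _ - _ - _|) (`|w _ - _ - _|) (e / 3 * _) => *; lra.
Qed.

Lemma rsmooth_Ck U u w k : rsmooth U u -> rsmooth U w ->
  Ck_on k U (fun z => (u z +i* w z : C)).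
Proof.
move=> [P cP Pu] [Q cQ Qw]; elim: k u w Pu Qw => [|k IH] u w Pu Qw /=;
  have [cu du] := cP u Pu; have [cw dw] := cQ w Qw.
all: have cF z : U z -> {for z, continuous (fun z => (u z +i* w z : C))}.
1,3: move=> Uz; apply: (@continuous_comp _ _ _ (fun z => (u z, w z)) (fun p : R * R => (p.1 +i* p.2 : C)));
  [exact: (cvg_pair (cu z Uz) (cw z Uz))|exact: continuous_Complex].
  by split.
split=> //.
have [ux Pux hux] := du true; have [uy Puy huy] := du false.
have [wx Pwx hwx] := dw true; have [wy Pwy hwy] := dw false.
exists (fun z => ux z +i* wx z), (fun z => uy z +i* wy z); split.
- by move=> z Uz; apply: dder_real_derive; [exact: hux|exact: hwx].
- by move=> z Uz; apply: dder_real_derive; [exact: huy|exact: hwy].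
- exact: IH.
- exact: IH.
Qed.

End SmoothFunctions.

(** * Continuity and termwise differentiation of series *)

Section SmoothSeries.
Variable R : realType.
Notation C := (Cplx R).

Lemma continuous_rP (u : C -> R) (z : C) :
  {for z, continuous u} <-> (forall e : R, 0 < e -> exists2 d : R, 0 < d &
    forall w, cabs (w - z) < d -> `|u w - u z| < e).
Proof.
split.
  move=> cu e e0; have : nbhs (u z) [set y | `|y - u z| < e].
    apply/nbhs_ballP; exists e => //= y; rewrite -ball_normE /= distrC //.
  by move=> /cu /nbhs_cplxP.
move=> H A /nbhs_ballP[e /= e0 he]; have [d d0 hd] := H e e0.
apply/nbhs_cplxP; exists d => // w /hd h; apply: he.
by rewrite -ball_normE /= distrC.
Qed.

Implicit Types (x y : nat -> R).

Definition rsum x : R := limn (series x).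

(** The fixed majorant gives the tail bound [2 * 2^-1 ^+ N] without further constants. The rank [n0]
    is a parameter because it rises by one with each differentiation of the series. *)
Definition dominated (n0 : nat) x := forall n, (n0 <= n)%N -> `|x n| <= 2^-1 ^+ n.

Lemma half_ge0 n : 0 <= 2^-1 ^+ n :> R.
Proof. by rewrite exprn_ge0. Qed.

Lemma half_gt0 n : 0 < 2^-1 ^+ n :> R.
Proof. by rewrite exprn_gt0. Qed.

Lemma half_small (e : R) : 0 < e -> exists n0, forall n, (n0 <= n)%N -> 2^-1 ^+ n < e.
Proof.
move=> e0; have h : `|2^-1 : R| < 1 by rewrite ger0_norm ?invr_ge0// invf_lt1 ?ltr1n.
have /cvgrPdist_lt /(_ e e0) := @cvg_expr R _ h.
move=> [n0 _ H]; exists n0 => n /H /=.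
by rewrite sub0r normrN ger0_norm// half_ge0.
Qed.

Lemma series_tail n0 x : dominated n0 x -> forall N M, (n0 <= N)%N -> (N <= M)%N ->
  `|series x M - series x N| <= 2 * 2^-1 ^+ N - 2 * 2^-1 ^+ M.
Proof.
move=> dx N M n0N; elim: M => [|M IH].
  by rewrite leqn0 => /eqP ->; rewrite !subrr normr0.
rewrite leq_eqVlt => /orP[/eqP ->|]; first by rewrite !subrr normr0.
rewrite ltnS => NM; rewrite seriesSr.
have := IH NM; have := dx M (leq_trans n0N NM).
rewrite [2^-1 ^+ M.+1]exprS => h1 h2.
have -> : series x M + x M - series x N = (series x M - series x N) + x M by ring.
apply: le_trans (ler_normD _ _) _; lra.
Qed.

Lemma rsum_cvg n0 x : dominated n0 x -> series x @ \oo --> rsum x.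
Proof.
move=> dx; suff : cvgn (series x) by [].
apply/cauchy_cvgP/cauchy_exP => e e0.
have e2 : 0 < e / 2 by rewrite divr_gt0.
have [n1 hn1] := half_small e2; set N := maxn n0 n1.
exists (series x N); exists N => // M /= NM.
rewrite -ball_normE /= distrC; apply: le_lt_trans (series_tail dx _ NM) _.
  exact: leq_maxl.
have := hn1 N (leq_maxr _ _); have := half_gt0 M; lra.
Qed.

Lemma rsum_unique x l : series x @ \oo --> l -> rsum x = l.
Proof. by move=> h; apply: cvg_lim. Qed.

Lemma rsum_tail n0 x N : dominated n0 x -> (n0 <= N)%N ->
  `|rsum x - series x N| <= 2 * 2^-1 ^+ N.
Proof.
move=> dx n0N; apply/ler_addgt0Pr => e e0.
have /cvgrPdist_lt /(_ e e0)[M0 _ H] := rsum_cvg dx.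
have h1 := H (maxn M0 N) (leq_maxl _ _).
have h2 := series_tail dx n0N (leq_maxr M0 N).
have := half_gt0 (maxn M0 N).
have := ler_distD (series x (maxn M0 N)) (rsum x) (series x N).
rewrite /= in h1; lra.
Qed.

Lemma dominatedW n0 n1 x : (n0 <= n1)%N -> dominated n0 x -> dominated n1 x.
Proof. by move=> h d n hn; apply: d; exact: leq_trans hn. Qed.

Lemma rsumM n0 x (c : R) : dominated n0 x -> rsum (fun n => c * x n) = c * rsum x.
Proof.
move=> dx; apply: rsum_unique.
have -> : series (fun n => c * x n) = (fun n => c * series x n).
  by apply/funext => n; rewrite /series /= big_distrr.
by apply: cvgMl_tmp; exact: rsum_cvg dx.
Qed.

Variable U : set C.
Hypothesis oU : open U.

Lemma rsum_continuous n0 (g : nat -> C -> R) z : U z ->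
  (forall n, {for z, continuous (g n)}) ->
  (forall w, U w -> dominated n0 (g^~ w)) ->
  {for z, continuous (fun w => rsum (g^~ w))}.
Proof.
move=> Uz cg dg; apply/continuous_rP => e e0.
have e3 : 0 < e / 6 by rewrite divr_gt0.
have [n1 hn1] := half_small e3; pose N := maxn n0 n1.
have cs : {for z, continuous (fun w => series (g^~ w) N)}.
  elim: N => [|N IH].
    have -> : (fun w => series (g^~ w) 0) = cst 0.
      by apply/funext => w; rewrite /series /= big_geq.
    by apply/continuous_rP => e' e0'; exists 1 => // w _; rewrite subrr normr0.
  have -> : (fun w => series (g^~ w) N.+1) = (fun w => series (g^~ w) N + g N w).
    by apply/funext => w; rewrite seriesSr.
  by apply: continuousD => //; exact: cg.
have e2 : 0 < e / 3 by rewrite divr_gt0.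
have [d d0 hd] := iffLR (continuous_rP _ _) cs _ e2.
have [r r0 hr] := iffLR (open_cplxP U) oU z Uz.
exists (Num.min d r); first by rewrite lt_min d0.
move=> w; rewrite lt_min => /andP[/hd h1 /hr Uw].
have h2 := rsum_tail (dg z Uz) (leq_maxl n0 n1).
have h3 := rsum_tail (dg w Uw) (leq_maxl n0 n1).
have h4 := hn1 N (leq_maxr _ _).
rewrite -/N in h2 h3; rewrite ltr_norml; move: h1 h2 h3.
by rewrite ltr_norml !ler_norml => /andP[? ?] /andP[? ?] /andP[? ?]; apply/andP; split; lra.
Qed.

Lemma mean_value_bound (g g' : C -> R) v z (h M : R) :
  (forall t : R, `|t| <= `|h| -> dder v g (z + t%:C * v) (g' (z + t%:C * v))) ->
  (forall t : R, `|t| <= `|h| -> `|g' (z + t%:C * v)| <= M) ->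
  `|g (z + h%:C * v) - g z| <= M * `|h|.
Proof.
move=> dg bg; pose phi (t : R) := g (z + t%:C * v).
have D (t : R) : `|t| <= `|h| -> is_derive t 1 phi (g' (z + t%:C * v)).
  by move=> th; apply: dder_shift; exact: dg.
have phi0 : phi 0 = g z by rewrite /phi mul0r addr0.
rewrite -/(phi h) -phi0.
have [h0|h0] := leP 0 h.
- have th t : t \in `[0, h] -> `|t| <= `|h|.
    by rewrite in_itv /= => /andP[t0 ?]; rewrite !ger0_norm.
  have [||c cI ->] := @MVT_segment R phi (fun t => g' (z + t%:C * v)) 0 h h0.
  + by move=> t tI; apply: D; apply: th; exact: subset_itv_oo_cc tI.
  + apply: derivable_within_continuous => t tI.
    by have [] := D t (th t tI).
  + by rewrite subr0 normrM ler_wpM2r// bg// th.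
- have th t : t \in `[h, 0] -> `|t| <= `|h|.
    by rewrite in_itv /= => /andP[? t0]; rewrite !ler0_norm ?lerN2// ltW.
  have [||c cI] := @MVT_segment R phi (fun t => g' (z + t%:C * v)) h 0 (ltW h0).
  + by move=> t tI; apply: D; apply: th; exact: subset_itv_oo_cc tI.
  + apply: derivable_within_continuous => t tI.
    by have [] := D t (th t tI).
  + by rewrite sub0r distrC => ->; rewrite normrM normrN ler_wpM2r// bg// th.
Qed.

(** The first-order remainder is split at [N]. The first [N] terms are handled by differentiability
    of each term; the others uniformly in [h], since the remainders divided by [2 * h] form a
    dominated series. *)
Lemma rsum_dder n0 (g g' : nat -> C -> R) v :
  (forall n z, U z -> dder v (g n) z (g' n z)) ->
  (forall w, U w -> dominated n0 (g^~ w)) ->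
  (forall w, U w -> dominated n0 (g'^~ w)) ->
  forall z, U z -> dder v (fun w => rsum (g^~ w)) z (rsum (g'^~ z)).
Proof.
move=> dg bg bg' z Uz; apply/dderP => e e0.
have e8 : 0 < e / 8 by rewrite divr_gt0.
have [n1 hn1] := half_small e8; pose N := maxn n0 n1.
have [r r0 hr] := iffLR (open_cplxP U) oU z Uz.
have fin e' : 0 < e' -> exists2 d, 0 < d & forall h : R, `|h| < d ->
    `|series (fun n => g n (z + h%:C * v) - g n z - g' n z * h) N| <= e' * `|h|.
  elim: N e' => [|N IH] e' e0'.
    by exists 1 => // h _; rewrite /series /= big_geq// normr0 mulr_ge0// ltW.
  have e2 : 0 < e' / 2 by rewrite divr_gt0.
  have [d d0 hd] := IH _ e2.
  have [d' d0' hd'] := iffLR (dderP _ _ _ _) (dg N z Uz) _ e2.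
  exists (Num.min d d'); first by rewrite lt_min d0.
  move=> h; rewrite lt_min => /andP[/hd h1 /hd' h2].
  rewrite seriesSr; apply: le_trans (ler_normD _ _) _; lra.
have [d d0 hd] : exists2 d, 0 < d & forall h : R, `|h| < d ->
    `|series (fun n => g n (z + h%:C * v) - g n z - g' n z * h) N| <= e / 2 * `|h|.
  by apply: fin; rewrite divr_gt0.
have V0 : 0 < cabs v + 1 by rewrite ltr_wpDl// cabs_ge0.
exists (Num.min d (r / (cabs v + 1))); first by rewrite lt_min d0 divr_gt0.
move=> h; rewrite lt_min => /andP[h1 h2].
have Ut (t : R) : `|t| <= `|h| -> U (z + t%:C * v).
  move=> th; apply: hr; rewrite addrC addKr cabsM cabs_real.
  rewrite ltr_pdivlMr// in h2; apply: le_lt_trans h2.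
  by rewrite ler_pM ?cabs_ge0// lerDl.
have [->|h0] := eqVneq h 0.
  by rewrite mul0r addr0 subrr mulr0 subr0 normr0 mulr0.
have hp : 0 < `|h| by rewrite normr_gt0.
pose t n := g n (z + h%:C * v) - g n z - g' n z * h.
(* The factor 2 pays for two contributions, each at most [2^-1 ^+ n] times the modulus of [h]: the
   increment of [g n], by the mean value theorem, and the linear term. *)
have dt : dominated n0 (fun n => (2 * h)^-1 * t n).
  move=> n n0n; rewrite normrM normfV normrM ger0_norm// ler_pdivrMl ?mulr_gt0//.
  have m1 : `|g n (z + h%:C * v) - g n z| <= 2^-1 ^+ n * `|h|.
    apply: (@mean_value_bound _ (g' n)) => s sh; first by apply: dg; exact: Ut.
    by apply: (bg' _ (Ut s sh)).
  have m2 : `|g' n z * h| <= 2^-1 ^+ n * `|h|.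
    by rewrite normrM ler_wpM2r//; apply: bg'.
  apply: le_trans (ler_normB _ _) _; lra.
have E : rsum (g^~ (z + h%:C * v)) - rsum (g^~ z) - rsum (g'^~ z) * h =
    (2 * h) * rsum (fun n => (2 * h)^-1 * t n).
  rewrite -(rsumM (2 * h) dt).
  have -> : (fun n => 2 * h * ((2 * h)^-1 * t n)) = t.
    by apply/funext => n; rewrite mulrA mulfV ?mul1r// mulf_neq0.
  symmetry; apply: rsum_unique.
  have -> : series t = (fun n => series (g^~ (z + h%:C * v)) n - series (g^~ z) n
      - series (g'^~ z) n * h).
    by apply/funext => n; rewrite /series /= -sumrB big_distrl /= -sumrB.
  apply: cvgB; first by apply: cvgB; apply: rsum_cvg; apply: bg => //; exact: Ut.
  by apply: cvgMl; apply: rsum_cvg; exact: bg'.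
rewrite E.
have T := rsum_tail dt (leq_maxl n0 n1 : (n0 <= N)%N).
have S : series (fun n => (2 * h)^-1 * t n) N = (2 * h)^-1 * series t N.
  by rewrite /series /= big_distrr.
rewrite S in T.
have -> : 2 * h * rsum (fun n => (2 * h)^-1 * t n) =
  series t N + 2 * h * (rsum (fun n => (2 * h)^-1 * t n) - (2 * h)^-1 * series t N).
  by field.
apply: le_trans (ler_normD _ _) _.
have := hd h h1; rewrite -/t => T1.
rewrite !normrM (ger0_norm (ler0n R 2)).
have T2 : 2 * `|h| * `|rsum (fun n => (2 * h)^-1 * t n) - (2 * h)^-1 * series t N|
   <= 2 * `|h| * (2 * (e / 8)).
  rewrite ler_wpM2l ?mulr_ge0//; apply: le_trans T _.
  by rewrite ler_wpM2l// ltW// hn1// leq_maxr.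
lra.
Qed.

End SmoothSeries.

Section SmoothSeriesThm.
Variable R : realType.
Notation C := (Cplx R).
Variable U : set C.
Hypothesis oU : open U.

Definition bounded_on (u : C -> R) := exists2 M : R, 0 < M & forall z, U z -> `|u z| <= M.

(* The coefficients are bounded by a sequence that tames, for each n, the
   derivatives of order at most n of the n-th term; every fixed derivative of
   the series is then dominated from some rank on. *)
Lemma rsmooth_series (u : nat -> C -> R) (P : nat -> set (C -> R)) :
  (forall n, der_closed U (P n)) -> (forall n g, P n g -> bounded_on g) ->
  (forall n, P n (u n)) ->
  exists2 d : nat -> R, (forall n, 0 < d n) &
    forall c : nat -> R, (forall n, 0 <= c n <= d n) ->
      (forall z, U z -> dominated 0 (fun n => c n * u n z)) /\
      rsmooth U (fun z => rsum (fun n => c n * u n z)).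
Proof.
move=> cP bP Pu.
(* [D] selects a partial derivative inside [P n] and, to be total, returns its argument outside that
   class. A word of booleans then encodes an iterated derivative. *)
have /choice[D hD] : forall q : nat * bool * (C -> R), exists u',
    P q.1.1 q.2 -> P q.1.1 u' /\ forall z, U z -> dder (dir R q.1.2) q.2 z (u' z).
  move=> [[n b] g] /=; have [Pg|nP] := pselect (P n g); last by exists g.
  by have [_ /(_ b)[u' Pu' hu']] := cP n g Pg; exists u'.
pose wd n (g : C -> R) (w : seq bool) := foldl (fun g b => D (n, b, g)) g w.
have Pwd n g w : P n g -> P n (wd n g w).
  by elim: w g => //= b w IH g Pg; apply: IH; exact: (hD (n, b, g) Pg).1.
have bwd n m g : P n g -> exists2 M : R, 0 < M &
    forall w, (size w <= m)%N -> forall z, U z -> `|wd n g w z| <= M.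
  elim: m g => [|m IH] g Pg.
    have [M M0 hM] := bP n g Pg; exists M => // w.
    by rewrite leqn0 size_eq0 => /eqP -> z /hM.
  have [M M0 hM] := bP n g Pg.
  have [M1 M10 hM1] := IH _ (hD (n, true, g) Pg).1.
  have [M2 M20 hM2] := IH _ (hD (n, false, g) Pg).1.
  exists (M + M1 + M2); first by rewrite !addr_gt0.
  move=> [|[] w] /= sw z Uz.
  - by apply: le_trans (hM z Uz) _; lra.
  - by apply: le_trans (hM1 w sw z Uz) _; lra.
  - by apply: le_trans (hM2 w sw z Uz) _; lra.
have /choice[M hM] : forall n, exists M : R, 0 < M /\
    forall w, (size w <= n)%N -> forall z, U z -> `|wd n (u n) w z| <= M.
  by move=> n; have [M M0 h] := bwd n n (u n) (Pu n); exists M.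
exists (fun n => 2^-1 ^+ n / M n) => [n|c hc].
  by rewrite divr_gt0 ?half_gt0// (hM n).1.
have dom w : forall z, U z -> dominated (size w) (fun n => c n * wd n (u n) w z).
  move=> z Uz n wn; have [M0 h] := hM n; have /andP[c0 cd] := hc n.
  rewrite normrM (ger0_norm c0).
  have := ler_pM c0 (normr_ge0 _) cd (h w wn z Uz).
  by rewrite divfK// gt_eqF.
split; first exact: (dom [::]).
exists [set g | exists w, g = fun z => rsum (fun n => c n * wd n (u n) w z)]; last by exists [::].
move=> _ [w ->]; split.
  move=> z Uz; apply: (@rsum_continuous R U oU (size w) (fun n z => c n * wd n (u n) w z)) => //.
    move=> n; have [cw _] := cP n _ (Pwd n (u n) w (Pu n)).
    by apply: continuousM; [apply/continuous_rP => e e0; exists 1 => // ? _; rewrite subrr normr0|exact: cw].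
  exact: dom.
move=> b; exists (fun z => rsum (fun n => c n * wd n (u n) (rcons w b) z)); first by exists (rcons w b).
apply: (@rsum_dder R U oU (size w).+1 (fun n z => c n * wd n (u n) w z)
  (fun n z => c n * wd n (u n) (rcons w b) z)).
- move=> n z Uz; rewrite /wd foldl_rcons -/(wd n (u n) w).
  have [_ /(_ z Uz) H] := hD (n, b, wd n (u n) w) (Pwd n (u n) w (Pu n)).
  exact: (is_deriveZ (c n) H).
- by move=> z Uz; apply: (dominatedW _ (dom w z Uz)).
- by move=> z Uz; have := dom (rcons w b) z Uz; rewrite size_rcons.
Qed.

End SmoothSeriesThm.

(** * Elementary smooth functions attached to a disc *)

Section ElementarySmooth.
Variable R : realType.
Notation C := (Cplx R).
Variables (a : C) (r : R).
Hypothesis r0 : 0 < r.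
Implicit Types (u w : C -> R) (z v : C) (l : R).
Notation ReC := (fun z : C => complex.Re z).
Notation ImC := (fun z : C => complex.Im z).

(** The modulus is not smooth at the centre, so the disc is described by the sign of a polynomial in
    the coordinates. *)
Definition defect (z : C) : R :=
  r ^+ 2 - ((complex.Re z - complex.Re a) ^+ 2 + (complex.Im z - complex.Im a) ^+ 2).

Lemma defectE z : defect z = r ^+ 2 - cabs (z - a) ^+ 2.
Proof. by rewrite sqr_cabs !raddfB. Qed.

Lemma defect_gt0 z : (0 < defect z) = (cabs (z - a) < r).
Proof. by rewrite defectE subr_gt0 ltr_pXn2r ?nnegrE ?cabs_ge0 ?(ltW r0). Qed.

(* Makes conj (z - a) / regsq z a smooth extension of 1/(z - a) into the disc. *)
Definition regsq (z : C) : R := r ^+ 2 - defect z + beta 0 (defect z).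

Lemma regsq_gt0 z : 0 < regsq z.
Proof.
rewrite /regsq; have [h|h] := ltP (cabs (z - a)) r.
  rewrite ltr_wpDl ?beta_gt0 ?defect_gt0// defectE opprB addrC subrK; exact: sqr_ge0.
rewrite ltr_wpDr ?beta_ge0// defectE opprB addrC subrK exprn_gt0//.
exact: lt_le_trans h.
Qed.

Lemma regsq_out z : r <= cabs (z - a) -> regsq z = cabs (z - a) ^+ 2.
Proof.
move=> h; rewrite /regsq beta_le0 ?addr0; first by rewrite defectE opprB addrC subrK.
by rewrite leNgt defect_gt0 -leNgt.
Qed.

(** A class just large enough to contain the regularised poles and the bumps and to be stable under
    both partial derivatives. The constructor with [- defect] serves the exterior of the large disc,
    the one with [defect] the holes. *)
Inductive elem_smooth : (C -> R) -> Prop :=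
| ES_cst c : elem_smooth (fun=> c)
| ES_Re : elem_smooth ReC
| ES_Im : elem_smooth ImC
| ES_add u w : elem_smooth u -> elem_smooth w -> elem_smooth (fun z => u z + w z)
| ES_mul u w : elem_smooth u -> elem_smooth w -> elem_smooth (fun z => u z * w z)
| ES_beta k : elem_smooth (fun z => beta k (defect z))
| ES_betaN k : elem_smooth (fun z => beta k (- defect z))
| ES_inv : elem_smooth (fun z => (regsq z)^-1).

Lemma ES_opp u : elem_smooth u -> elem_smooth (fun z => - u z).
Proof.
move=> Eu; have -> : (fun z => - u z) = (fun z => -1 * u z).
  by apply/funext => z; rewrite mulN1r.
by apply: ES_mul => //; exact: ES_cst.
Qed.

Lemma continuous_Re z : {for z, continuous ReC}.
Proof.
apply/continuous_rP => e e0; exists e => // w; apply: le_lt_trans.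
by rewrite -raddfB ler_Re_cabs.
Qed.

Lemma continuous_Im z : {for z, continuous ImC}.
Proof.
apply/continuous_rP => e e0; exists e => // w; apply: le_lt_trans.
by rewrite -raddfB ler_Im_cabs.
Qed.

Lemma continuous_rcst (c : R) (z : C) : {for z, continuous (fun _ : C => c)}.
Proof. by apply/continuous_rP => e e0; exists 1 => // w _; rewrite subrr normr0. Qed.

Lemma continuous_defect z : {for z, continuous defect}.
Proof.
apply: continuousB; first exact: continuous_rcst.
have cx : {for z, continuous (fun z => complex.Re z - complex.Re a)}.
  by apply: continuousB; [exact: continuous_Re|exact: continuous_rcst].
have cy : {for z, continuous (fun z => complex.Im z - complex.Im a)}.
  by apply: continuousB; [exact: continuous_Im|exact: continuous_rcst].
by apply: continuousD; [exact: continuousM|exact: continuousM].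
Qed.

Lemma continuous_beta_comp k (g : C -> R) z : {for z, continuous g} ->
  {for z, continuous (fun z => beta k (g z))}.
Proof. by move=> cg; apply: (continuous_comp cg); exact: continuous_beta. Qed.

Lemma ES_continuous u z : elem_smooth u -> {for z, continuous u}.
Proof.
elim=> [c|||{}u w _ cu _ cw|{}u w _ cu _ cw|k|k|].
- exact: continuous_rcst.
- exact: continuous_Re.
- exact: continuous_Im.
- exact: continuousD.
- exact: continuousM.
- apply: continuous_beta_comp; exact: continuous_defect.
- by apply: continuous_beta_comp; apply: continuousN; exact: continuous_defect.
- apply: continuousV; first by rewrite gt_eqF// regsq_gt0.
  apply: continuousD; last by apply: continuous_beta_comp; exact: continuous_defect.
  by apply: continuousB; [exact: continuous_rcst|exact: continuous_defect].
Qed.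

Lemma dder_Re v z : dder v ReC z (complex.Re v).
Proof.
apply/dderP => e e0; exists 1 => // h _.
by case: z v => [x y] [x' y'] /=; rewrite mul0r subr0 [x + _]addrC addrK mulrC subrr normr0 mulr_ge0// ltW.
Qed.

Lemma dder_Im v z : dder v ImC z (complex.Im v).
Proof.
apply/dderP => e e0; exists 1 => // h _.
by case: z v => [x y] [x' y'] /=; rewrite mul0r addr0 [y + _]addrC addrK mulrC subrr normr0 mulr_ge0// ltW.
Qed.

Lemma dder_cst v (c : R) z : dder v (fun=> c) z 0.
Proof. exact: is_derive_cst. Qed.

Lemma dderD v u w z l l' : dder v u z l -> dder v w z l' ->
  dder v (fun z => u z + w z) z (l + l').
Proof. exact: is_deriveD. Qed.

Lemma dderN v u z l : dder v u z l -> dder v (fun z => - u z) z (- l).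
Proof. exact: is_deriveN. Qed.

Lemma dderM v u w z l l' : dder v u z l -> dder v w z l' ->
  dder v (fun z => u z * w z) z (u z * l' + w z * l).
Proof.
move=> hu hw; apply: (is_derive_eq (is_deriveM hu hw)).
by rewrite mul0r addr0.
Qed.

Lemma dder_beta v k u z l : dder v u z l ->
  dder v (fun z => beta k (u z)) z ((beta k.+2 (u z) - k%:R * beta k.+1 (u z)) * l).
Proof.
move=> hu; have := is_derive_beta k (u (z + (0 : R)%:C * v)).
rewrite mul0r addr0 => hb.
have E : u (z + (0 : R)%:C * v) = u z by rewrite mul0r addr0.
rewrite -E in hb.
have := @is_derive1_comp R (beta k) (fun h : R => u (z + h%:C * v)) 0 _ _ hb hu.
by rewrite E.
Qed.

Lemma dderV v u z l : u z != 0 -> dder v u z l ->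
  dder v (fun z => (u z)^-1) z (- (u z)^-1 * (u z)^-1 * l).
Proof.
move=> uz hu; have E : u (z + (0 : R)%:C * v) = u z by rewrite mul0r addr0.
have uz' : u (z + (0 : R)%:C * v) != 0 by rewrite E.
apply: (is_derive_eq (is_deriveV uz' hu)); rewrite E /GRing.scale /=.
by rewrite expr2 invfM !mulNr.
Qed.

Lemma dder_defect v z :
  dder v defect z (- (2 * (complex.Re z - complex.Re a) * complex.Re v + 2 * (complex.Im z - complex.Im a) * complex.Im v)).
Proof.
have hx : dder v (fun z => complex.Re z - complex.Re a) z (complex.Re v + 0).
  by apply: dderD; [exact: dder_Re|exact: dder_cst].
have hy : dder v (fun z => complex.Im z - complex.Im a) z (complex.Im v + 0).
  by apply: dderD; [exact: dder_Im|exact: dder_cst].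
apply: dder_eq (dderD (dder_cst v (r ^+ 2) z) (dderN (dderD (dderM hx hx) (dderM hy hy)))) _.
by ring.
Qed.

Lemma ES_ddefect v :
  elem_smooth (fun z => - (2 * (complex.Re z - complex.Re a) * complex.Re v + 2 * (complex.Im z - complex.Im a) * complex.Im v)).
Proof.
have Ex : elem_smooth (fun z => complex.Re z - complex.Re a) := ES_add ES_Re (ES_cst _).
have Ey : elem_smooth (fun z => complex.Im z - complex.Im a) := ES_add ES_Im (ES_cst _).
exact: ES_opp (ES_add (ES_mul (ES_mul (ES_cst _) Ex) (ES_cst _)) (ES_mul (ES_mul (ES_cst _) Ey) (ES_cst _))).
Qed.

Lemma ES_dder u v : elem_smooth u ->
  exists2 u', elem_smooth u' & forall z, dder v u z (u' z).
Proof.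
elim=> [c|||{}u w Eu [u' Eu' hu] Ew [w' Ew' hw]|{}u w Eu [u' Eu' hu] Ew [w' Ew' hw]|k|k|].
- by exists (fun=> 0) => [|z]; [exact: ES_cst|exact: dder_cst].
- by exists (fun=> complex.Re v) => [|z]; [exact: ES_cst|exact: dder_Re].
- by exists (fun=> complex.Im v) => [|z]; [exact: ES_cst|exact: dder_Im].
- by exists (fun z => u' z + w' z) => [|z]; [exact: ES_add|exact: dderD].
- exists (fun z => u z * w' z + w z * u' z) => [|z]; last exact: dderM.
  by apply: ES_add; exact: ES_mul.
- eexists; last by move=> z; apply: dder_beta; exact: dder_defect.
  apply: ES_mul (ES_ddefect v); apply: ES_add; first exact: ES_beta.
  by apply: ES_opp; apply: ES_mul; [exact: ES_cst|exact: ES_beta].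
- eexists; last by move=> z; apply: (@dder_beta v k (fun z => - defect z)); apply: dderN; exact: dder_defect.
  apply: ES_mul (ES_opp (ES_ddefect v)); apply: ES_add; first exact: ES_betaN.
  by apply: ES_opp; apply: ES_mul; [exact: ES_cst|exact: ES_betaN].
- eexists; last first.
    move=> z; apply: dderV; first by rewrite gt_eqF// regsq_gt0.
    apply: dderD; last by apply: dder_beta; exact: dder_defect.
    by apply: dderD; [exact: dder_cst|apply: dderN; exact: dder_defect].
  apply: ES_mul; first by apply: ES_mul; [apply: ES_opp|]; exact: ES_inv.
  apply: ES_add; first by apply: ES_add; [exact: ES_cst|apply: ES_opp; exact: ES_ddefect].
  apply: ES_mul (ES_ddefect v); apply: ES_add; first exact: ES_beta.
  by apply: ES_opp; apply: ES_mul; [exact: ES_cst|exact: ES_beta].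
Qed.

Lemma ES_der_closed U : der_closed U elem_smooth.
Proof.
move=> u Eu; split; first by move=> z _; exact: ES_continuous.
by move=> b; have [u' Eu' h] := ES_dder (dir R b) Eu; exists u' => // z _.
Qed.

Lemma ES_bounded (M : R) u : elem_smooth u -> bounded_on [set z | cabs z < M] u.
Proof.
move=> Eu; have cK : compact [set z : C | cabs (z - 0) <= M].
  by apply: (@compact_cplx _ _ M); [exact: closed_cdisc|move=> z /=; rewrite subr0].
have [|N N0 h] := @continuous_on_bounded R C [set z : C | cabs (z - 0) <= M] u cK.
  move=> z _ e e0; have [d d0 hd] := iffLR (continuous_rP _ _) (ES_continuous (z := z) Eu) e e0.
  by apply/nbhs_cplxP; exists d => // w /hd.
by exists N => // z /= /ltW zM; apply: h; rewrite /= subr0.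
Qed.

End ElementarySmooth.

(** * Swiss cheeses *)

Section SwissCheese.
Variable R : realType.
Notation C := (Cplx R).

Lemma dense_sequence : exists q : nat -> C,
  forall z (e : R), 0 < e -> exists n, cabs (q n - z) < e.
Proof.
exists (fun n => if (unpickle n : option (rat * rat)) is Some p
  then (ratr p.1 +i* ratr p.2 : C) else 0).
move=> z e e0; have e2 : 0 < e / 2 by rewrite divr_gt0.
have H (x : R) : exists p : rat, `|ratr p - x| < e / 2.
  have [|p] := @rat_in_itvoo R (x - e / 2) (x + e / 2); first lra.
  by rewrite in_itv /= => /andP[h1 h2]; exists p; rewrite ltr_norml; apply/andP; split; lra.
have [p hp] := H (complex.Re z); have [p' hp'] := H (complex.Im z).
exists (pickle (p, p')); rewrite pickleK /=.
apply: le_lt_trans (ler_cabs_ReIm _) _; case: z hp hp' => x y /= hp hp'.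
by rewrite [e]splitr ltrD.
Qed.

Lemma finite_gap (T : Type) (s : seq T) (g : T -> R) (e : R) : 0 < e ->
  (forall i, List.In i s -> 0 < g i) ->
  exists2 d, 0 < d <= e & forall i, List.In i s -> d < g i.
Proof.
move=> e0; elim: s => [|i s IH] hs; first by exists e => //; rewrite e0 lexx.
have [|d /andP[d0 de] hd] := IH; first by move=> j js; apply: hs; right.
have gi := hs i (or_introl erefl).
exists (Num.min d (g i / 2)).
  by rewrite lt_min d0 divr_gt0// ge_min de.
move=> j [<-|/hd jd]; first by rewrite gt_min; apply/orP; right; lra.
by rewrite gt_min jd.
Qed.

Variables (a0 : C) (R0 : R).
Hypothesis R0_gt0 : 0 < R0.

(** Greedy choice along a dense sequence [q]: if [q n] lies in the large disc and in none of the
    closed discs chosen so far, it becomes the centre of the next one. Otherwise a disc is placed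
    elsewhere, so that every stage contributes a hole. *)
Lemma swiss_cheese_exists : exists (a : nat -> C) (r : nat -> R),
  [/\ forall n, 0 < r n, forall n, r n <= R0 / 8 * 2^-1 ^+ n,
      forall n, cabs (a n - a0) + r n < R0,
      forall i j, i != j -> r i + r j < cabs (a i - a j) &
      forall z (e : R), 0 < e -> cabs (z - a0) < R0 ->
        exists w i, cabs (w - z) < e /\ cabs (w - a i) < r i].
Proof.
have [q hq] := dense_sequence.
pose inside (p : C * R) := 0 < p.2 /\ cabs (p.1 - a0) + p.2 < R0.
pose valid (s : seq (C * R)) := forall p, List.In p s -> inside p.
pose good (s : seq (C * R)) n (p : C * R) :=
  [/\ inside p, p.2 <= R0 / 8 * 2^-1 ^+ n,
   forall p', List.In p' s -> p'.2 + p.2 < cabs (p'.1 - p.1) &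
   cabs (q n - a0) < R0 -> exists2 p', List.In p' (p :: s) & cabs (q n - p'.1) <= p'.2].
have room s n c : valid s -> cabs (c - a0) < R0 ->
    (forall p', List.In p' s -> p'.2 < cabs (p'.1 - c)) ->
    (cabs (q n - a0) < R0 -> q n = c \/ exists2 p', List.In p' s & cabs (q n - p'.1) <= p'.2) ->
    exists p, good s n p.
  move=> vs cD unc cov.
  have e0 : 0 < Num.min (R0 / 8 * 2^-1 ^+ n) ((R0 - cabs (c - a0)) / 2).
    by rewrite lt_min mulr_gt0 ?half_gt0 ?divr_gt0//= subr_gt0.
  have [i|d /andP[d0 de] hd] := @finite_gap _ s (fun p => cabs (p.1 - c) - p.2) _ e0.
    by move=> /unc; rewrite subr_gt0.
  move: de; rewrite le_min => /andP[de1 de2].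
  exists (c, d); split => //=.
  - by split=> //=; lra.
  - by move=> p' /hd; rewrite ltrBrDl.
  - move=> /cov[->|[p' p's h]]; first by exists (c, d); [left|rewrite subrr cabs0 ltW].
    by exists p' => //; right.
have step s n : valid s -> exists p, good s n p.
  move=> vs.
  have [[qD qu]|nqu] := pselect (cabs (q n - a0) < R0 /\
    forall p', List.In p' s -> p'.2 < cabs (p'.1 - q n)).
    by apply: (room s n (q n)) => // _; left.
  have [m m0 hm] : exists2 m, 0 <= m < R0 & forall p, List.In p s -> cabs (p.1 - a0) + p.2 <= m.
    elim: s vs {nqu} => [|p s IH] vs; first by exists 0; rewrite ?lexx.
    have [|m /andP[m0 mR] hm] := IH; first by move=> p' p's; apply: vs; right.
    have [_ hp] := vs p (or_introl erefl).
    exists (Num.max m (cabs (p.1 - a0) + p.2)); first by rewrite le_max m0 gt_max mR hp.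
    by move=> p' [<-|/hm h]; rewrite le_max ?lexx ?orbT ?h.
  (* The point [q n] requires nothing new. All earlier discs stay within distance [m < R0] of [a0],
     so a point at the intermediate distance [t] is free. *)
  have /andP[m1 m2] := m0; pose t := (m + R0) / 2.
  have tE : cabs (a0 + t%:C - a0) = t.
    by rewrite addrC addKr cabs_real ger0_norm// /t; lra.
  apply: (room s n (a0 + t%:C)) => //.
  - by rewrite tE /t; lra.
  - move=> p' /hm h; have := ler_cabs_dist (a0 + t%:C) p'.1 a0.
    rewrite tE (cabs_dist _ p'.1) /t; lra.
  - move=> qD; right; apply: contrapT => nex; apply: nqu; split => // p' p's.
    rewrite ltNge; apply/negP => h; apply: nex; exists p' => //.
    by rewrite cabs_dist.
have /choice[S hS] : forall sn : seq (C * R) * nat, exists p, valid sn.1 -> good sn.1 sn.2 p.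
  move=> [s n] /=; have [vs|] := pselect (valid s); last by exists (0, 0).
  by have [p hp] := step s n vs; exists p.
pose L := fix L n := if n is n'.+1 then S (L n', n') :: L n' else [::].
have vL n : valid (L n).
  elim: n => [|n IH] //= p [<-|]; last exact: IH.
  by have [] := hS (L n, n) IH.
have gL n := hS (L n, n) (vL n).
have memL i j : (i < j)%N -> List.In (S (L i, i)) (L j).
  elim: j => // j IH; rewrite ltnS leq_eqVlt => /orP[/eqP ->|/IH h] /=; by [left|right].
have Lmem n p : List.In p (L n) -> exists i, p = S (L i, i).
  by elim: n => //= n IH [<-|/IH//]; exists n.
exists (fun n => (S (L n, n)).1), (fun n => (S (L n, n)).2); split.
- by move=> n; have [[]] := gL n.
- by move=> n; have [] := gL n.
- by move=> n; have [[]] := gL n.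
- move=> i j; wlog ij : i j / (i < j)%N => [H|_].
    move=> nij; have [ij|ij] := ltnP i j; first exact: H.
    rewrite addrC cabs_dist; apply: H; last by rewrite eq_sym.
    by rewrite ltn_neqAle eq_sym nij.
  by have [_ _ H _] := gL j; exact: H (memL i j ij).
- move=> z e e0 zD.
  have d0 : 0 < Num.min (e / 2) (R0 - cabs (z - a0)) by rewrite lt_min divr_gt0//= subr_gt0.
  have [n] := hq z _ d0; rewrite lt_min => /andP[h1 h2].
  have qD : cabs (q n - a0) < R0 by have := ler_cabs_dist (q n) z a0; lra.
  have [_ _ _ /(_ qD)[p pL hp]] := gL n.
  have [i pE] := Lmem n.+1 p pL; rewrite pE in hp.
  have ri : 0 < (S (L i, i)).2 by have [[]] := gL i.
  move: hp ri; set ai := (S (L i, i)).1; set r := (S (L i, i)).2 => hp ri.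
  (* The construction only puts [q n] in a closed disc. Sliding it towards the centre by the
     fraction [t] moves it by at most [e / 4] and brings it into the open disc. *)
  pose t : R := Num.min 1 (e / (4 * r)).
  have t0 : 0 < t by rewrite lt_min ltr01 divr_gt0// mulr_gt0.
  have t1 : t <= 1 by rewrite ge_min lexx.
  have tr : t * r <= e / 4.
    have : t <= e / (4 * r) by rewrite ge_min lexx orbT.
    by rewrite ler_pdivlMr ?mulr_gt0//; lra.
  exists (q n + t%:C * (ai - q n)), i; rewrite -/ai -/r; split.
    have -> : q n + t%:C * (ai - q n) - z = (q n - z) + t%:C * (ai - q n) by ring.
    apply: le_lt_trans (ler_cabsD _ _) _.
    rewrite cabsM cabs_real (ger0_norm (ltW t0)) (cabs_dist ai).
    have : t * cabs (q n - ai) <= t * r by rewrite ler_wpM2l// ltW.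
    lra.
  have -> : q n + t%:C * (ai - q n) - ai = (1 - t)%:C * (q n - ai).
    by rewrite rmorphB rmorph1; ring.
  rewrite cabsM cabs_real ger0_norm ?subr_ge0//.
  apply: le_lt_trans (_ : (1 - t) * r < r); first by rewrite ler_wpM2l// subr_ge0.
  by rewrite mulrBl mul1r ltrBlDr ltrDl mulr_gt0.
Qed.

End SwissCheese.

(** * Averages over roots *)

Section DyadicAverages.
Variable R : realType.
Notation C := (Cplx R).
Implicit Types (F G : C -> C) (u w b : C) (rho : R).

(* The average of F over the 2^m-th roots of u. *)
Fixpoint davg (m : nat) F u : C :=
  if m is m'.+1 then
    davg m' (fun t => (F (sqrtC t) + F (- sqrtC t)) / 2) u
  else F u.

Lemma cabs_sqrtC u rho : 0 <= rho -> cabs u = rho ^+ 2 -> cabs (sqrtC u) = rho.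
Proof.
move=> rho0 uE; apply/eqP; rewrite -(eqrXn2 (n := 2)) ?cabs_ge0//.
by rewrite -cabsX sqrtCK uE.
Qed.

Lemma davg_ext m F G rho u : 0 <= rho -> (forall w, cabs w = rho -> F w = G w) ->
  cabs u = rho ^+ (2 ^ m) -> davg m F u = davg m G u.
Proof.
elim: m F G rho => [|m IH] F G rho rho0 FG uE /=; first by apply: FG; rewrite uE.
apply: (IH _ _ (rho ^+ 2)); first exact: sqr_ge0.
  by move=> t tE; rewrite !FG ?cabsN ?(cabs_sqrtC rho0).
by rewrite uE -exprM expnS.
Qed.

Lemma davg_bound m F rho M u : 0 <= rho -> (forall w, cabs w = rho -> cabs (F w) <= M) ->
  cabs u = rho ^+ (2 ^ m) -> cabs (davg m F u) <= M.
Proof.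
elim: m F rho => [|m IH] F rho rho0 FM uE /=; first by apply: FM; rewrite uE.
apply: (IH _ (rho ^+ 2)); first exact: sqr_ge0; last by rewrite uE -exprM expnS.
move=> t tE; have E := cabs_sqrtC rho0 tE.
have h1 := FM _ E; have h2 : cabs (F (- sqrtC t)) <= M by apply: FM; rewrite cabsN.
have c2 : cabs (2 : C) = 2 by rewrite /cabs normr_nat.
rewrite cabsM cabsV c2 ler_pdivrMr//.
apply: le_trans (ler_cabsD _ _) _; lra.
Qed.

Lemma davgD m F G u : davg m (fun w => F w + G w) u = davg m F u + davg m G u.
Proof.
elim: m F G => [|m IH] F G //=; rewrite -IH; congr davg.
by apply/funext => t; field.
Qed.

Lemma davgZ m (c : C) F u : davg m (fun w => c * F w) u = c * davg m F u.
Proof.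
elim: m F => [|m IH] F //=; rewrite -IH; congr davg.
by apply/funext => t; field.
Qed.

Lemma davg_cst m (c : C) u : davg m (fun=> c) u = c.
Proof.
elim: m => [|m IH] //=; rewrite -[RHS]IH; congr davg.
by apply/funext => t; field.
Qed.

Lemma davg_id m u : davg m.+1 (fun w => w) u = 0.
Proof.
rewrite /= -[RHS](davg_cst m 0 u); congr davg.
by apply/funext => t; rewrite subrr mul0r.
Qed.

(** The half-sum of [w / (w - b)] over [w = s] and [w = - s] is [s ^+ 2 / (s ^+ 2 - b ^+ 2)]: each
    halving squares the pole and the radius and keeps the shape of the function. *)
Lemma davg_pole m rho b u : 0 < rho -> cabs b != rho -> cabs u = rho ^+ (2 ^ m) ->
  davg m (fun w => w / (w - b)) u = u / (u - b ^+ (2 ^ m)).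
Proof.
elim: m rho b => [|m IH] rho b rho0 brho uE /=; first by rewrite expn0 expr1.
rewrite expnS exprM -(IH (rho ^+ 2)) ?exprn_gt0//; last 2 first.
- by rewrite cabsX eqrXn2 ?cabs_ge0// ltW.
- by rewrite -exprM -expnS.
apply: (@davg_ext _ _ _ (rho ^+ 2)); first exact: sqr_ge0; last first.
  by rewrite -exprM -expnS.
move=> t tE; have E := cabs_sqrtC (ltW rho0) tE.
rewrite -[in RHS](sqrtCK t).
have h1 : sqrtC t - b != 0.
  by apply: contra brho => /eqP/subr0_eq <-; rewrite E.
have h2 : sqrtC t + b != 0.
  apply: contra brho; rewrite addr_eq0 => /eqP bE.
  by rewrite -(cabsN b) -bE E.
have h3 : - sqrtC t - b != 0 by rewrite -opprD oppr_eq0.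
have h4 : sqrtC t ^+ 2 - b ^+ 2 != 0 by rewrite subr_sqr mulf_neq0.
by field; rewrite h1 h3 h4.
Qed.

(** A discrete version of the integral of [g] along the circle divided by 2 pi i: the weight [w]
    comes from dz = i w dtheta, and the roots of the positive number [rho ^+ (2 ^ m)] lie on the
    circle. *)
Definition cmean m (c : C) rho (g : C -> C) : C :=
  davg m (fun w => g (c + w) * w) (rho ^+ (2 ^ m))%:C.

Lemma cabs_realX rho n : 0 <= rho -> cabs ((rho ^+ n)%:C : C) = rho ^+ n.
Proof. by move=> h; rewrite cabs_real ger0_norm// exprn_ge0. Qed.

Lemma cmeanD m c rho g h :
  cmean m c rho (fun z => g z + h z) = cmean m c rho g + cmean m c rho h.
Proof. by rewrite /cmean -davgD; congr davg; apply/funext => w; rewrite mulrDl. Qed.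

Lemma cmeanZ m c rho k g : cmean m c rho (fun z => k * g z) = k * cmean m c rho g.
Proof. by rewrite /cmean -davgZ; congr davg; apply/funext => w; rewrite mulrA. Qed.

Lemma cmean_bound m c rho g M : 0 <= rho ->
  (forall z, cabs (z - c) = rho -> cabs (g z) <= M) -> cabs (cmean m c rho g) <= M * rho.
Proof.
move=> rho0 gM; apply: (davg_bound rho0); last exact: cabs_realX.
by move=> w wE; rewrite cabsM wE ler_wpM2r// gM// addrC addKr.
Qed.

(** On the circle, [conjc (c + w) * w] is [conjc c * w + rho ^+ 2], and the mean of [w] is zero. The
    rank is a successor because opposite roots must be paired at least once. *)
Lemma cmean_conj m c rho : 0 <= rho ->
  cmean m.+1 c rho (fun z => conjc z) = ((rho ^+ 2)%:C : C).
Proof.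
move=> rho0; rewrite /cmean.
rewrite (@davg_ext _ _ (fun w => conjc c * w + (rho ^+ 2)%:C) rho)//.
- by rewrite davgD davgZ davg_id mulr0 add0r davg_cst.
- by move=> w wE; rewrite rmorphD mulrDl [conjc w * w]mulrC mul_conjc_cabs wE.
- exact: cabs_realX.
Qed.

Lemma cmean_pole m c rho b : 0 < rho -> cabs (b - c) != rho ->
  cmean m c rho (fun z => (z - b)^-1) =
  (rho ^+ (2 ^ m))%:C / ((rho ^+ (2 ^ m))%:C - (b - c) ^+ (2 ^ m)).
Proof.
move=> rho0 bc; rewrite /cmean -(davg_pole rho0 bc) ?cabs_realX ?(ltW rho0)//.
congr davg; apply/funext => w; rewrite mulrC; congr (_ / _); ring.
Qed.

Lemma small_dyadic_power (t e : R) : 0 <= t < 1 -> 0 < e ->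
  exists m0, forall m, (m0 <= m)%N -> t ^+ (2 ^ m) < e.
Proof.
move=> /andP[t0 t1] e0; have h : `|t| < 1 by rewrite ger0_norm.
have /cvgrPdist_lt /(_ e e0)[n0 _ H] := @cvg_expr R _ h.
exists n0 => m hm; have := H (2 ^ m)%N; rewrite /= sub0r normrN ger0_norm ?exprn_ge0//.
by apply; apply: leq_trans hm _; apply: ltnW; exact: ltn_expl.
Qed.

(** The limit is the winding number of the circle around [b]. Let [y] be the 2^m-th power of
    [(b - c) / rho], or of its inverse when [b] is outside: up to sign, the mean differs from its
    limit by [y / (1 - y)]. *)
Lemma cmean_pole_lim c rho b (e : R) : 0 < rho -> cabs (b - c) != rho -> 0 < e ->
  exists m0, forall m, (m0 <= m)%N ->
    cabs (cmean m c rho (fun z => (z - b)^-1) - (cabs (b - c) < rho)%R%:R) < e.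
Proof.
move=> rho0 bc e0.
have e2 : 0 < Num.min 2^-1 (e / 2) by rewrite lt_min invr_gt0 ltr0n divr_gt0.
have rc : (rho%:C : C) != 0 by rewrite -cabs_gt0 cabs_real normr_gt0 gt_eqF.
have key (y : C) : cabs y < Num.min 2^-1 (e / 2) -> cabs (y / (1 - y)) < e.
  rewrite lt_min => /andP[y1 y2]; rewrite cabsM cabsV.
  have := lerB_cabs 1 y; rewrite cabs1 => h.
  have d0 : 0 < cabs (1 - y) by lra.
  rewrite ltr_pdivrMr//; nra.
have [lt|gt|/eqP] := ltgtP (cabs (b - c)) rho; last by rewrite (negPf bc).
- have [|m0 hm] := @small_dyadic_power (cabs ((b - c) / rho%:C)) _ _ e2.
    by rewrite cabs_ge0 cabsM cabsV cabs_real (gtr0_norm rho0) ltr_pdivrMr// mul1r.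
  exists m0 => m /hm; rewrite -cabsX cmean_pole// => h; have := key _ h.
  congr (cabs _ < _); rewrite expr_div_n rmorphXn /=.
  set y := (b - c) ^+ _; set x := rho%:C ^+ _.
  have x0 : x != 0 by rewrite expf_neq0.
  have xy : x - y != 0.
    apply/eqP => /subr0_eq E; have := congr1 (@cabs R) E.
    rewrite /x /y !cabsX cabs_real (gtr0_norm rho0) => /eqP.
    by rewrite eqrXn2 ?cabs_ge0 ?expn_gt0 ?(ltW rho0)// eq_sym (negPf bc).
  by field; rewrite x0 xy.
- have bc0 : b - c != 0 by rewrite -cabs_gt0; apply: lt_trans gt.
  have [|m0 hm] := @small_dyadic_power (cabs (rho%:C / (b - c))) _ _ e2.
    rewrite cabs_ge0 cabsM cabsV cabs_real (gtr0_norm rho0) ltr_pdivrMr ?mul1r//.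
    by rewrite cabs_gt0.
  exists m0 => m /hm; rewrite -cabsX cmean_pole// => h; have := key _ h.
  rewrite -cabsN; congr (cabs _ < _); rewrite expr_div_n rmorphXn /= subr0.
  set y := (b - c) ^+ _; set x := rho%:C ^+ _.
  have y0 : y != 0 by rewrite expf_neq0.
  have xy : x - y != 0.
    apply/eqP => /subr0_eq E; have := congr1 (@cabs R) E.
    rewrite /x /y !cabsX cabs_real (gtr0_norm rho0) => /eqP.
    by rewrite eqrXn2 ?cabs_ge0 ?expn_gt0 ?(ltW rho0)// eq_sym (negPf bc).
  have yx : y - x != 0 by rewrite -opprB oppr_eq0.
  by field; rewrite y0 xy yx.
Qed.

End DyadicAverages.

(** * Circle averages on a Swiss cheese *)

Section CheeseApproximation.
Variable R : realType.
Notation C := (Cplx R).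
Variables (a0 : C) (R0 : R) (a : nat -> C) (r : nat -> R).
Hypothesis R0_gt0 : 0 < R0.
Hypothesis r_gt0 : forall n, 0 < r n.
Hypothesis r_le : forall n, r n <= R0 / 8 * 2^-1 ^+ n.
Hypothesis a_in : forall n, cabs (a n - a0) + r n < R0.
Hypothesis a_sep : forall i j, i != j -> r i + r j < cabs (a i - a j).

Definition cheese : set C :=
  [set z | cabs (z - a0) <= R0 /\ forall n, r n <= cabs (z - a n)].

Lemma outer_circle_cheese z : cabs (z - a0) = R0 -> cheese z.
Proof.
move=> zE; split=> [|n]; first by rewrite zE.
have := ler_cabs_dist z (a n) a0; have := a_in n; lra.
Qed.

Lemma inner_circle_cheese n z : cabs (z - a n) = r n -> cheese z.
Proof.
move=> zE; split=> [|j].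
  have := ler_cabs_dist z (a n) a0; have := a_in n; lra.
have [->|nj] := eqVneq j n; first by rewrite zE.
have := ler_cabs_dist (a n) z (a j); have := a_sep nj.
by rewrite (cabs_dist (a n) z) zE (cabs_dist (a j) (a n)); lra.
Qed.

Lemma notin_cheeseP b : ~ cheese b ->
  R0 < cabs (b - a0) \/ exists n, cabs (b - a n) < r n.
Proof.
move=> nb; have [h|h] := ltP R0 (cabs (b - a0)); [by left|right].
apply: contrapT => nex; apply: nb; split=> // n.
by rewrite leNgt; apply/negP => hn; apply: nex; exists n.
Qed.

Lemma sum_r_le J : \sum_(j < J) r j <= R0 / 4.
Proof.
have : \sum_(j < J) r j <= R0 / 4 - R0 / 4 * 2^-1 ^+ J.
  elim: J => [|J IH]; first by rewrite big_ord0 expr0 mulr1 subrr.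
  rewrite big_ord_recr /= exprS; have := r_le J; lra.
move=> h; apply: le_trans h _.
by rewrite gerBl mulr_ge0 ?half_ge0// divr_ge0// ltW.
Qed.

Lemma sum_r2_le J : \sum_(j < J) r j ^+ 2 <= R0 / 8 * (R0 / 4).
Proof.
apply: le_trans (_ : R0 / 8 * \sum_(j < J) r j <= _); last first.
  by rewrite ler_wpM2l ?sum_r_le// divr_ge0// ltW.
rewrite mulr_sumr; apply: ler_sum => j _; rewrite expr2 ler_wpM2r ?(ltW (r_gt0 j))//.
apply: le_trans (r_le j) _; rewrite ger_pMr ?divr_gt0//.
by rewrite exprn_ile1// invf_le1 ?ler1n.
Qed.

(** The annihilating boundary measure, truncated to the first [J] holes and discretised at level
    [m]. Both parameters stay finite, so no limit of means is ever formed. *)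
Definition cheese_mean m J (g : C -> C) : C :=
  cmean m a0 R0 g - \sum_(j < J) cmean m (a j) (r j) g.

Lemma cheese_meanD m J g h : cheese_mean m J (fun z => g z + h z) =
  cheese_mean m J g + cheese_mean m J h.
Proof.
rewrite /cheese_mean cmeanD; under eq_bigr do rewrite cmeanD.
by rewrite big_split /=; ring.
Qed.

Lemma cheese_meanZ m J c g : cheese_mean m J (fun z => c * g z) = c * cheese_mean m J g.
Proof.
rewrite /cheese_mean cmeanZ; under eq_bigr do rewrite cmeanZ.
by rewrite -mulr_sumr; ring.
Qed.

Lemma cheese_mean_bound m J g M : 0 <= M -> (forall z, cheese z -> cabs (g z) <= M) ->
  cabs (cheese_mean m J g) <= M * (R0 + R0 / 4).
Proof.
move=> M0 gM; apply: le_trans (ler_cabsB _ _) _; rewrite mulrDr lerD//.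
  apply: cmean_bound => [|z zE]; first exact: ltW.
  exact/gM/outer_circle_cheese.
apply: le_trans (ler_cabs_sum _ _ _) _.
apply: le_trans (_ : M * \sum_(j < J) r j <= _); last by rewrite ler_wpM2l// sum_r_le.
rewrite mulr_sumr; apply: ler_sum => j _; apply: cmean_bound => [|z zE]; first exact: ltW.
exact/gM/(inner_circle_cheese zE).
Qed.

Lemma cheese_mean_conj m J : cheese_mean m.+1 J (fun z => conjc z) =
  (R0 ^+ 2 - \sum_(j < J) r j ^+ 2)%:C.
Proof.
rewrite /cheese_mean cmean_conj ?(ltW R0_gt0)//.
under eq_bigr do rewrite cmean_conj ?(ltW (r_gt0 _))//.
by rewrite rmorphB rmorph_sum.
Qed.

(** Beyond the large disc all winding numbers of [b] vanish. In a hole, that of the outer circle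
    cancels against that of this one hole, the holes being disjoint; [J0] only has to count this
    hole, and is therefore chosen before the precision. *)
Lemma cheese_mean_pole b : ~ cheese b -> exists J0, forall J, (J0 <= J)%N ->
  forall e : R, 0 < e -> exists m0, forall m, (m0 <= m)%N ->
    cabs (cheese_mean m J (fun z => (z - b)^-1)) < e.
Proof.
move=> nb.
have bout : cabs (b - a0) != R0 by apply/eqP => /outer_circle_cheese.
have bin n : cabs (b - a n) != r n by apply/eqP => /inner_circle_cheese.
pose d0 : C := (cabs (b - a0) < R0)%R%:R.
pose d j : C := (cabs (b - a j) < r j)%R%:R.
have lim J (e : R) : 0 < e -> exists m0, forall m, (m0 <= m)%N ->
    cabs (cheese_mean m J (fun z => (z - b)^-1) - (d0 - \sum_(j < J) d j)) < e.
  elim: J e => [|J IH] e e0.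
    have [m0 hm] := cmean_pole_lim R0_gt0 bout e0; exists m0 => m /hm.
    by rewrite /cheese_mean !big_ord0 !subr0.
  have e2 : 0 < e / 2 by rewrite divr_gt0.
  have [m0 hm] := IH _ e2.
  have [m1 hm1] := cmean_pole_lim (r_gt0 J) (bin J) e2.
  exists (maxn m0 m1) => m; rewrite geq_max => /andP[/hm h0 /hm1 h1].
  move: h0 h1; rewrite /cheese_mean !big_ord_recr /= -/(d J).
  move: (cmean m a0 _ _) (\sum_(i < J) cmean _ _ _ _) (\sum_(i < J) d i) (cmean m (a J) _ _) (d J).
  move=> x1 x2 x3 x4 x5 h0 h1.
  have -> : x1 - (x2 + x4) - (d0 - (x3 + x5)) = (x1 - x2 - (d0 - x3)) - (x4 - x5) by ring.
  by apply: le_lt_trans (ler_cabsB _ _) _; rewrite [e]splitr ltrD.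
suff [J0 hJ0] : exists J0, forall J, (J0 <= J)%N -> d0 - \sum_(j < J) d j = 0.
  exists J0 => J /hJ0 E e e0; have [m0 hm] := lim J e e0.
  by exists m0 => m /hm; rewrite E subr0.
have [h|[n hn]] := notin_cheeseP nb.
  exists 0%N => J _; rewrite /d0 ltNge (ltW h) /= big1 ?subr0// => j _.
  rewrite /d ltNge; suff -> : r j <= cabs (b - a j) by [].
  have := ler_cabs_dist b (a j) a0; have := a_in j; lra.
exists n.+1 => J nJ; rewrite /d0.
have -> : cabs (b - a0) < R0 by have := ler_cabs_dist b (a n) a0; have := a_in n; lra.
rewrite (bigD1 (Ordinal nJ))//= /d hn big1 ?addr0 ?subrr// => j jn.
suff /ltW h : r j < cabs (b - a j) by rewrite ltNge h.
have nj : n != j by apply: contra jn => /eqP E; apply/eqP/val_inj.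
have := ler_cabs_dist (a n) b (a j); have := a_sep nj.
by rewrite (cabs_dist (a n) b); lra.
Qed.

Lemma cheese_mean_poles (s : seq (C * C)) : (forall p, List.In p s -> ~ cheese p.2) ->
  exists J0, forall J, (J0 <= J)%N ->
  forall e : R, 0 < e -> exists m0, forall m, (m0 <= m)%N ->
    cabs (cheese_mean m J (fun z => \sum_(p <- s) p.1 / (z - p.2))) < e.
Proof.
elim: s => [|p s IH] hs.
  exists 0%N => J _ e e0; exists 0%N => m _.
  have -> : (fun z : C => \sum_(p <- [::]) p.1 / (z - p.2)) = (fun z => 0 * z).
    by apply/funext => z; rewrite big_nil mul0r.
  by rewrite cheese_meanZ mul0r cabs0.
have [|J0 h0] := IH; first by move=> p' hp'; apply: hs; right.
have [J1 h1] := cheese_mean_pole (hs p (or_introl erefl)).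
exists (maxn J0 J1) => J; rewrite geq_max => /andP[/h0 {}h0 /h1 {}h1] e e0.
have c0 : 0 < 1 + cabs p.1 by rewrite ltr_wpDr ?cabs_ge0.
have e2 : 0 < e / 2 by rewrite divr_gt0.
have e3 : 0 < e / 2 / (1 + cabs p.1) by rewrite divr_gt0.
have [m0 hm0] := h0 _ e2; have [m1 hm1] := h1 _ e3.
exists (maxn m0 m1) => m; rewrite geq_max => /andP[/hm0 k0 /hm1 k1].
have -> : (fun z : C => \sum_(p <- p :: s) p.1 / (z - p.2)) =
   (fun z => p.1 * (z - p.2)^-1 + \sum_(p <- s) p.1 / (z - p.2)).
  by apply/funext => z; rewrite big_cons.
rewrite cheese_meanD cheese_meanZ; apply: le_lt_trans (ler_cabsD _ _) _.
rewrite cabsM [e]splitr ltr_leD ?(ltW k0)//.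
rewrite ltr_pdivlMr// in k1.
by have := cabs_ge0 (cheese_mean m J (fun z => (z - p.2)^-1)); nra.
Qed.

(** In units of [R0 ^+ 2]: the mean of conj is at least 31/32, while an approximation within
    [R0 / 4] would bound it by 5/16, from the difference, plus 1/4, from the poles. *)
Lemma conj_not_poles (s : seq (C * C)) : (forall p, List.In p s -> ~ cheese p.2) ->
  ~ (forall z, cheese z -> cabs (conjc z - \sum_(p <- s) p.1 / (z - p.2)) < R0 / 4).
Proof.
move=> hs happ.
have [J0 /(_ _ (leqnn _)) hJ] := cheese_mean_poles hs.
have e0 : 0 < R0 ^+ 2 / 4 by rewrite divr_gt0 ?exprn_gt0.
(* Rank [m0.+1] instead of [m0], since the mean of conj is computed for successor ranks. *)
have [m0 /(_ _ (leqnSn _)) hm] := hJ _ e0.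
set S := fun z : C => \sum_(p <- s) p.1 / (z - p.2) in hm happ.
have b := @cheese_mean_bound m0.+1 J0 (fun z => conjc z - S z) (R0 / 4).
have {}b := b (ltW (divr_gt0 R0_gt0 (ltr0n R 4))) (fun z kz => ltW (happ z kz)).
have E : cheese_mean m0.+1 J0 (fun z => conjc z) =
    cheese_mean m0.+1 J0 (fun z => conjc z - S z) + cheese_mean m0.+1 J0 S.
  by rewrite -cheese_meanD; congr cheese_mean; apply/funext => z; rewrite subrK.
have := ler_cabsD (cheese_mean m0.+1 J0 (fun z => conjc z - S z)) (cheese_mean m0.+1 J0 S).
rewrite -E cheese_mean_conj cabs_real.
have h2 := sum_r2_le J0.
have := ler_norm (R0 ^+ 2 - \sum_(j < J0) r j ^+ 2).
by have := exprn_gt0 2 R0_gt0; lra.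
Qed.

End CheeseApproximation.

(** * The generators *)

Section CheeseFunctions.
Variable R : realType.
Notation C := (Cplx R).
Variables (a0 : C) (R0 : R) (a : nat -> C) (r : nat -> R).
Hypothesis R0_gt0 : 0 < R0.
Hypothesis r_gt0 : forall n, 0 < r n.
Notation K := (cheese a0 R0 a r).
Variable M : R.
Notation U := [set z : C | cabs z < M].

Lemma open_U : open U.
Proof. by have := @open_cdisc R 0 M; under eq_set do rewrite subr0. Qed.

(** One coefficient sequence must serve several series: the real and imaginary parts of [F1] share
    it, and [rho] must be the same function in both generators built from it. *)
Lemma rsmooth_series_list (us : seq (nat -> C -> R)) :
  (forall u, List.In u us -> forall n, elem_smooth (a n) (r n) (u n)) ->
  exists2 d : nat -> R, (forall n, 0 < d n) &
    forall c : nat -> R, (forall n, 0 <= c n <= d n) -> forall u, List.In u us ->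
      (forall z, U z -> dominated 0 (fun n => c n * u n z)) /\
      rsmooth U (fun z => rsum (fun n => c n * u n z)).
Proof.
elim: us => [|u us IH] hus; first by exists (fun=> 1).
have [|d d0 hd] := IH; first by move=> w hw; apply: hus; right.
have [|||d' d0' hd'] := @rsmooth_series R U open_U u (fun n => elem_smooth (a n) (r n)).
- by move=> n; exact: ES_der_closed.
- by move=> n g; exact: ES_bounded.
- by apply: hus; left.
exists (fun n => Num.min (d n) (d' n)); first by move=> n; rewrite lt_min d0 d0'.
move=> c hc w [<-|hw].
  by apply: hd' => n; have /andP[-> ] := hc n; rewrite le_min => /andP[].
by apply: hd => // n; have /andP[-> ] := hc n; rewrite le_min => /andP[].
Qed.

Definition poleRe n (z : C) : R := (complex.Re z - complex.Re (a n)) * (regsq (a n) (r n) z)^-1.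
Definition poleIm n (z : C) : R := - (complex.Im z - complex.Im (a n)) * (regsq (a n) (r n) z)^-1.
(** Positive exactly on the n-th hole, as [outer] is exactly beyond the large disc; a sum of both
    kinds with positive coefficients vanishes exactly on K. *)
Definition bump n (z : C) : R := beta 0 (defect (a n) (r n) z).
Definition outer (z : C) : R := beta 0 (- defect a0 R0 z).

Lemma pole_partE n z : K z -> poleRe n z +i* poleIm n z = (z - a n)^-1 :> C.
Proof.
move=> [_ /(_ n) h]; rewrite /poleRe /poleIm regsq_out// invc_norm normE -rmorphXn /=.
rewrite -fmorphV; set t := (_ ^+ 2)^-1; case: z {h} @t => x y t; case: (a n) => x' y' /=.
by apply/eqP; rewrite eq_complex /=; apply/andP; split; apply/eqP; ring.
Qed.

Lemma rsum_ge_term x n : (forall k, 0 <= x k) -> dominated 0 x -> x n <= rsum x :> R.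
Proof.
move=> x0 dx; apply/ler_addgt0Pr => e e0.
have e2 : 0 < e / 2 by rewrite divr_gt0.
have [n1 hn1] := half_small e2.
have h := rsum_tail dx (leq0n (maxn n.+1 n1)).
have h1 := hn1 _ (leq_maxr n.+1 n1).
suff h2 : x n <= series x (maxn n.+1 n1).
  move: h; rewrite ler_norml => /andP[? ?]; lra.
rewrite /series /= big_mkord (bigD1 (Ordinal (leq_maxl n.+1 n1)))//= lerDl.
by apply: sumr_ge0.
Qed.

Lemma rsum0 : rsum (fun=> 0 : R) = 0.
Proof.
apply: rsum_unique; have -> : series (fun=> 0 : R) = cst 0.
  by apply/funext => n; rewrite /series /= big1.
exact: cvg_cst.
Qed.

(** On K a Lagrange factor [(z - a j) / (a i - a j)] has modulus at most [2 * R0 / r j], because the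
    centres are separated by the radii. This product therefore outweighs every Lagrange polynomial
    with nodes among the first [N] centres. *)
Definition radius_ratio N : R := \prod_(j < N) (r j / (2 * R0)).

Hypothesis r_le : forall n, r n <= R0 / 8 * 2^-1 ^+ n.

Lemma r_le_R0 n : r n <= R0.
Proof.
apply: le_trans (r_le n) _; have h : 2^-1 ^+ n <= 1 :> R.
  by rewrite exprn_ile1// invf_le1 ?ler1n.
have := half_gt0 R n; have := R0_gt0; nra.
Qed.

Lemma ratio_gt0 n : 0 < r n / (2 * R0).
Proof. by rewrite divr_gt0// mulr_gt0. Qed.

Lemma ratio_le1 n : r n / (2 * R0) <= 1.
Proof. by rewrite ler_pdivrMr ?mulr_gt0// mul1r; have := r_le_R0 n; have := R0_gt0; lra. Qed.

Lemma radius_ratio_gt0 N : 0 < radius_ratio N.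
Proof. by apply: prodr_gt0 => j _; exact: ratio_gt0. Qed.

Lemma radius_ratio_le N n : (N <= n)%N -> radius_ratio n <= radius_ratio N.
Proof.
elim: n => [|n IH]; first by rewrite leqn0 => /eqP ->.
rewrite leq_eqVlt => /orP[/eqP ->//|]; rewrite ltnS => /IH h.
apply: le_trans h; rewrite /radius_ratio big_ord_recr /= ger_pMr ?ratio_le1//.
exact: radius_ratio_gt0.
Qed.

(** The tail estimate is confined to K, where the regularised poles are the true ones. Its constant
    4 is the 2 of a geometric tail, counted for the real and for the imaginary part. *)
Lemma cheese_functions_exist : exists (c : nat -> R) (F1 : C -> C) (rho : C -> R),
  [/\ forall n, 0 < c n,
      forall N z, K z -> U z -> cabs (F1 z - \sum_(j < N) (c j)%:C / (z - a j)) <=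
        4 * 2^-1 ^+ N * radius_ratio N,
      forall z, U z -> 0 <= rho z /\ (rho z = 0 <-> K z),
      forall k, Ck_on k U F1 &
      (forall k, Ck_on k U (fun z => ((rho z)%:C : C))) /\
      exists2 F3, (forall k, Ck_on k U F3) &
        forall z, U z -> F3 z = (rho z)%:C * (conjc z : C)].
Proof.
(* The last two families are the components of [bump n] times conj: [rho] times conj is obtained as
   a series of its own, with the same coefficients as [rho]. *)
pose us := [:: poleRe; poleIm; bump; (fun n z => bump n z * complex.Re z);
  (fun n z => bump n z * - complex.Im z)].
have ES_pole n : elem_smooth (a n) (r n) (poleRe n) /\ elem_smooth (a n) (r n) (poleIm n).
  have E1 : elem_smooth (a n) (r n) (fun z => complex.Re z - complex.Re (a n)) :=
    ES_add (ES_Re _ _) (ES_cst _ _ _).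
  have E2 : elem_smooth (a n) (r n) (fun z => complex.Im z - complex.Im (a n)) :=
    ES_add (ES_Im _ _) (ES_cst _ _ _).
  split; first exact: ES_mul E1 (ES_inv _ _).
  exact: ES_mul (ES_opp E2) (ES_inv _ _).
have [|d d0 hd] := @rsmooth_series_list us.
  move=> u; rewrite /us /=; case=> [<-|[<-|[<-|[<-|[<-|//]]]]] n.
  - by have [] := ES_pole n.
  - by have [] := ES_pole n.
  - exact: ES_beta.
  - by apply: ES_mul; [exact: ES_beta|exact: ES_Re].
  - by apply: ES_mul; [exact: ES_beta|apply: ES_opp; exact: ES_Im].
(* [d n] ensures smoothness. In the second bound, [r n] compensates the size of the pole on K and
   [radius_ratio n] the Lagrange factors. *)
pose c n := Num.min (d n) (r n * 2^-1 ^+ n * radius_ratio n).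
have c0 n : 0 < c n by rewrite lt_min d0 !mulr_gt0 ?half_gt0 ?radius_ratio_gt0.
have cd n : 0 <= c n <= d n by rewrite ltW//= ge_min lexx.
have cr n : c n <= r n * 2^-1 ^+ n * radius_ratio n by rewrite ge_min lexx orbT.
have {}hd := hd c cd.
have [domRe smRe] := hd poleRe (or_introl erefl).
have [domIm smIm] := hd poleIm (or_intror (or_introl erefl)).
have [domB smB] := hd bump (or_intror (or_intror (or_introl erefl))).
have [domX smX] := hd (fun n z => bump n z * complex.Re z)
  (or_intror (or_intror (or_intror (or_introl erefl)))).
have [domY smY] := hd (fun n z => bump n z * - complex.Im z)
  (or_intror (or_intror (or_intror (or_intror (or_introl erefl))))).
pose S u (z : C) := rsum (fun n => c n * u n z).
pose F1 z : C := S poleRe z +i* S poleIm z.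
pose rho z := outer z + S bump z.
have smO u : elem_smooth a0 R0 u -> rsmooth U u.
  by move=> Eu; exists (elem_smooth a0 R0) => //; exact: ES_der_closed.
have sm0 : rsmooth U (fun=> 0) by apply: smO; exact: ES_cst.
have Eo : elem_smooth a0 R0 outer by exact: ES_betaN.
have smrho : rsmooth U rho by apply: rsmooth_add => //; exact: smO.
exists c, F1, rho; split => //.
- move=> N z Kz Uz.
  have tail (u : nat -> C -> R) :
      (forall z, U z -> dominated 0 (fun n => c n * u n z)) ->
      (forall n, `|u n z| <= cabs ((z - a n)^-1)) ->
      `|S u z - \sum_(j < N) c j * u j z| <= 2 * 2^-1 ^+ N * radius_ratio N.
    (* As [radius_ratio] decreases, the terms from rank [N] on stay dominated after division by
       [radius_ratio N], and the general tail bound applies. *)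
    move=> du hu; pose y n := (radius_ratio N)^-1 * (c n * u n z).
    have rN := radius_ratio_gt0 N.
    have dy : dominated N y.
      move=> n Nn; rewrite normrM normfV (gtr0_norm rN) ler_pdivrMl//.
      rewrite normrM (gtr0_norm (c0 n)).
      have h : `|u n z| <= (r n)^-1.
        apply: le_trans (hu n) _; rewrite cabsV lef_pV2 ?posrE//.
          by have [_] := Kz; exact.
        by apply: lt_le_trans (r_gt0 n) _; have [_] := Kz; exact.
      apply: le_trans (ler_pM (ltW (c0 n)) (normr_ge0 _) (cr n) h) _.
      rewrite mulrC mulrA mulrA mulVf ?gt_eqF// mul1r mulrC ler_wpM2r ?half_ge0//.
      exact: radius_ratio_le.
    have := rsum_tail dy (leqnn N).
    rewrite /y (rsumM _ (du z Uz)) /series /= big_mkord -mulr_sumr -mulrBr.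
    by rewrite normrM normfV (gtr0_norm rN) ler_pdivrMl// [radius_ratio N * _]mulrC.
  have E n : (z - a n)^-1 = poleRe n z +i* poleIm n z :> C by rewrite pole_partE.
  have h1 := tail poleRe domRe.
  have h2 := tail poleIm domIm.
  have {}h1 := h1 (fun n => eq_ind_r (fun w => `|poleRe n z| <= cabs w) (ler_Re_cabs (poleRe n z +i* poleIm n z : C)) (E n)).
  have {}h2 := h2 (fun n => eq_ind_r (fun w => `|poleIm n z| <= cabs w) (ler_Im_cabs (poleRe n z +i* poleIm n z : C)) (E n)).
  have -> : \sum_(j < N) (c j)%:C / (z - a j) =
    (\sum_(j < N) c j * poleRe j z) +i* (\sum_(j < N) c j * poleIm j z) :> C.
    elim: N {h1 h2 tail} => [|N IH]; first by rewrite !big_ord0.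
    rewrite !big_ord_recr /= IH E.
    by apply/eqP; rewrite eq_complex /=; apply/andP; split; apply/eqP; ring.
  apply: le_trans (ler_cabs_ReIm _) _ => /=.
  apply: le_trans (lerD h1 h2) _; lra.
- move=> z Uz.
  have b0 n : 0 <= c n * bump n z by rewrite mulr_ge0 ?beta_ge0// ltW.
  have SB n : c n * bump n z <= S bump z by apply: rsum_ge_term => //; exact: domB.
  have SB0 : 0 <= S bump z by apply: le_trans (b0 0%N) (SB 0%N).
  have o0 : 0 <= outer z by exact: beta_ge0.
  split; first by rewrite addr_ge0.
  split=> [rz|[Kz1 Kz2]].
    have oz : outer z = 0 by apply/eqP; move: rz; rewrite /rho; lra.
    have Sz : S bump z = 0 by move: rz; rewrite /rho; lra.
    split.
      rewrite leNgt; apply/negP => h; have : 0 < outer z.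
        apply: beta_gt0; rewrite oppr_gt0 ltNge; apply/negP => h'.
        move: h'; rewrite defectE subr_ge0 => h'.
        have : cabs (z - a0) <= R0 by rewrite -(ler_pXn2r (n:=2)) ?nnegrE ?cabs_ge0// ltW.
        by rewrite leNgt h.
      by rewrite oz ltxx.
    move=> n; rewrite leNgt -defect_gt0//; apply/negP => /(beta_gt0 0) bn.
    have := SB n; rewrite Sz leNgt => /negP; apply.
    by rewrite mulr_gt0.
  have oz : outer z = 0.
    rewrite /outer beta_le0// oppr_le0 defectE subr_ge0.
    by rewrite ler_pXn2r ?nnegrE ?cabs_ge0// ltW.
  rewrite /rho oz add0r /S.
  have -> : (fun n => c n * bump n z) = (fun=> 0).
    apply/funext => n; rewrite /bump beta_le0 ?mulr0//.
    by rewrite leNgt defect_gt0// -leNgt; exact: Kz2.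
  exact: rsum0.
- by move=> k; exact: rsmooth_Ck.
- split; first by move=> k; exact: (@rsmooth_Ck R U rho (fun=> 0) k).
  exists (fun z => (outer z * complex.Re z + S (fun n z => bump n z * complex.Re z) z) +i*
                   (outer z * - complex.Im z + S (fun n z => bump n z * - complex.Im z) z)).
    move=> k; apply: rsmooth_Ck; apply: rsmooth_add => //; apply: smO.
      by apply: ES_mul => //; exact: ES_Re.
    by apply: ES_mul => //; apply: ES_opp; exact: ES_Im.
  move=> z Uz.
  have SM (t : R) : S (fun n z => bump n z * t) z = t * S bump z.
    rewrite /S -(rsumM t (domB z Uz)); congr rsum.
    by apply/funext => n; ring.
  have -> : S (fun n z => bump n z * complex.Re z) z = complex.Re z * S bump z by exact: SM.
  have -> : S (fun n z => bump n z * - complex.Im z) z = - complex.Im z * S bump z by exact: SM.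
  rewrite /rho; case: z {Uz} SM => x y _.
  by apply/eqP; rewrite eq_complex /=; apply/andP; split; apply/eqP; ring.
Qed.

End CheeseFunctions.

(** * The algebra of the Swiss cheese *)

Section CheeseAlgebra.
Variable R : realType.
Notation C := (Cplx R).
Variables (a0 : C) (R0 : R) (a : nat -> C) (r : nat -> R).
Hypothesis R0_gt0 : 0 < R0.
Hypothesis r_gt0 : forall n, 0 < r n.
Hypothesis r_le : forall n, r n <= R0 / 8 * 2^-1 ^+ n.
Hypothesis a_in : forall n, cabs (a n - a0) + r n < R0.
Hypothesis a_sep : forall i j, i != j -> r i + r j < cabs (a i - a j).
Notation K := (cheese a0 R0 a r).

Lemma closed_cheese : closed K.
Proof.
rewrite -openC; apply/open_cplxP => z /= /notin_cheeseP[h|[n h]].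
  exists (cabs (z - a0) - R0); first by rewrite subr_gt0.
  by move=> w wz [h' _]; have := ler_cabs_dist z w a0; rewrite (cabs_dist z w); lra.
exists (r n - cabs (z - a n)); first by rewrite subr_gt0.
by move=> w wz [_ /(_ n) h']; have := ler_cabs_dist w z (a n); lra.
Qed.

Lemma compact_cheese : compact K.
Proof.
apply: (@compact_cplx _ _ (R0 + cabs a0)); first exact: closed_cheese.
by move=> z [h _]; have := ler_cabsD (z - a0) a0; rewrite subrK; lra.
Qed.

Lemma cheese_nonempty : K (a0 + R0%:C).
Proof.
apply: outer_circle_cheese => //; rewrite addrC addKr cabs_real ger0_norm//.
exact: ltW.
Qed.

Lemma cheese_dist z w : K z -> K w -> cabs (z - w) <= 2 * R0.
Proof.
move=> [h _] [h' _]; have := ler_cabs_dist z a0 w; rewrite (cabs_dist a0 w); lra.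
Qed.

Lemma cheese_neq z n : K z -> z - a n != 0.
Proof.
by move=> [_ /(_ n) h]; rewrite -cabs_gt0; apply: lt_le_trans h.
Qed.

Lemma notin_cheese_dist b : ~ K b -> exists2 d, 0 < d & forall z, K z -> d <= cabs (z - b).
Proof.
move=> /notin_cheeseP[h|[n h]].
  exists (cabs (b - a0) - R0); first by rewrite subr_gt0.
  by move=> z [hz _]; have := ler_cabs_dist b z a0; rewrite (cabs_dist b z); lra.
exists (r n - cabs (b - a n)); first by rewrite subr_gt0.
by move=> z [_ /(_ n) hz]; have := ler_cabs_dist z b (a n); lra.
Qed.

Variables (c : nat -> R) (F1 : C -> C) (rho : C -> R) (X : set C).
Hypothesis c_gt0 : forall n, 0 < c n.
Hypothesis cX : compact X.
Hypothesis KX : K `<=` X.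
Hypothesis cF1 : ccont X F1.
Hypothesis crho : {within X, continuous rho}.
Hypothesis rho0 : forall z, X z -> rho z = 0 <-> K z.
Hypothesis F1_tail : forall N z, K z ->
  cabs (F1 z - \sum_(j < N) (c j)%:C / (z - a j)) <= 4 * 2^-1 ^+ N * radius_ratio R0 r N.

Definition cheese_gens (j : 'I_3) (z : C) : C :=
  match val j with
  | 0 => F1 z
  | 1 => (rho z)%:C
  | _ => (rho z)%:C * conjc z
  end.
Notation f := cheese_gens.
Notation GX := (generated_algebra f X).
Notation GK := (generated_algebra f K).

Lemma cgens j : ccont X (f j).
Proof.
have cr := ccont_real crho.
case: j => [[|[|j]] hj]; rewrite /cheese_gens /=; [exact: cF1|exact: cr|].
exact: ccontM cr (ccont_conj (@ccont_id R X)).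
Qed.

Lemma cgensK j : ccont K (f j).
Proof. exact: ccont_sub KX (cgens j). Qed.

Let cK := compact_cheese.

(** * Poles and rational functions in the algebra on K *)

Lemma gen_poly (p : {poly C}) : GK (fun z => p.[z]).
Proof. exact (gen_horner cK cgensK p (gen_id f K)). Qed.

Lemma gen_F1 Y : generated_algebra f Y F1.
Proof. exact: (gen_f f Y (@Ordinal 3 0 isT)). Qed.

Lemma gen_rho Y : generated_algebra f Y (fun z => (rho z)%:C).
Proof. exact: (gen_f f Y (@Ordinal 3 1 isT)). Qed.

Lemma gen_rho_conj Y : generated_algebra f Y (fun z => (rho z)%:C * conjc z).
Proof. exact: (gen_f f Y (@Ordinal 3 2 isT)). Qed.

Lemma horner_divided_difference (Q : {poly C}) b :
  exists T : {poly C}, forall z, z != b -> Q.[z] / (z - b) = T.[z] + Q.[b] / (z - b).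
Proof.
have /factor_theorem[T hT] : root (Q - Q.[b]%:P) b.
  by rewrite /root hornerD hornerN hornerC subrr.
exists T => z zb; have z0 : z - b != 0 by rewrite subr_eq0.
have := congr1 (horner^~ z) hT; rewrite !hornerE => hz.
by apply: (mulIf z0); rewrite mulrDl !divfK// -hz subrK.
Qed.

Lemma radius_ratio_cancel N (i : 'I_N) z : K z ->
  cabs (\prod_(j < N | j != i) ((z - a j) / (a i - a j))) * radius_ratio R0 r N <= 1.
Proof.
move=> Kz; have -> : radius_ratio R0 r N =
    \prod_(j < N | j != i) (r j / (2 * R0)) * (r i / (2 * R0)).
  by rewrite mulrC /radius_ratio (bigD1 i).
rewrite mulrA (big_morph (@cabs R) (@cabsM R) (@cabs1 R)) -big_split /=.
have ri := ltW (ratio_gt0 R0_gt0 r_gt0 i).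
rewrite -[leRHS]mulr1 ler_pM//; last exact: ratio_le1.
- by apply: prodr_ge0 => j _; rewrite mulr_ge0 ?cabs_ge0// ltW// ratio_gt0.
- apply: prodr_ile1 => j ji; rewrite mulr_ge0 ?cabs_ge0 ?(ltW (ratio_gt0 R0_gt0 r_gt0 j))//=.
  have nij : val i != val j by apply: contra ji => /eqP E; apply/eqP/val_inj.
  have h1 : r j < cabs (a i - a j) by have := a_sep nij; have := r_gt0 i; lra.
  have h2 : cabs (z - a j) <= 2 * R0.
    have := ler_cabs_dist z a0 (a j); rewrite (cabs_dist a0).
    by have [+ _] := Kz; have := a_in j; have := r_gt0 j; lra.
  have d0 : 0 < cabs (a i - a j) by apply: lt_trans h1.
  rewrite cabsM cabsV mulrACA -[(cabs _)^-1 * _]invfM ?mulr1.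
  rewrite ler_pdivrMr ?mulr_gt0// mul1r [leRHS]mulrC ler_pM ?cabs_ge0// ltW //.
Qed.

(* Lagrange interpolation singles out the pole a i: the partial sum times the
   i-th Lagrange factor is c i / (z - a i) up to a polynomial, and the factor is
   harmless on the tail because the coefficients decay like radius_ratio. *)
Lemma gen_center_pole i : GK (fun z => (z - a i)^-1).
Proof.
apply: gen_closed => e e0.
have ce : 0 < e * c i / 8 by rewrite divr_gt0// mulr_gt0.
have [n0 hn0] := half_small ce.
pose N := maxn n0 i.+1.
have iN : (i < N)%N by exact: leq_maxr.
pose i' := Ordinal iN.
pose Q : {poly C} := \prod_(j < N | j != i') ((a i - a j)^-1 *: ('X - (a j)%:P)).
have Qz z : Q.[z] = \prod_(j < N | j != i') ((z - a j) / (a i - a j)).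
  by rewrite horner_prod; apply: eq_bigr => j _; rewrite !hornerE mulrC.
have Qi : Q.[a i] = 1.
  rewrite Qz big1// => j ji; rewrite divff// -cabs_gt0.
  have nij : i != j by apply: contra ji => /eqP E; apply/eqP/val_inj.
  by have := a_sep nij; have := r_gt0 i; have := r_gt0 j; lra.
have Qj (j : 'I_N) : j != i' -> Q.[a j] = 0.
  by move=> ji; rewrite Qz (bigD1 j)//= subrr mul0r mul0r.
have /choice[T hT] : forall j : nat, exists T : {poly C}, forall z, z != a j ->
  Q.[z] / (z - a j) = T.[z] + Q.[a j] / (z - a j).
  by move=> j; exact: horner_divided_difference.
pose P : {poly C} := \sum_(j < N) (c j)%:C *: T j.
exists (fun z => (c i)%:C^-1 * (F1 z * Q.[z] - P.[z])).
  have gF := gen_F1 K.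
  apply: (genM cK cgensK (gen_cst _ _ _)).
  apply: (genB cK cgensK); last exact: gen_poly.
  by apply: (genM cK cgensK) => //; exact: gen_poly.
move=> z Kz.
have ci0 : ((c i)%:C : C) != 0 by rewrite -cabs_gt0 cabs_real normr_gt0 gt_eqF.
have zn j : z != a j by rewrite -subr_eq0; exact: cheese_neq.
have E : (\sum_(j < N) (c j)%:C / (z - a j)) * Q.[z] = P.[z] + (c i)%:C / (z - a i).
  rewrite mulr_suml /P horner_sum.
  have -> : (c i)%:C / (z - a i) = \sum_(j < N) (c j)%:C * (Q.[a j] / (z - a j)).
    rewrite (bigD1 i')//= Qi div1r big1 ?addr0// => j ji.
    by rewrite Qj// mul0r mulr0.
  rewrite -big_split /=; apply: eq_bigr => j _.
  by rewrite hornerZ -mulrDr -hT// mulrAC mulrA.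
have -> : (z - a i)^-1 - (c i)%:C^-1 * (F1 z * Q.[z] - P.[z]) =
   - ((c i)%:C^-1 * (Q.[z] * (F1 z - \sum_(j < N) (c j)%:C / (z - a j)))).
  have -> : Q.[z] * (F1 z - \sum_(j < N) (c j)%:C / (z - a j)) =
     F1 z * Q.[z] - (P.[z] + (c i)%:C / (z - a i)) by rewrite -E; ring.
  by field; rewrite ci0 cheese_neq.
rewrite cabsN cabsM cabsV cabs_real (gtr0_norm (c_gt0 i)) ltr_pdivrMl// cabsM.
have h1 := F1_tail N Kz.
have h2 : cabs Q.[z] * radius_ratio R0 r N <= 1 by rewrite Qz; exact: (radius_ratio_cancel i').
have h3 := hn0 N (leq_maxl _ _).
apply: le_lt_trans (_ : cabs Q.[z] * (4 * 2^-1 ^+ N * radius_ratio R0 r N) < _).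
  by rewrite ler_wpM2l ?cabs_ge0.
have -> : cabs Q.[z] * (4 * 2^-1 ^+ N * radius_ratio R0 r N) =
  4 * 2^-1 ^+ N * (cabs Q.[z] * radius_ratio R0 r N) by ring.
apply: le_lt_trans (_ : 4 * 2^-1 ^+ N * 1 < _).
  by rewrite ler_wpM2l// mulr_ge0// half_ge0.
rewrite mulr1; have := mulr_gt0 e0 (c_gt0 i); move: h3; rewrite (mulrC (c i)).
lra.
Qed.

(** A Neumann series. It moves the pole from the centre of a hole to any point of that hole, and
    produces the poles beyond the large disc from polynomials. *)
Lemma gen_geometric (g : C -> C) (q : R) : q < 1 -> GK g ->
  (forall z, K z -> cabs (g z) <= q) -> GK (fun z => (1 - g z)^-1).
Proof.
move=> q1 Gg gq; apply: gen_closed => e e0.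
have q0 : 0 <= q by apply: le_trans (gq _ cheese_nonempty); exact: cabs_ge0.
have p0 : 0 < 1 - q by rewrite subr_gt0.
have aq : `|q| < 1 by rewrite ger0_norm.
have ep : 0 < e * (1 - q) by rewrite mulr_gt0.
have /cvgrPdist_lt /(_ _ ep)[n _ /(_ n (leqnn n))] := @cvg_expr R _ aq.
rewrite /= sub0r normrN ger0_norm ?exprn_ge0// => hn.
exists (fun z => \sum_(j < n) g z ^+ j).
  by apply: gen_sum => j; exact: (genX cK cgensK).
move=> z Kz; have d0 : 1 - q <= cabs (1 - g z).
  by have := lerB_cabs 1 (g z); rewrite cabs1; have := gq z Kz; lra.
have d1 : 1 - g z != 0 by rewrite -cabs_gt0; apply: lt_le_trans d0.
have -> : (1 - g z)^-1 - \sum_(j < n) g z ^+ j = g z ^+ n / (1 - g z).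
  apply: (mulIf d1); rewrite mulrBl mulVf// divfK//.
  have E := subrX1 (g z) n.
  have -> : (\sum_(j < n) g z ^+ j) * (1 - g z) = 1 - g z ^+ n.
    by rewrite -(opprB (g z ^+ n)) E; ring.
  by ring.
rewrite cabsM cabsV cabsX ltr_pdivrMr; last exact: lt_le_trans d0.
apply: le_lt_trans (_ : q ^+ n < _).
  by rewrite lerXn2r ?nnegrE ?cabs_ge0 ?gq.
by apply: lt_le_trans hn _; rewrite ler_wpM2l// ltW.
Qed.

Lemma gen_pole b : ~ K b -> GK (fun z => (z - b)^-1).
Proof.
move=> /notin_cheeseP[h|[n h]].
- have b0 : b - a0 != 0 by rewrite -cabs_gt0; apply: lt_trans h.
  have bp : 0 < cabs (b - a0) by rewrite cabs_gt0.
  apply: (@gen_ext R 3 f K (fun z => - (b - a0)^-1 * (1 - (z - a0) * (b - a0)^-1)^-1)).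
    move=> z /set_mem Kz; have zb : z - b != 0.
      apply/eqP => /subr0_eq E; move: Kz; rewrite E => -[h' _].
      by move: h; rewrite ltNge h'.
    have d : b - a0 - (z - a0) != 0.
      by have -> : b - a0 - (z - a0) = - (z - b) by [ring]; rewrite oppr_eq0.
    by field; rewrite b0 zb d.
  apply: (genM cK cgensK (gen_cst _ _ _)).
  apply: (@gen_geometric (fun z => (z - a0) * (b - a0)^-1) (R0 / cabs (b - a0))).
  + by rewrite ltr_pdivrMr// mul1r.
  + apply: (genM cK cgensK); last exact: gen_cst.
    by apply: (genB cK cgensK); [exact: gen_id|exact: gen_cst].
  + by move=> z [hz _]; rewrite cabsM cabsV ler_wpM2r// invr_ge0 cabs_ge0.
- apply: (@gen_ext R 3 f K (fun z => (z - a n)^-1 * (1 - (b - a n) * (z - a n)^-1)^-1)).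
    move=> z /set_mem Kz; have zn := cheese_neq n Kz.
    have zb : z - b != 0.
      apply/eqP => /subr0_eq E; move: Kz; rewrite E => -[_ /(_ n)].
      by rewrite leNgt h.
    have d : z - a n - (b - a n) != 0.
      by have -> : z - a n - (b - a n) = z - b by ring.
    by field; rewrite zn zb; move: d; rewrite opprB addrA.
  have gn := gen_center_pole n.
  apply: (genM cK cgensK) => //.
  apply: (@gen_geometric (fun z => (b - a n) * (z - a n)^-1) (cabs (b - a n) / r n)).
  + by rewrite ltr_pdivrMr// mul1r.
  + by apply: (genM cK cgensK) => //; exact: gen_cst.
  + move=> z [_ /(_ n) hz]; rewrite cabsM cabsV ler_wpM2l ?cabs_ge0// lef_pV2 ?posrE//.
    exact: lt_le_trans hz.
Qed.

Lemma gen_rational g : rational_algebra K g -> GK g.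
Proof.
move=> Rg; apply: gen_closed => e /Rg[_ [p [q [V [_ KV q0 ->]]]] hpq].
exists (fun z => p.[z] / q.[z]) => //.
have [s qE] := closed_field_poly_normal q.
have rts b : List.In b s -> ~ K b.
  move=> bs /KV /q0 /negP; apply; rewrite qE hornerZ horner_prod.
  suff -> : \prod_(i <- s) ('X - i%:P).[b] = 0 by rewrite mulr0.
  elim: s bs {qE} => //= b' s IH [<-|/IH h]; rewrite big_cons.
    by rewrite hornerXsubC subrr mul0r.
  by rewrite h mulr0.
apply: (@gen_ext R 3 f K (fun z => p.[z] * ((lead_coef q)^-1 * \prod_(b <- s) (z - b)^-1))).
  move=> z _; rewrite [in RHS]qE hornerZ horner_prod invfM prodfV.
  by congr (_ * (_ / _)); apply: eq_bigr => b _; rewrite hornerXsubC.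
apply: (genM cK cgensK); first exact: gen_poly.
apply: (genM cK cgensK (gen_cst _ _ _)).
elim: s rts {qE} => [|b s IH] rts.
  by under eq_fun do rewrite big_nil; exact: gen_cst.
under eq_fun do rewrite big_cons; apply: (genM cK cgensK).
  by apply: gen_pole; apply: rts; left.
by apply: IH => b' hb'; apply: rts; right.
Qed.

(** * Functions vanishing on K, and extension from K *)

(** The functions [rho], [rho * Re] and [rho * Im] separate any two distinct points that are not
    both in K, which allows affine interpolation. For two points of K the constant 0 interpolates
    [u]. *)
Lemma gen_vanish_real (u : C -> R) : continuous_on X u -> (forall z, K z -> u z = 0) ->
  GX (fun z => (u z)%:C).
Proof.
move=> cu uK; pose A := [set g : C -> R | GX (fun z => (g z)%:C)].
have Are : A (fun z => rho z * complex.Re z).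
  have G1 : GX (fun z => 2^-1 * ((rho z)%:C * z + (rho z)%:C * conjc z)).
    apply: (genM cX cgens (gen_cst _ _ _)); apply: genD; last exact: gen_rho_conj.
    by apply: (genM cX cgens); [exact: gen_rho|exact: gen_id].
  apply: gen_ext G1 => z _; rewrite -mulrDr addcJ; case: z => x y /=.
  by rewrite rmorphM; field.
have Aim : A (fun z => rho z * complex.Im z).
  have G1 : GX (fun z => (2 * 'i%C)^-1 * ((rho z)%:C * z - (rho z)%:C * conjc z)).
    apply: (genM cX cgens (gen_cst _ _ _)); apply: (genB cX cgens); last exact: gen_rho_conj.
    by apply: (genM cX cgens); [exact: gen_rho|exact: gen_id].
  have i0 : ('i%C : C) != 0 by rewrite eq_complex /= oner_eq0 andbF.
  apply: gen_ext G1 => z _; rewrite -mulrBr subcJ; case: z => x y /=.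
  by rewrite rmorphM; field.
apply: (@stone_weierstrass R C X A cX) => //.
- by move=> t; exact: gen_cst.
- move=> g h Ag Ah; rewrite /A /=; under eq_fun do rewrite rmorphD; exact: genD.
- move=> g h Ag Ah; rewrite /A /=; under eq_fun do rewrite rmorphM; exact: (genM cX cgens).
- move=> h H; apply: gen_closed => e /H[g Ag gh]; exists (fun z => (g z)%:C) => // z /gh.
  by rewrite -rmorphB cabs_real.
- move=> g Ag; apply/continuous_onP.
  exact: (within_Re (gen_cont cgens Ag)).
- move=> x y Xx Xy.
  have sep (phi : C -> R) : A phi -> phi x != phi y -> exists2 g, A g & g x = u x /\ g y = u y.
    move=> Aphi pxy; have d0 : phi y - phi x != 0 by rewrite subr_eq0 eq_sym.
    exists (fun z => u x + (u y - u x) / (phi y - phi x) * (phi z - phi x)); last first.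
      by rewrite subrr mulr0 addr0 divfK// addrC subrK.
    rewrite /A /=; under eq_fun do rewrite rmorphD rmorphM rmorphB.
    apply: genD; first exact: gen_cst.
    apply: (genM cX cgens); first exact: gen_cst.
    by apply: (genB cX cgens); [exact: Aphi|exact: gen_cst].
  have [E1|/sep h] := eqVneq (rho x) (rho y); last exact/h/gen_rho.
  have [r0|rn0] := eqVneq (rho x) 0.
    have kx := iffLR (rho0 Xx) r0; have ky : K y by apply/(rho0 Xy); rewrite -E1.
    exists (fun=> 0); last by rewrite !uK.
    exact: gen_cst.
  have [E2|h] := eqVneq (rho x * complex.Re x) (rho y * complex.Re y); last exact: (sep _ Are h).
  have [E3|h] := eqVneq (rho x * complex.Im x) (rho y * complex.Im y); last exact: (sep _ Aim h).
  exists (fun=> u x); first exact: gen_cst.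
  split=> //; congr u; apply/eqP; rewrite eq_complex; apply/andP; split; apply/eqP.
    by apply: (mulfI rn0); rewrite E2 E1.
  by apply: (mulfI rn0); rewrite E3 E1.
Qed.

Lemma gen_vanish h : ccont X h -> (forall z, K z -> h z = 0) -> GX h.
Proof.
move=> ch hK.
have Gre : GX (fun z => (complex.Re (h z))%:C).
  apply: gen_vanish_real; first by apply/continuous_onP; exact: within_Re.
  by move=> z /hK ->.
have Gim : GX (fun z => (complex.Im (h z))%:C).
  apply: gen_vanish_real; first by apply/continuous_onP; exact: within_Im.
  by move=> z /hK ->.
apply: (@gen_ext R 3 f X (fun z => (complex.Re (h z))%:C + 'i%C * (complex.Im (h z))%:C)).
  by move=> z _; rewrite -complexE.
by apply: genD => //; apply: (genM cX cgens) => //; exact: gen_cst.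
Qed.

Lemma within_max (u v : C -> R) : {within X, continuous u} -> {within X, continuous v} ->
  {within X, continuous (fun z => Num.max (u z) (v z))}.
Proof. by move=> cu cv x; apply: continuous_max; [exact: cu|exact: cv]. Qed.

Lemma within_cst (t : R) : {within X, continuous (fun _ : C => t)}.
Proof. by apply/continuous_onP => z Xz e e0; apply/nbhs_cplxP; exists 1 => // w _ _; rewrite subrr normr0. Qed.

Lemma withinV (u : C -> R) : {within X, continuous u} -> (forall z, u z != 0) ->
  {within X, continuous (fun z => (u z)^-1)}.
Proof. by move=> cu u0 x; apply: continuousV; [exact: u0|exact: cu]. Qed.

Lemma withinM (u v : C -> R) : {within X, continuous u} -> {within X, continuous v} ->
  {within X, continuous (fun z => u z * v z)}.
Proof. by move=> cu cv x; apply: continuousM; [exact: cu|exact: cv]. Qed.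

Lemma withinB (u v : C -> R) : {within X, continuous u} -> {within X, continuous v} ->
  {within X, continuous (fun z => u z - v z)}.
Proof. by move=> cu cv x; apply: continuousB; [exact: cu|exact: cv]. Qed.

(** The modulus is lowered by [eta] and cut off at 0, the argument being kept. The denominator
    [max(eta, |h|)] stays away from 0, which makes continuity immediate. *)
Lemma truncation h (eta : R) : 0 < eta -> ccont X h -> exists h', [/\ ccont X h',
  forall z, cabs (h z - h' z) <= eta & forall z, cabs (h z) <= eta -> h' z = 0].
Proof.
move=> eta0 ch; have ca := within_cabs ch.
have m0 z : 0 < Num.max eta (cabs (h z)) by rewrite lt_max eta0.
pose k z : R := Num.max 0 (cabs (h z) - eta) * (Num.max eta (cabs (h z)))^-1.
exists (fun z => h z * (k z)%:C); split.
- apply: ccontM => //; apply: ccont_real; apply: withinM.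
    by apply: within_max; [exact: within_cst|apply: withinB => //; exact: within_cst].
  by apply: withinV; [apply: within_max => //; exact: within_cst|move=> z; rewrite gt_eqF].
- move=> z; have -> : h z - h z * (k z)%:C = h z * (1 - k z)%:C.
    by rewrite rmorphB rmorph1; ring.
  rewrite cabsM cabs_real /k.
  have [hz|hz] := leP (cabs (h z)) eta.
    have -> : Num.max 0 (cabs (h z) - eta) = 0 by apply/max_idPl; rewrite subr_le0.
    by rewrite mul0r subr0 normr1 mulr1.
  have -> : Num.max 0 (cabs (h z) - eta) = cabs (h z) - eta.
    by apply/max_idPr; rewrite subr_ge0 ltW.
  have hz0 : cabs (h z) != 0 by rewrite gt_eqF// (lt_trans eta0).
  have -> : 1 - (cabs (h z) - eta) / cabs (h z) = eta / cabs (h z) by field.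
  rewrite ger0_norm; first by rewrite mulrC divfK.
  by rewrite divr_ge0 ?cabs_ge0// ltW.
- move=> z hz; have -> : k z = 0.
    by rewrite /k (_ : Num.max 0 _ = 0) ?mul0r//; apply/max_idPl; rewrite subr_le0.
  by rewrite mulr0.
Qed.

(** Approximate [g] on K by a polynomial in the generators: their difference on X is small on K,
    hence close to a function vanishing on K, which is in the algebra. *)
Lemma gen_extend g : ccont X g -> GK g -> GX g.
Proof.
move=> cg Gg; apply: gen_closed => e e0; have e2 : 0 < e / 2 by rewrite divr_gt0.
have [p hp] := iffLR (genP _ _ _) Gg _ e2.
have cp := cont_polyval_graph cgens p.
have [h [ch hclose hK]] := truncation e2 (ccontB cg cp).
exists (fun z => h z + polyval p (graph_point f z)).
  apply: genD; last exact: gen_polyval.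
  by apply: gen_vanish => // z Kz; apply: hK; rewrite ltW// hp.
move=> z Xz; apply: le_lt_trans (_ : e / 2 < e); last by lra.
rewrite opprD addrCA addrC -addrA addrC [- _ + _]addrC -addrA.
by have := hclose z; congr (cabs _ <= _); ring.
Qed.

(** * The polynomial hull of the graph *)

Lemma hull_le v p (B : R) : poly_hull (graph f X) v ->
  (forall z, X z -> cabs (polyval p (graph_point f z)) <= B) -> cabs (polyval p v) <= B.
Proof.
move=> /(_ p) hv hB; apply: le_trans hv _; apply: ge_sup.
  by exists (cabs (polyval p (graph_point f (a0 + R0%:C)))), (graph_point f (a0 + R0%:C)) => //;
    exists (a0 + R0%:C) => //; exact/KX/cheese_nonempty.
by move=> _ [_ [z Xz <-] <-]; exact: hB.
Qed.

Lemma ccontV g : ccont X g -> (forall z, X z -> g z != 0) -> ccont X (fun z => (g z)^-1).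
Proof.
move=> /cont_funP cg g0; apply/cont_funP.
have {}cg := iffLR (subspace_continuousP X g) cg.
apply: (iffRL (subspace_continuousP X (fun z => (g z)^-1))) => z Xz.
by apply: cvgV; [exact: g0|exact: cg].
Qed.

Lemma ccont_sum (I : Type) (s : seq I) (g : I -> C -> C) :
  (forall i, ccont X (g i)) -> ccont X (fun z => \sum_(i <- s) g i z).
Proof.
move=> h; elim: s => [|i s IH]; first by under eq_fun do rewrite big_nil; exact: ccont_cst.
by under eq_fun do rewrite big_cons; exact: ccontD.
Qed.

Lemma polyval_sum n (I : Type) (s : seq I) (F : I -> mpoly n C) v :
  polyval (\sum_(i <- s) F i) v = \sum_(i <- s) polyval (F i) v.
Proof. exact: (big_morph (fun p => polyval p v) (fun p q => polyvalD p q v) (meval0 _)). Qed.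

(* Off the graph the coordinate differences have no common zero on X, so every h
   vanishing on K is a combination of them with coefficients in the algebra. *)
Lemma hull_vanish v h p (e : R) : poly_hull (graph f X) v -> ~ graph f X v ->
  ccont X h -> (forall z, K z -> h z = 0) ->
  (forall z, X z -> cabs (h z - polyval p (graph_point f z)) <= e) ->
  cabs (polyval p v) <= e.
Proof.
move=> hv ngv ch hK hp.
pose l (i : 'I_4) z := graph_point f z ord0 i - v ord0 i.
have cl i : ccont X (l i).
  apply: ccontB; last exact: ccont_cst.
  case: (unliftP ord0 i) => [j ->|->].
    by under eq_fun do rewrite graph_pointS; exact: cgens.
  by under eq_fun do rewrite graph_point0; exact: ccont_id.
pose T z : C := \sum_i l i z * conjc (l i z).
have T0 z : X z -> T z != 0.
  move=> Xz; apply/eqP => T0; apply: ngv; exists z => //.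
  have TE : T z = (\sum_i cabs (l i z) ^+ 2)%:C.
    by rewrite /T rmorph_sum; apply: eq_bigr => i _; rewrite mul_conjc_cabs.
  move: T0; rewrite TE => /complexI /eqP; rewrite psumr_eq0 => [|i _]; last exact: sqr_ge0.
  move=> /allP li; apply/rowP => i.
  have := li i (mem_index_enum i); rewrite /= expf_eq0 /= cabs_eq0 subr_eq0.
  by move=> /eqP.
have cT : ccont X T by apply: ccont_sum => i; apply: ccontM => //; exact: ccont_conj.
pose u i z := h z * conjc (l i z) * (T z)^-1.
have Gu i : GX (u i).
  apply: gen_vanish; last by move=> z Kz; rewrite /u hK// !mul0r.
  by apply: ccontM; [apply: ccontM => //; exact: ccont_conj|exact: ccontV].
have hE z : X z -> h z = \sum_i u i z * l i z.
  move=> Xz; have -> : \sum_i u i z * l i z = h z * (T z)^-1 * T z.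
    by rewrite /T mulr_sumr; apply: eq_bigr => i _; rewrite /u; ring.
  by rewrite divfK// T0.
have /choice[B hB] : forall i, exists B : R, 0 < B /\ forall z, X z -> cabs (l i z) <= B.
  by move=> i; have [B B0 hB] := ccont_bounded cX (cl i); exists B.
pose S := \sum_i B i; have S0 : 0 < S.
  rewrite /S big_ord_recl ltr_wpDr ?(hB ord0).1//.
  by apply: sumr_ge0 => i _; rewrite ltW// (hB _).1.
apply/ler_addgt0Pr => d d0; have dS : 0 < d / S by rewrite divr_gt0.
have /choice[q hq] : forall i, exists q, forall z, X z ->
    cabs (u i z - polyval q (graph_point f z)) < d / S.
  by move=> i; exact: (iffLR (genP _ _ _) (Gu i) _ dS).
(* The correction vanishes at [v] and is nearly [h] on the graph. So [Q] has the value of [p] at [v]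
   and is nearly as small on the graph as [p - h]. *)
pose Q : mpoly 4 C := p - \sum_i q i * (mpolyX C (mnm1 i) - mpolyC 4 (v ord0 i)).
have QE w : polyval Q w = polyval p w - \sum_i polyval (q i) w * (w ord0 i - v ord0 i).
  rewrite /Q polyvalB polyval_sum; congr (_ - _); apply: eq_bigr => i _.
  by rewrite polyvalM polyvalB polyvalX polyvalC.
have -> : polyval p v = polyval Q v.
  by rewrite QE big1 ?subr0// => i _; rewrite subrr mulr0.
apply: hull_le hv _ => z Xz; rewrite QE.
have -> : polyval p (graph_point f z) -
    \sum_i polyval (q i) (graph_point f z) * (graph_point f z ord0 i - v ord0 i) =
  \sum_i (u i z - polyval (q i) (graph_point f z)) * l i z -
    (h z - polyval p (graph_point f z)).
  rewrite hE//; under [in RHS]eq_bigr do rewrite mulrBl.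
  by rewrite sumrB /l; ring.
apply: le_trans (ler_cabsB _ _) _; rewrite addrC lerD ?hp//.
apply: le_trans (ler_cabs_sum _ _ _) _.
apply: le_trans (_ : \sum_i d / S * B i <= _); last by rewrite -mulr_sumr divfK// gt_eqF.
apply: ler_sum => i _; rewrite cabsM ler_pM ?cabs_ge0 ?(hB i).2// ltW// hq//.
Qed.

(** A hull point off the graph already lies in the hull of the part of the graph over K: truncating
    [p] leaves a function that vanishes on K and differs from [p] by at most [eta]. *)
Lemma hull_cheese_bound v p (eta : R) : 0 < eta -> poly_hull (graph f X) v ->
  ~ graph f X v -> (forall z, K z -> cabs (polyval p (graph_point f z)) <= eta) ->
  cabs (polyval p v) <= eta.
Proof.
move=> eta0 hv ngv hp; have cp := cont_polyval_graph cgens p.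
have [h [ch hclose hK]] := truncation eta0 cp.
apply: (hull_vanish hv ngv ch) => [z Kz|z Xz]; first by apply: hK; exact: hp.
by rewrite cabs_dist; exact: hclose.
Qed.

(** For [F1] the quotient is the divided difference of a partial sum, a combination of the poles
    [1 / (z - a j)] and thus in the algebra on K. The other two generators vanish on K. *)
Lemma gens_divided_approx j z0 (e : R) : K z0 -> 0 < e -> exists p, forall z, K z ->
  cabs (f j z - f j z0 - (z - z0) * polyval p (graph_point f z)) <= e.
Proof.
move=> Kz0 e0.
have zero (g : C -> C) : (forall z, K z -> g z = 0) -> exists p, forall z, K z ->
  cabs (g z - g z0 - (z - z0) * polyval p (graph_point f z)) <= e.
  by move=> g0; exists (mpolyC 4 0) => z Kz; rewrite !g0// polyvalC subrr mulr0 subr0 cabs0 ltW.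
have rho_eq0 z : K z -> rho z = 0 by move=> Kz; apply/(rho0 (KX Kz)).
case: j => [[|[|j]] hj]; last 2 first.
- by apply: zero => z Kz; rewrite /cheese_gens /= rho_eq0.
- by apply: zero => z Kz; rewrite /cheese_gens /= rho_eq0// mul0r.
rewrite /cheese_gens /=.
have e16 : 0 < e / 16 by rewrite divr_gt0.
have [N /(_ N (leqnn N)) hN] := half_small e16.
have ratio1 : radius_ratio R0 r N <= 1.
  by apply: le_trans (radius_ratio_le R0_gt0 r_gt0 r_le (leq0n N)) _; rewrite /radius_ratio big_ord0.
pose s z : C := \sum_(j < N) (c j)%:C / (z - a j).
have tail z : K z -> cabs (F1 z - s z) <= e / 4.
  move=> Kz; apply: le_trans (F1_tail N Kz) _.
  apply: le_trans (_ : 4 * 2^-1 ^+ N * 1 <= _).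
    by rewrite ler_wpM2l// mulr_ge0// half_ge0.
  by lra.
pose k z : C := \sum_(j < N) - ((c j)%:C / (z0 - a j)) * (z - a j)^-1.
have Gk : GK k.
  apply: gen_sum => j; apply: (genM compact_cheese cgensK); first exact: gen_cst.
  exact: gen_center_pole.
have eR : 0 < e / (4 * R0) by rewrite divr_gt0// mulr_gt0.
have [p hp] := iffLR (genP _ _ _) Gk _ eR.
exists p => z Kz.
have sE : s z - s z0 = (z - z0) * k z.
  rewrite /s /k mulr_sumr -sumrB; apply: eq_bigr => j _.
  have zj := cheese_neq j Kz; have z0j := cheese_neq j Kz0.
  by field; rewrite zj z0j.
have -> : F1 z - F1 z0 - (z - z0) * polyval p (graph_point f z) =
   (F1 z - s z) - (F1 z0 - s z0) + (z - z0) * (k z - polyval p (graph_point f z)).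
  by rewrite mulrBr -sE; ring.
apply: le_trans (ler_cabsD _ _) _; rewrite cabsM.
have h1 := ler_cabsB (F1 z - s z) (F1 z0 - s z0).
have h2 := tail z Kz; have h3 := tail z0 Kz0.
have h4 : cabs (z - z0) * cabs (k z - polyval p (graph_point f z)) <= 2 * R0 * (e / (4 * R0)).
  by rewrite ler_pM ?cabs_ge0 ?cheese_dist// ltW// hp.
have h5 : 2 * R0 * (e / (4 * R0)) = e / 2 by field; rewrite gt_eqF.
lra.
Qed.

Lemma graph_polynomially_convex : polynomially_convex (graph f X).
Proof.
split; first exact: (compact_graph cX cgens).
apply/seteqP; split => [v hv|v gv p]; last first.
  have [w Xw wv] := gv; have [B B0 hB] := ccont_bounded cX (cont_polyval_graph cgens p).
  apply: ub_le_sup; last by exists v.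
  by exists B => _ [_ [z Xz <-] <-]; exact: hB.
apply: contrapT => ngv; set z0 := v ord0 ord0.
have Kz0 : K z0.
  apply: contrapT => nK; have Gp := gen_pole nK.
  have [D D0 hD] := ccont_bounded compact_cheese (ccontB (@ccont_id R K) (@ccont_cst R K z0)).
  have D2 : 0 < (2 * D)^-1 by rewrite invr_gt0 mulr_gt0.
  have [p hp] := iffLR (genP _ _ _) Gp _ D2.
  (* With [p] close to [1 / (z - z0)] on K, [Q] is at most 1/2 over K although its value at [v] is
     -1. *)
  pose Q : mpoly 4 C := (mpolyX C (mnm1 ord0) - mpolyC 4 z0) * p - mpolyC 4 1.
  have h2 : 0 < 2^-1 :> R by rewrite invr_gt0.
  have := @hull_cheese_bound v Q 2^-1 h2 hv ngv.
  rewrite /Q polyvalB polyvalM polyvalB polyvalX !polyvalC -/z0 subrr mul0r sub0r cabsN cabs1.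
  suff H : forall z, K z -> cabs (polyval Q (graph_point f z)) <= 2^-1 by move=> /(_ H); lra.
  move=> z Kz; rewrite /Q polyvalB polyvalM polyvalB polyvalX !polyvalC graph_point0.
  have zz : z - z0 != 0 by apply/eqP => /subr0_eq E; apply: nK; rewrite -E.
  have -> : (z - z0) * polyval p (graph_point f z) - 1 =
    - ((z - z0) * ((z - z0)^-1 - polyval p (graph_point f z))).
    by rewrite mulrBr mulfV//; ring.
  rewrite cabsN cabsM.
  apply: le_trans (_ : D * (2 * D)^-1 <= _); last by rewrite invfM mulrCA mulfV ?mulr1// gt_eqF.
  by rewrite ler_pM ?cabs_ge0 ?hD// ltW// hp.
apply: (ngv); exists z0; first exact: KX.
apply/rowP => i; case: (unliftP ord0 i) => [j ->|->]; last by rewrite graph_point0.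
rewrite graph_pointS; apply/eqP; rewrite eq_sym -subr_eq0 -cabs_eq0; apply/eqP.
apply: le_anti; rewrite cabs_ge0 andbT; apply/ler_addgt0Pr => e e0; rewrite add0r.
have [p hp] := gens_divided_approx j Kz0 e0.
(* At [v] the last product vanishes, so [Q] takes there the value that has to be shown to be zero,
   while it is at most [e] over K. *)
pose Q : mpoly 4 C := mpolyX C (mnm1 (lift ord0 j)) - mpolyC 4 (f j z0) -
  (mpolyX C (mnm1 ord0) - mpolyC 4 z0) * p.
have := @hull_cheese_bound v Q e e0 hv ngv.
rewrite /Q !polyvalB polyvalM !polyvalB !polyvalX !polyvalC -/z0 subrr mul0r subr0.
apply=> z Kz; rewrite !polyvalB polyvalM polyvalB !polyvalX !polyvalC graph_point0 graph_pointS.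
exact: hp.
Qed.

(** * Empty interior of the cheese and the Shilov boundary *)

Hypothesis dense_holes : forall z (e : R), 0 < e -> cabs (z - a0) < R0 ->
  exists w i, cabs (w - z) < e /\ cabs (w - a i) < r i.

Lemma cheese_no_interior z (e : R) : K z -> 0 < e -> exists2 w, cabs (w - z) < e & ~ K w.
Proof.
move=> [zR _] e0; have [zin|zout] := ltP (cabs (z - a0)) R0.
  have [w [i [wz wi]]] := dense_holes e0 zin.
  by exists w => // -[_ /(_ i)]; rewrite leNgt wi.
have zE : cabs (z - a0) = R0 by apply/le_anti; rewrite zR zout.
(* A point of the outer circle is pushed outwards by [e / 2]. *)
pose t : R := e / (2 * R0); have t0 : 0 < t by rewrite divr_gt0// mulr_gt0.
exists (z + t%:C * (z - a0)).
  rewrite addrC addKr cabsM cabs_real gtr0_norm// zE /t.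
  have -> : e / (2 * R0) * R0 = e / 2 by field; rewrite gt_eqF.
  lra.
move=> [h _]; move: h; have -> : z + t%:C * (z - a0) - a0 = (1 + t)%:C * (z - a0).
  by rewrite rmorphD rmorph1; ring.
rewrite cabsM cabs_real zE gtr0_norm ?addr_gt0// leNgt => /negP; apply.
by rewrite mulrDl mul1r ltrDl mulr_gt0.
Qed.

Lemma shilov_boundary_gens : closed X -> is_shilov_boundary X GX X.
Proof.
move=> clX; have X0 : X !=set0 by exists (a0 + R0%:C); exact/KX/cheese_nonempty.
split; first split => //.
  by move=> g Gg; exact: cabs_attains_max cX X0 (gen_cont cgens Gg).
move=> E [clE EX maxE] x Xx; apply: contrapT => nEx.
have [d d0 hd] : exists2 d, 0 < d & forall w, cabs (w - x) < d -> ~ E w.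
  by apply: (iffLR (open_cplxP (~` E))) => //; exact: closed_openC.
have cdist b : ccont X (fun z => z - b) := ccontB (@ccont_id R X) (@ccont_cst R X b).
have [Kx|nKx] := pselect (K x); last first.
  have [d1 d10 hd1] := notin_cheese_dist nKx.
  pose d' := Num.min d d1; have d'0 : 0 < d' by rewrite lt_min d0.
  pose h z : C := (Num.max 0 (d' - cabs (z - x)))%:C.
  have hfar z : d' <= cabs (z - x) -> h z = 0.
    by move=> hz; rewrite /h (_ : Num.max 0 _ = 0)//; apply/max_idPl; rewrite subr_le0.
  have Gh : GX h.
    apply: gen_vanish => [|z Kz]; last by apply: hfar; rewrite ge_min hd1 ?orbT.
    apply: ccont_real; apply: within_max; first exact: within_cst.
    by apply: withinB; [exact: within_cst|exact: within_cabs].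
  have [y Ey hy] := maxE h Gh; have := hy x Xx.
  rewrite (hfar y); last first.
    by rewrite leNgt; apply/negP => yx; apply: (hd y) => //; apply: lt_le_trans yx _; rewrite ge_min lexx.
  rewrite cabs0 /h subrr cabs0 subr0 cabs_real.
  have -> : Num.max 0 d' = d' by apply/max_idPr; exact: ltW.
  by rewrite gtr0_norm// leNgt d'0.
have d3 : 0 < d / 3 by rewrite divr_gt0.
(* The pole is within [d / 3] of [x], whereas points of [E] are at distance at least [d] from [x],
   hence more than [2 * d / 3] from [w]: the modulus is strictly larger at [x]. *)
have [w wx nKw] := cheese_no_interior Kx d3.
have [s s0 hs] := notin_cheese_dist nKw.
have sx : s <= cabs (x - w) by exact: hs.
pose m z : R := Num.max s (cabs (z - w)).
have m0 z : 0 < m z by rewrite lt_max s0.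
(* A continuous extension of [1 / (z - w)] to X: the two agree where the distance to [w] is at least
   [s], in particular on K, and the algebra contains every such extension. *)
pose g z : C := conjc (z - w) * (((m z)^-1) ^+ 2)%:C.
have gE z : s <= cabs (z - w) -> g z = (z - w)^-1.
  move=> hz; rewrite /g /m (_ : Num.max _ _ = cabs (z - w)); last exact/max_idPr.
  by rewrite invc_norm normE -rmorphXn -fmorphV exprVn mulrC.
have Gg : GX g.
  apply: gen_extend.
    apply: ccontM; first exact: ccont_conj.
    apply: ccont_real; under eq_fun do rewrite expr2.
    have cm : {within X, continuous (fun z => (m z)^-1)}.
      apply: withinV; first by apply: within_max; [exact: within_cst|exact: within_cabs].
      by move=> z; rewrite gt_eqF.
    exact: withinM.
  apply: gen_ext (gen_pole nKw) => z /set_mem Kz; rewrite gE//; exact: hs.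
have [y Ey hy] := maxE g Gg.
have yx : d <= cabs (y - x).
  by rewrite leNgt; apply/negP => yx; exact: (hd y).
have yw : 2 * d / 3 < cabs (y - w).
  by have := ler_cabs_dist y w x; lra.
have := hy x Xx; rewrite cabs_dist in wx.
rewrite !gE//; last by apply: le_trans sx _; lra.
rewrite !cabsV lef_pV2 ?posrE; [lra|exact: lt_le_trans s0 sx|].
by apply: lt_trans yw; rewrite divr_gt0// mulr_gt0.
Qed.

(** * Absence of holomorphic discs *)

Lemma derivable_quotient (g : C -> C) z : derivable g z 1 -> exists l : C,
  forall e : R, 0 < e -> exists2 d : R, 0 < d & forall h : C, h != 0 -> cabs h < d ->
    cabs (h^-1 * (g (z + h) - g z) - l) < e.
Proof.
move=> /cvg_ex[l hl]; exists l => e e0.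
have /cvg_cplxP /(_ e e0) := hl; rewrite near_withinE => /nbhs_cplxP[d d0 hd].
exists d => // h h0 hh; have := hd h; rewrite subr0 => /(_ hh h0) /=.
by rewrite /GRing.scale /= mulr1 (addrC h).
Qed.

(* If u and u * conj were both holomorphic near a point where u does not vanish,
   the difference quotient of conj would have the same limit, namely 1 and -1,
   along the real and the imaginary direction. *)
Lemma conj_not_derivable (u : C -> C) w : u w != 0 -> derivable u w 1 ->
  derivable (fun z => u z * conjc z) w 1 -> False.
Proof.
move=> uw /derivable_quotient[l hl] /derivable_quotient[l' hl'].
have U0 : 0 < cabs (u w) by rewrite cabs_gt0.
pose eta := cabs (u w) / 4; have eta0 : 0 < eta by rewrite divr_gt0.
have W0 : 0 < 1 + cabs w by rewrite ltr_wpDr ?cabs_ge0.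
have eW : 0 < eta / (1 + cabs w) by rewrite divr_gt0.
have L0 : 0 < 1 + cabs l by rewrite ltr_wpDr ?cabs_ge0.
have [d1 d10 h1] := hl 1 ltr01.
have [d2 d20 h2] := hl _ eW.
have [d3 d30 h3] := hl' _ eta0.
pose d := Num.min (Num.min d1 d2) (Num.min d3 (eta / (1 + cabs l))).
have d0 : 0 < d by rewrite !lt_min d10 d20 d30 divr_gt0.
pose L := l' - conjc w * l.
have key (h : C) : h != 0 -> cabs h = d / 2 ->
    cabs (h^-1 * conjc h * u (w + h) - L) <= 2 * eta /\ cabs (u (w + h) - u w) <= eta.
  move=> h0 hE; have hd : cabs h < d by rewrite hE; lra.
  move: hd; rewrite !lt_min => /andP[/andP[hd1 hd2] /andP[hd3 hd4]].
  have k1 := h1 h h0 hd1; have k2 := h2 h h0 hd2; have k3 := h3 h h0 hd3.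
  split.
    have -> : h^-1 * conjc h * u (w + h) - L =
       (h^-1 * (u (w + h) * conjc (w + h) - u w * conjc w) - l') -
       conjc w * (h^-1 * (u (w + h) - u w) - l).
      by rewrite /L rmorphD; ring.
    apply: le_trans (ler_cabsB _ _) _; rewrite cabsM cabs_conj.
    have : cabs w * cabs (h^-1 * (u (w + h) - u w) - l) <= eta.
      rewrite ltr_pdivlMr// in k2.
      by have := cabs_ge0 (h^-1 * (u (w + h) - u w) - l); lra.
    lra.
  have -> : u (w + h) - u w = h * ((h^-1 * (u (w + h) - u w) - l) + l).
    by rewrite subrK mulrA mulfV// mul1r.
  rewrite cabsM; rewrite ltr_pdivlMr// in hd4.
  have := ler_cabsD (h^-1 * (u (w + h) - u w) - l) l.
  have := cabs_ge0 h; have := cabs_ge0 l => cl ch hD.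
  apply: le_trans (_ : cabs h * (1 + cabs l) <= _); last exact: ltW.
  by rewrite ler_wpM2l//; lra.
have d2' : 0 < d / 2 by rewrite divr_gt0.
have c1 : cabs ((d / 2)%:C : C) = d / 2 by rewrite cabs_real gtr0_norm.
have i1 : cabs ('i%C : C) = 1 by rewrite cabsE /= expr0n expr1n add0r sqrtr1.
have c2 : cabs ('i%C * (d / 2)%:C : C) = d / 2 by rewrite cabsM i1 mul1r.
have n1 : ((d / 2)%:C : C) != 0 by rewrite -cabs_gt0 c1.
have n2 : ('i%C * (d / 2)%:C : C) != 0 by rewrite -cabs_gt0 c2.
have [] := key _ n1 c1; have [] := key _ n2 c2.
have -> : ((d / 2)%:C : C)^-1 * conjc ((d / 2)%:C : C) = 1 by rewrite conjc_real mulVf.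
have -> : ('i%C * (d / 2)%:C : C)^-1 * conjc ('i%C * (d / 2)%:C : C) = -1.
  have -> : conjc ('i%C * (d / 2)%:C : C) = - ('i%C * (d / 2)%:C).
    by apply/eqP; rewrite eq_complex /=; apply/andP; split; apply/eqP; ring.
  by rewrite mulrN mulVf.
rewrite mul1r mulN1r => m1 m2 m3 m4.
have : cabs (2 * u w) <= 6 * eta.
  have -> : 2 * u w = - (u (w + (d / 2)%:C) - u w) + (u (w + (d / 2)%:C) - L)
     - (- u (w + 'i%C * (d / 2)%:C) - L) - (u (w + 'i%C * (d / 2)%:C) - u w) by ring.
  move: m1 m2 m3 m4; set x1 := - u _ - L; set x2 := u _ - u w; set x3 := u _ - L; set x4 := u _ - u w.
  move=> m1 m2 m3 m4; have := ler_cabsB (- x4 + x3 - x1) x2.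
  have := ler_cabsB (- x4 + x3) x1; have := ler_cabsD (- x4) x3; rewrite cabsN; lra.
have c22 : cabs (2 : C) = 2 by rewrite /cabs normr_nat.
rewrite cabsM c22 /eta; lra.
Qed.

Lemma gens_no_disk b (s : R) : 0 < s -> ball b (s%:C : C) `<=` X ->
  ~ (forall j, holomorphic_on (ball b (s%:C : C)) (f j)).
Proof.
move=> s0 bX hol.
have [w bw nKw] : exists2 w, ball b (s%:C : C) w & ~ K w.
  have [Kb|nKb] := pselect (K b); last by exists b => //; apply/ball_cplxE; rewrite subrr cabs0.
  by have [w wb nKw] := cheese_no_interior Kb s0; exists w => //; apply/ball_cplxE.
apply: (@conj_not_derivable (fun z => (rho z)%:C) w).
- have rw : rho w <> 0 by move/(rho0 (bX _ bw)).
  by rewrite -cabs_gt0 cabs_real normr_gt0; apply/eqP.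
- exact: (hol (@Ordinal 3 1 isT) w bw).
- exact: (hol (@Ordinal 3 2 isT) w bw).
Qed.

(** * Properness through uniform limits of simple poles *)

Definition pole_sum (p : seq (C * C)) (z : C) : C := \sum_(q <- p) q.1 / (z - q.2).

Definition pole_closure (g : C -> C) := forall e : R, 0 < e ->
  exists2 p : seq (C * C), (forall q, List.In q p -> ~ K q.2) &
    forall z, K z -> cabs (g z - pole_sum p z) < e.

(** Multipliers are closed under products by composition, so only constants and generators have to
    be tested. Since 1 is a limit of pole sums, every multiplier is one too. *)
Definition pole_multiplier (g : C -> C) :=
  forall h, pole_closure h -> pole_closure (fun z => g z * h z).

Lemma pc_closed g : (forall e : R, 0 < e -> exists2 h, pole_closure h &
  forall z, K z -> cabs (g z - h z) < e) -> pole_closure g.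
Proof.
move=> H e e0; have e2 : 0 < e / 2 by rewrite divr_gt0.
have [h /(_ _ e2)[p hp ph] gh] := H _ e2; exists p => // z Kz.
by apply: le_lt_trans (ler_cabs_dist _ (h z) _) _; rewrite [e]splitr ltrD ?gh ?ph.
Qed.

Lemma pc_ext g h : (forall z, K z -> h z = g z) -> pole_closure g -> pole_closure h.
Proof.
by move=> gh Pg; apply: pc_closed => e e0; exists g => // z Kz; rewrite gh// subrr cabs0.
Qed.

Lemma pc_sum (p : seq (C * C)) : (forall q, List.In q p -> ~ K q.2) -> pole_closure (pole_sum p).
Proof. by move=> hp e e0; exists p => // z Kz; rewrite subrr cabs0. Qed.

Lemma pcD g h : pole_closure g -> pole_closure h -> pole_closure (fun z => g z + h z).
Proof.
move=> Pg Ph e e0; have e2 : 0 < e / 2 by rewrite divr_gt0.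
have [p hp gp] := Pg _ e2; have [q hq gq] := Ph _ e2.
exists (p ++ q); first by move=> x /(@List.in_app_or _ p q)[/hp|/hq].
move=> z Kz; rewrite /pole_sum big_cat /= opprD addrACA.
by apply: le_lt_trans (ler_cabsD _ _) _; rewrite [e]splitr ltrD ?gp ?gq.
Qed.

Lemma pcZ (k : C) g : pole_closure g -> pole_closure (fun z => k * g z).
Proof.
move=> Pg e e0; have k0 : 0 < 1 + cabs k by rewrite ltr_wpDr ?cabs_ge0.
have ek : 0 < e / (1 + cabs k) by rewrite divr_gt0.
have [p hp gp] := Pg _ ek.
exists [seq (k * q.1, q.2) | q <- p].
  by elim: p hp {gp} => //= q p IH hp x [<-|/IH]; [apply: (hp q); left|apply=> y yp; apply: hp; right].
move=> z Kz; rewrite /pole_sum big_map /=.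
have -> : \sum_(q <- p) k * q.1 / (z - q.2) = k * pole_sum p z.
  by rewrite /pole_sum mulr_sumr; apply: eq_bigr => q _; rewrite mulrA.
rewrite -mulrBr cabsM; have := gp z Kz; rewrite ltr_pdivlMr// => h.
by have := cabs_ge0 (g z - pole_sum p z); lra.
Qed.

Lemma pc_bounded g : pole_closure g -> exists2 B : R, 0 < B & forall z, K z -> cabs (g z) <= B.
Proof.
move=> /(_ 1 ltr01)[p hp gp].
have [B B0 hB] : exists2 B : R, 0 < B & forall z, K z -> cabs (pole_sum p z) <= B.
  elim: p hp {gp} => [|q p IH] hp.
    by exists 1 => // z _; rewrite /pole_sum big_nil cabs0.
  have [|B B0 hB] := IH; first by move=> x xp; apply: hp; right.
  have [d d0 hd] := notin_cheese_dist (hp q (or_introl erefl)).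
  exists (cabs q.1 / d + B); first by rewrite ltr_wpDl// divr_ge0 ?cabs_ge0// ltW.
  move=> z Kz; rewrite /pole_sum big_cons; apply: le_trans (ler_cabsD _ _) _.
  rewrite lerD ?hB// cabsM cabsV ler_wpM2l ?cabs_ge0// lef_pV2 ?posrE ?hd//.
  exact: lt_le_trans (hd z Kz).
exists (B + 1) => [|z Kz]; first by rewrite addr_gt0.
have := ler_cabsD (g z - pole_sum p z) (pole_sum p z); rewrite subrK.
by have := gp z Kz; have := hB z Kz; lra.
Qed.

Lemma pm_closed g : (forall e : R, 0 < e -> exists2 h, pole_multiplier h &
  forall z, K z -> cabs (g z - h z) < e) -> pole_multiplier g.
Proof.
move=> H k Pk; have [B B0 hB] := pc_bounded Pk.
apply: pc_closed => e e0; have eB : 0 < e / B by rewrite divr_gt0.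
have [h Mh gh] := H _ eB; exists (fun z => h z * k z); first exact: Mh.
move=> z Kz; rewrite -mulrBl cabsM; have := gh z Kz; rewrite ltr_pdivlMr// => h1.
by apply: le_lt_trans h1; rewrite ler_wpM2l ?cabs_ge0 ?hB.
Qed.

Lemma pm_ext g h : (forall z, K z -> h z = g z) -> pole_multiplier g -> pole_multiplier h.
Proof. by move=> gh Mg k Pk; apply: pc_ext (Mg k Pk) => z Kz; rewrite gh. Qed.

Lemma pmD g h : pole_multiplier g -> pole_multiplier h -> pole_multiplier (fun z => g z + h z).
Proof.
move=> Mg Mh k Pk; apply: pc_ext (pcD (Mg k Pk) (Mh k Pk)) => z _.
by rewrite mulrDl.
Qed.

Lemma pmM g h : pole_multiplier g -> pole_multiplier h -> pole_multiplier (fun z => g z * h z).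
Proof.
by move=> Mg Mh k Pk; apply: pc_ext (Mg _ (Mh k Pk)) => z _; rewrite mulrA.
Qed.

Lemma pm_cst k : pole_multiplier (fun=> k).
Proof. by move=> h Ph; exact: pcZ. Qed.

Lemma pc_pole (k b : C) : ~ K b -> pole_closure (fun z => k / (z - b)).
Proof.
move=> nb; apply: (@pc_ext (pole_sum [:: (k, b)])); last by apply: pc_sum => q [<-|].
by move=> z _; rewrite /pole_sum big_seq1.
Qed.

Lemma notin_neq z b : K z -> ~ K b -> z - b != 0.
Proof. by move=> Kz nb; apply/eqP => /subr0_eq E; apply: nb; rewrite -E. Qed.

(** Distinct poles separate by partial fractions. A double pole is approximated by moving one of its
    two factors slightly. *)
Lemma pc_two_poles b b' : ~ K b -> ~ K b' -> pole_closure (fun z => (z - b)^-1 * (z - b')^-1).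
Proof.
move=> nb nb'.
have neq x : ~ K x -> x != b' -> pole_closure (fun z => (z - x)^-1 * (z - b')^-1).
  move=> nx xb; apply: pc_ext (pcD (pc_pole (x - b')^-1 nx) (pc_pole (- (x - b')^-1) nb')).
  move=> z Kz; have z1 := notin_neq Kz nx; have z2 := notin_neq Kz nb'.
  have z3 : x - b' != 0 by rewrite subr_eq0.
  by field; rewrite z1 z2 z3.
have [E|/neq] := eqVneq b b'; last exact.
rewrite {}E in nb *; apply: pc_closed => e e0.
have [d d0 hd] := notin_cheese_dist nb'.
(* The first bound keeps the shifted pole at distance [d / 2] from K. The error is then at most
   [t * 2 / d ^+ 3], which the second bound makes at most [e / 2]. *)
pose t : R := Num.min (d / 2) (e * d ^+ 3 / 4).
have t0 : 0 < t by rewrite lt_min !divr_gt0// mulr_gt0// exprn_gt0.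
pose x := b' + t%:C.
have xd z : K z -> d / 2 <= cabs (z - x).
  move=> Kz; have := ler_cabs_dist z x b'; rewrite /x addrAC subrr add0r cabs_real gtr0_norm//.
  have : t <= d / 2 by rewrite ge_min lexx.
  by have := hd z Kz; rewrite /x; lra.
have nx : ~ K x by move=> Kx; have := xd x Kx; rewrite subrr cabs0; lra.
have xb : x != b'.
  by rewrite -subr_eq0 /x addrAC subrr add0r -cabs_gt0 cabs_real gtr0_norm.
exists (fun z => (z - x)^-1 * (z - b')^-1); first exact: neq.
move=> z Kz; have z1 := notin_neq Kz nx; have z2 := notin_neq Kz nb'.
have -> : (z - b')^-1 * (z - b')^-1 - (z - x)^-1 * (z - b')^-1 =
   - t%:C * ((z - b')^-1 * (z - b')^-1 * (z - x)^-1).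
  move: z1; rewrite /x opprD addrA => z1.
  by field; rewrite z1 z2.
rewrite cabsM cabsN cabs_real gtr0_norm// !cabsM !cabsV.
have p1 : (cabs (z - b'))^-1 <= d^-1.
  by rewrite lef_pV2 ?posrE ?hd//; apply: lt_le_trans (hd z Kz).
have p2 : (cabs (z - x))^-1 <= (d / 2)^-1.
  rewrite lef_pV2 ?posrE ?xd//; last exact: divr_gt0.
  by apply: lt_le_trans (xd z Kz); exact: divr_gt0.
have i0 y : 0 <= (cabs y)^-1 by rewrite invr_ge0 cabs_ge0.
apply: le_lt_trans (_ : t * (d^-1 * d^-1 * (d / 2)^-1) < _).
  apply: ler_wpM2l; first exact: ltW.
  by apply: ler_pM; rewrite ?mulr_ge0 ?i0//; apply: ler_pM; rewrite ?i0.
have : t <= e * d ^+ 3 / 4 by rewrite ge_min lexx orbT.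
move=> ht; apply: le_lt_trans (_ : e * d ^+ 3 / 4 * (d^-1 * d^-1 * (d / 2)^-1) < _).
  by rewrite ler_wpM2r// !mulr_ge0 ?invr_ge0 ?divr_ge0// ltW.
have -> : e * d ^+ 3 / 4 * (d^-1 * d^-1 * (d / 2)^-1) = e / 2 by field; rewrite gt_eqF.
lra.
Qed.

Lemma pm_pole b : ~ K b -> pole_multiplier (fun z => (z - b)^-1).
Proof.
move=> nb h Ph; have [d d0 hd] := notin_cheese_dist nb.
apply: pc_closed => e e0; have ed : 0 < e * d by rewrite mulr_gt0.
have [p hp happ] := Ph _ ed.
exists (fun z => (z - b)^-1 * pole_sum p z).
  elim: p hp {happ} => [|q p IH] hp.
    apply: pc_ext (pc_sum (p := [::]) _); last by [].
    by move=> z _; rewrite /pole_sum big_nil mulr0.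
  have Pq := pcZ q.1 (pc_two_poles nb (hp q (or_introl erefl))).
  have Pp : pole_closure (fun z => (z - b)^-1 * pole_sum p z).
    by apply: IH => x xp; apply: hp; right.
  apply: pc_ext (pcD Pq Pp) => z _; rewrite /pole_sum big_cons; ring.
move=> z Kz; rewrite -mulrBr cabsM cabsV mulrC ltr_pdivrMr.
  by apply: lt_le_trans (happ z Kz) _; rewrite ler_wpM2l ?hd// ltW.
exact: lt_le_trans (hd z Kz).
Qed.

(** As [b] goes to infinity, [- b / (z - b)] tends to 1 and [- b * (1 + b / (z - b))] tends to [z],
    uniformly on K. The two bounded quantities are the errors, so simple poles alone reach the
    constants and the coordinate. *)
Lemma far_point (e : R) : 0 < e -> exists2 b : C, ~ K b & b != 0 /\ forall z, K z ->
  cabs (z / (z - b)) < e /\ cabs (z * (z / (z - b))) < e.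
Proof.
move=> e0; pose B := R0 + cabs a0.
have hB z : K z -> cabs z <= B.
  by move=> [h _]; have := ler_cabsD (z - a0) a0; rewrite subrK /B; lra.
have B0 : 0 < B by rewrite ltr_wpDr ?cabs_ge0.
pose t := B + (B + B * B) / e + 1.
have q0 : 0 <= (B + B * B) / e by rewrite divr_ge0 ?(ltW e0)// addr_ge0 ?mulr_ge0 ?(ltW B0).
have tB : B < t by rewrite /t; lra.
have ct : cabs (t%:C : C) = t by rewrite cabs_real gtr0_norm//; apply: lt_trans tB.
exists t%:C; first by move=> /hB; rewrite ct leNgt tB.
split; first by rewrite -cabs_gt0 ct; apply: lt_trans tB.
move=> z Kz; have zB := hB z Kz; have z0 := cabs_ge0 z.
have D : (B + B * B) / e < cabs (z - t%:C).
  by have := lerB_cabs t%:C z; rewrite ct cabs_dist /t; lra.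
have D0 : 0 < cabs (z - t%:C) by apply: le_lt_trans D.
rewrite ltr_pdivrMr// in D.
have h1 : cabs z * cabs z <= B * B by rewrite ler_pM.
have BB : 0 < B * B by rewrite mulr_gt0.
by split; rewrite !cabsM cabsV ?mulrA ltr_pdivrMr//; lra.
Qed.

Lemma pc_one : pole_closure (fun=> 1).
Proof.
apply: pc_closed => e e0; have [b nb [b0 hb]] := far_point e0.
exists (fun z => - b / (z - b)); first exact: pc_pole.
move=> z Kz; have zb := notin_neq Kz nb.
have -> : 1 - - b / (z - b) = z / (z - b) by field.
by have [] := hb z Kz.
Qed.

Lemma pm_id : pole_multiplier (fun z => z).
Proof.
apply: pm_closed => e e0; have [b nb [b0 hb]] := far_point e0.
exists (fun z => - b * (1 + b * (z - b)^-1)).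
  apply: (pmM (pm_cst (- b))); apply: (pmD (pm_cst 1)).
  by apply: (pmM (pm_cst b)); exact: pm_pole.
move=> z Kz; have zb := notin_neq Kz nb.
have -> : z - - b * (1 + b / (z - b)) = z * (z / (z - b)) by field.
by have [] := hb z Kz.
Qed.

Lemma center_notin j : ~ K (a j).
Proof. by move=> [_ /(_ j)]; rewrite subrr cabs0 leNgt r_gt0. Qed.

Lemma pm_gens j : pole_multiplier (f j).
Proof.
have rho_eq0 z : K z -> rho z = 0 by move=> Kz; apply/(rho0 (KX Kz)).
case: j => [[|[|j]] hj]; rewrite /cheese_gens /=.
- apply: pm_closed => e e0.
  have e4 : 0 < e / 4 by rewrite divr_gt0.
  have [N /(_ N (leqnn N)) hN] := half_small e4.
  exists (fun z => \sum_(j < N) (c j)%:C / (z - a j)).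
    elim: N {hN} => [|N IH].
      by apply: pm_ext (pm_cst 0) => z _; rewrite big_ord0.
    have Mp := pmM (pm_cst ((c N)%:C)) (pm_pole (@center_notin N)).
    by apply: pm_ext (pmD IH Mp) => z _; rewrite big_ord_recr.
  move=> z Kz; apply: le_lt_trans (F1_tail N Kz) _.
  have ratio1 : radius_ratio R0 r N <= 1.
    by apply: le_trans (radius_ratio_le R0_gt0 r_gt0 r_le (leq0n N)) _; rewrite /radius_ratio big_ord0.
  apply: le_lt_trans (_ : 4 * 2^-1 ^+ N * 1 < _); last by lra.
  by rewrite ler_wpM2l// mulr_ge0// half_ge0.
- by apply: pm_ext (pm_cst 0) => z /rho_eq0 ->.
- by apply: pm_ext (pm_cst 0) => z /rho_eq0 ->; rewrite mul0r.
Qed.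

Lemma conj_not_gen : ~ GK (fun z => conjc z).
Proof.
move=> Gc; have e4 : 0 < R0 / 4 by rewrite divr_gt0.
have : pole_closure (fun z => conjc z).
  apply: pc_closed => e /Gc[h [p ->] hp].
  exists (fun z => polyval p (graph_point f z)) => //.
  have Mp : pole_multiplier (fun z => polyval p (graph_point f z)).
    apply: (polyval_graph_ind (S := pole_multiplier)).
    - exact: pm_cst.
    - exact: pm_id.
    - exact: pm_gens.
    - by move=> g k; exact: pmD.
    - by move=> g k; exact: pmM.
  by apply: pc_ext (Mp _ pc_one) => z _; rewrite mulr1.
move=> /(_ _ e4)[p hp happ].
exact: (conj_not_poles R0_gt0 r_gt0 r_le a_in a_sep hp happ).
Qed.

Lemma gens_neq_cont : GX <> cont_fun X.
Proof.
move=> E; apply: conj_not_gen.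
have : GX (fun z => conjc z).
  by rewrite E; apply/cont_funP; exact: ccont_conj (@ccont_id R X).
move=> /genP H; apply/genP => e /H[p hp]; exists p => z /KX; exact: hp.
Qed.

End CheeseAlgebra.

Theorem theorem1p9 (R : realType) (Omega : set (Cplx R))
    (Omega_neq0 : Omega !=set0) (Omega_bounded : bounded_set Omega)
    (Omega_open : open Omega) :
  exists (f : 'I_3 -> Cplx R -> Cplx R) (K : set (Cplx R)),
    (forall j, smooth_up_to_boundary Omega (f j)) /\
    (compact K /\ K `<=` Omega) /\
    polynomially_convex (graph f (closure Omega)) /\
    (is_shilov_boundary (closure Omega)
       (generated_algebra f (closure Omega)) (closure Omega) /\
     ~ (exists (a : Cplx R) (r : R),
          [/\ 0 < r, ball a (r%:C : Cplx R) `<=` Omega &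
              forall j, holomorphic_on (ball a (r%:C : Cplx R)) (f j)])) /\
    [set g | cont_fun (closure Omega) g /\ rational_algebra K g]
      `<=` generated_algebra f (closure Omega) /\
    generated_algebra f (closure Omega) <> cont_fun (closure Omega).
Proof.
have [a0 Oa0] := Omega_neq0.
have [d d0 hd] := iffLR (open_cplxP Omega) Omega_open a0 Oa0.
(* Half of [d], so that the closed disc, and not only the open one, lies in Omega. *)
pose R0 := d / 2; have R0_gt0 : 0 < R0 by rewrite divr_gt0.
have [a [r [r_gt0 r_le a_in a_sep dense]]] := swiss_cheese_exists a0 R0_gt0.
pose K := cheese a0 R0 a r; pose X := closure Omega.
have [M M0 hM] := bounded_cplxP Omega_bounded.
have XM z : X z -> cabs z <= M.
  move=> /closure_cplxP Xz; apply/ler_addgt0Pr => e /Xz[w /hM h wz].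
  by have := lerB_cabs z w; rewrite cabs_dist; lra.
have cX : compact X by apply: compact_cplx XM; exact: closed_closure.
have KO : K `<=` Omega.
  by move=> z [h _]; apply: hd; apply: le_lt_trans h _; rewrite /R0; lra.
have KX : K `<=` X by move=> z /KO; exact: subset_closure.
(* A bounded open neighbourhood of the closure; boundedness is what lets the elementary functions
   and all their derivatives be tamed by the coefficients. *)
pose U := [set z : Cplx R | cabs z < M + 1].
have XU z : X z -> U z by move=> /XM h; rewrite /U /=; lra.
have [c [F1 [rho [c0 tail rhoP smF1 [smrho [F3 smF3 F3E]]]]]] :=
  cheese_functions_exist a0 a R0_gt0 r_gt0 (M + 1) r_le.
have sm_ccont g : (forall k, Ck_on k U g) -> ccont X g.
  move=> /(_ 0%N)[cg _] z Xz e e0.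
  have [s s0 hs] := iffLR (continuous_cplxP g z) (cg z (XU z Xz)) e e0.
  by exists s => // w _; exact: hs.
have cF1 := sm_ccont F1 smF1.
have crho : {within X, continuous rho} := within_Re (sm_ccont _ smrho).
have rho0 z : X z -> rho z = 0 <-> K z by move=> /XU /rhoP[].
have F1_tail N z : K z -> cabs (F1 z - \sum_(j < N) (c j)%:C / (z - a j)) <=
    4 * 2^-1 ^+ N * radius_ratio R0 r N.
  by move=> Kz; apply: tail => //; exact/XU/KX.
exists (cheese_gens F1 rho), K.
split.
  move=> j; exists U.
  have oU : open U by exact: open_U.
  case: j => [[|[|j]] hj]; [exists F1|exists (fun z => (rho z)%:C)|exists F3]; split => //.
  by move=> z /XU /F3E.
split; first by split=> //; exact: compact_cheese.
split.
  exact: (graph_polynomially_convex R0_gt0 r_gt0 r_le a_in a_sep c0 cX KX cF1 crho rho0 F1_tail).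
split.
  split.
    exact: (shilov_boundary_gens R0_gt0 r_gt0 r_le a_in a_sep c0 cX KX cF1 crho rho0 F1_tail dense
      (@closed_closure _ Omega)).
  move=> [b [s [s0 bO hol]]].
  apply: (gens_no_disk R0_gt0 rho0 dense s0 _ hol).
  by move=> z /bO; exact: subset_closure.
split.
  move=> g [/cont_funP cg Rg].
  apply: (gen_extend cX cF1 crho rho0) => //.
  exact: (gen_rational R0_gt0 r_gt0 r_le a_in a_sep c0 KX cF1 crho F1_tail).
exact: (gens_neq_cont R0_gt0 r_gt0 r_le a_in a_sep KX rho0 F1_tail).
Qed.
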